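(* Let $G$ be an $n$-vertex unicyclic graph with matching number $m$, where $2\le m\le\lfloor n/2\rfloor$. (i) If $m=2$ (i.e. among the graphs in $\mathscr{U}_{n,2}$), then $\xi^d(G)\ge 4n^2-9n+1$, with equality if and only if $G\cong U_{n,2}$. (ii) If $m=3$ and $n\le 9$, then $\xi^d(G)\ge 6n^2-5n-53$, with equality if and only if $G\cong U_{n,3}'$; while if $m=3$ and $n\ge 10$, then $\xi^d(G)\ge 6n^2-9n-14$, with equality if and only if $G\cong U_{n,3}$. (iii) If $m\ge 4$ and $n\ge 9$, then $\xi^d(G)\ge 6n^2+m^2+9mn-30m-31n+57$, with equality if and only if $G\cong U_{n,m}$.
   Context: All graphs are finite, simple and connected. For a graph $G$ and $v\in V_G$, $d(u,v)$ is the usual graph distance, $\varepsilon_G(v)=\max_{u\in V_G} d(u,v)$ is the eccentricity, and $D_G(v)=\sum_{u\in V_G} d(u,v)$. The eccentric distance sum is $\xi^d(G)=\sum_{v\in V_G}\varepsilon_G(v)D_G(v)$. A unicyclic graph is a connected graph with $|V_G|=|E_G|$. The matching number is the maximum number of pairwise independent edges. $\mathscr{U}_{n,m}$ is the set of unicyclic graphs with $n$ vertices and matching number $m$. $U_{n,m}$ (for $m\ge 2$) is the $n$-vertex graph obtained from a triangle $C_3=u_1u_2u_3u_1$ by attaching $n-2m+1$ pendant vertices and $m-2$ pendant paths of length $2$ (each by identifying one of its end vertices with $u_1$) to the single vertex $u_1$. $U_{n,m}'$ (for $m\ge 3$) is the $n$-vertex graph obtained from a cycle $C_5=u_1u_2u_3u_4u_5u_1$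 by attaching $n-2m+1$ pendant vertices and $m-3$ pendant paths of length $2$ (each by identifying one of its end vertices with $u_2$) to the single vertex $u_2$. *)

(* Defs.v *)
From mathcomp Require Import all_boot.

Set Implicit Arguments.
Unset Strict Implicit.
Unset Printing Implicit Defensive.

Record sgraph := SGraph {
  vertex :> finType;
  adj : rel vertex;
  adj_sym : symmetric adj;
  adj_irr : irreflexive adj
}.

Definition isomorphic (G H : sgraph) : Prop :=
  exists2 f : G -> H, bijective f & forall x y, adj (f x) (f y) = adj x y.

Definition edges (G : sgraph) : {set {set G}} :=
  [set [set p.1; p.2] | p : G * G & adj p.1 p.2].

Definition connected (G : sgraph) : Prop :=
  forall x y : G, connect (@adj G) x y.

Definition unicyclic (G : sgraph) : Prop :=
  connected G /\ #|G| = #|edges G|.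

(* Least length of a walk from u to v; the value is #|G| if there is none,
   and a walk of length less than #|G| always exists when G is connected. *)
Definition dist (G : sgraph) (u v : G) : nat :=
  find (fun k => [exists p : k.-tuple G, path (@adj G) u p && (last u p == v)])
       (iota 0 #|G|).

Definition eccentricity (G : sgraph) (v : G) : nat := \max_(u : G) dist u v.

Definition dist_sum (G : sgraph) (v : G) : nat := \sum_(u : G) dist u v.

Definition ecc_dist_sum (G : sgraph) : nat :=
  \sum_(v : G) eccentricity v * dist_sum v.

Definition matching (G : sgraph) (M : {set {set G}}) : bool :=
  (M \subset edges G) && trivIset M.

Definition matching_number (G : sgraph) : nat :=
  \max_(M : {set {set G}} | matching M) #|M|.

Section SymClosure.
Variables (T : finType) (r : rel T).

Definition sym_adj : rel T := fun x y => (x != y) && (r x y || r y x).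

Lemma sym_adj_sym : symmetric sym_adj.
Proof. by move=> x y; rewrite /sym_adj eq_sym orbC. Qed.

Lemma sym_adj_irr : irreflexive sym_adj.
Proof. by move=> x; rewrite /sym_adj eqxx. Qed.

Definition sym_graph : sgraph := SGraph sym_adj_sym sym_adj_irr.

End SymClosure.

(* The cycle C_k with a pendant vertices and b pendant paths of length 2
   attached at the vertex c.  An end of each pendant path is identified with c,
   so a path contributes two new vertices: inr (j, false), adjacent to c, and
   inr (j, true), the leaf. *)
Section CycleAttach.
Variables (k a b : nat) (c : 'I_k).

Definition cycle_attach_vertex : finType := ('I_k + 'I_a + 'I_b * bool)%type.

Definition cycle_attach_arc (x y : cycle_attach_vertex) : bool :=
  match x, y with
  | inl (inl i), inl (inl j) => j == ordS i
  | inl (inl i), inl (inr _) => i == c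
  | inl (inl i), inr (_, false) => i == c
  | inr (i, false), inr (j, true) => i == j
  | _, _ => false
  end.

Definition cycle_attach : sgraph := sym_graph cycle_attach_arc.

End CycleAttach.

(* U_{n,m}, with n vertices when 2 <= m <= n / 2. *)
Definition U_graph (n m : nat) : sgraph :=
  @cycle_attach 3 (n - 2 * m + 1) (m - 2) ord0.

(* U'_{n,m}, with n vertices when 3 <= m <= n / 2; index 1 stands for u_2. *)
Definition U'_graph (n m : nat) : sgraph :=
  @cycle_attach 5 (n - 2 * m + 1) (m - 3) (Ordinal (isT : 1 < 5)).

(* Main.v *)
(* Root a unicyclic graph with n vertices at c, with a breadth-first spanning tree: there is one
   further edge xy.  The vertices not adjacent to c, together with c and x, cover all edges,
   so deg c <= n - m + 1, and equality forces the graph to be U_{n,m}, whose eccentric distance sum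
   is computed directly.  It remains to show that graphs with all degrees at most n - m are not
   better (except for the pentagon U'_{n,3}).

   For m = 2 this follows from eccentricities at least 2 and D(v) >= 2n - 2 - deg v.  For m >= 3
   argue by induction on n.  If two leaves share a neighbour w, removing one of them keeps m, and
   the loss is large because only few neighbours of w can have eccentricity 2: two adjacent vertices
   of eccentricity 2 give a vertex cover of size 3.  If a leaf hangs at a vertex of degree 2, either
   both are removed (m >= 5) or the bound is direct (m = 3, 4), from
     sum D(v) >= 3n^2 - 8n - sum (deg v - 1)^2,
   which comes from counting walks of length at most 2.  Otherwise the graph is a cycle with at most
   one leaf at each of its vertices, where the same estimate applies; only here, with n = 6, and
   by adding twin leaves, does the pentagon appear. *)

Require Import Defs.
From mathcomp Require Import all_boot all_order all_algebra.
From mathcomp Require Import zify.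

Set Implicit Arguments.
Unset Strict Implicit.
Unset Printing Implicit Defensive.

(** The tight case is [m = 3] with twin leaves. Deleting one of them at a vertex of degree [n - 3]
    is only guaranteed to lose [12 n - 11], exactly the increment of [6 n^2 - 5 n - 53]. No slack is
    left, so the equality case travels through the induction together with the bound; this is why
    [lower_bounds] mentions [pendant_pentagon]. The two candidate values for [m = 3] differ by
    [4 n - 39], whence the threshold between 9 and 10. Small eccentricities are exploited around a
    vertex [c] of eccentricity at most 2. Vertices in different branches at [c] are joined by a
    geodesic through [c] unless the extra edge [xy] links their branches. A second vertex of small
    eccentricity therefore confines the vertices at distance 2 from [c] to at most two branches, and
    this yields small vertex covers. Numerical estimates are pointwise inequalities summed over all
    vertices. Corrections appear as indicator terms added to one side, which avoids truncated
    subtraction. *)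

(** * Distances *)

Section Distance.
Variable G : sgraph.
Implicit Types u v w : G.

Lemma dist_le_walk u p : path (@adj G) u p -> dist u (last u p) <= size p.
Proof.
move=> pth; rewrite /dist leqNgt; apply/negP => lt.
have lt2 : size p < #|G|.
  by apply: leq_trans lt _; rewrite -[X in _ <= X](size_iota 0) find_size.
have := before_find 0 lt; rewrite nth_iota // add0n => /negbT /existsPn /(_ (in_tuple p)).
by rewrite /= pth eqxx.
Qed.

Lemma connect_dist_lt u v : connect (@adj G) u v -> dist u v < #|G|.
Proof.
move=> /connectP[q qp eqv]; case: (shortenP qp) eqv => q' q'p uq _ ->.
apply: leq_ltn_trans (dist_le_walk q'p) _.
have : size (u :: q') <= #|G| by rewrite -(card_uniqP uq) max_card.
by [].
Qed.

Lemma connect_walk u v : connect (@adj G) u v ->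
  exists p, [/\ path (@adj G) u p, last u p = v & size p = dist u v].
Proof.
move=> /connect_dist_lt lev.
have : has (fun k => [exists p : k.-tuple G, path (@adj G) u p && (last u p == v)])
           (iota 0 #|G|) by rewrite has_find size_iota.
move=> /(nth_find 0); rewrite -/(dist u v) nth_iota // add0n.
move=> /existsP[p /andP[pp /eqP lp]].
by exists p; rewrite size_tuple.
Qed.

(* A distance function is recognised by being 1-Lipschitz along edges and by admitting a descent
   step. *)
Lemma dist_unique v (d : G -> nat) :
  d v = 0 -> (forall u w, adj u w -> d u <= (d w).+1) ->
  (forall u, u != v -> exists2 w, adj u w & d w < d u) ->
  forall u, dist u v = d u /\ connect (@adj G) u v.
Proof.
move=> d0 lip desc u.
have walk : exists p, [/\ path (@adj G) u p, last u p = v & size p <= d u].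
  have [k] := ubnP (d u); elim: k u => // k IH u /ltnSE ltk.
  have [->|neq] := eqVneq u v; first by exists [::].
  have [w uw lt] := desc u neq.
  have [|p [pth lst sz]] := IH w; first exact: leq_trans lt ltk.
  by exists (w :: p); rewrite /= uw pth lst; split=> //; apply: leq_ltn_trans lt.
have lb p w : path (@adj G) w p -> d w <= d (last w p) + size p.
  elim: p w => [|y p IH] w /=; first by rewrite addn0.
  by move=> /andP[wy /IH le]; have := lip _ _ wy; lia.
have [p [pth lst sz]] := walk.
split; last by apply/connectP; exists p.
apply/eqP; rewrite eqn_leq; apply/andP; split.
  by apply: leq_trans sz; rewrite -lst dist_le_walk.
have [|q [qp lq <-]] := @connect_walk u v; first by apply/connectP; exists p.
by have := lb _ _ qp; rewrite lq d0.
Qed.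

Hypothesis conG : connected G.

Lemma dist_walk u v :
  exists p, [/\ path (@adj G) u p, last u p = v & size p = dist u v].
Proof. exact: connect_walk. Qed.

Lemma distxx v : dist v v = 0.
Proof. by apply/eqP; rewrite -leqn0; apply: (@dist_le_walk v [::]). Qed.

Lemma dist_eq0 u v : (dist u v == 0) = (u == v).
Proof.
apply/eqP/eqP => [|->]; last exact: distxx.
by have [p [_ <- <-]] := dist_walk u v; case: p.
Qed.

Lemma dist_lip u w v : adj u w -> dist u v <= (dist w v).+1.
Proof.
move=> uw; have [p [pp <- <-]] := dist_walk w v.
by apply: (@dist_le_walk u (w :: p)); rewrite /= uw.
Qed.

Lemma dist_desc u v : u != v -> exists2 w, adj u w & dist u v = (dist w v).+1.
Proof.
have [p [pp <- sz]] := dist_walk u v; case: p pp sz => [|w p] /=; first by rewrite eqxx.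
move=> /andP[uw pp] sz _; exists w => //.
apply/eqP; rewrite eqn_leq dist_lip //= -sz ltnS.
exact: dist_le_walk.
Qed.

Lemma dist_tri u v w : dist u w <= dist u v + dist v w.
Proof.
have [p [pp lp <-]] := dist_walk u v; have [q [qp lq <-]] := dist_walk v w.
rewrite -size_cat -lq -lp -last_cat; apply: dist_le_walk.
by rewrite cat_path pp lp.
Qed.

Lemma dist_sym u v : dist u v = dist v u.
Proof.
suff le (a b : G) : dist a b <= dist b a by apply/eqP; rewrite eqn_leq !le.
have [k] := ubnP (dist b a); elim: k b => // k IH b /ltnSE ltk.
have [->|neq] := eqVneq b a; first by rewrite distxx.
have [w bw e] := dist_desc neq; have := IH w; rewrite e in ltk *.
move=> /(_ ltk) le; apply: leq_trans (dist_tri a w b) _.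
have : dist w b <= 1 by rewrite adj_sym in bw; rewrite -(distxx b) dist_lip.
lia.
Qed.

Lemma dist_eq1 u v : (dist u v == 1) = adj u v.
Proof.
apply/eqP/idP => [e|uv].
  have : u != v by rewrite -dist_eq0 e.
  by move=> /dist_desc[w uw]; rewrite e => -[] /esym /eqP; rewrite dist_eq0 => /eqP <-.
have := dist_lip v uv; rewrite distxx; have : dist u v != 0.
  by rewrite dist_eq0; apply: contraTneq uv => ->; rewrite adj_irr.
lia.
Qed.

Lemma dist_le_ecc u v : dist u v <= eccentricity v.
Proof. exact: (leq_bigmax u). Qed.

End Distance.

(** * Degrees, matchings and vertex covers *)

Definition degree (G : sgraph) (v : G) : nat := \sum_(u : G) adj v u.

Section DegreesMatchings.
Variable G : sgraph.
Implicit Types (u v : G) (M N : {set {set G}}) (C : {set G}).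

Lemma degree_card v : degree v = #|[set u | adj v u]|.
Proof. by rewrite /degree -sum1dep_card [RHS]big_mkcond; apply: eq_bigr => u _; case: adj. Qed.

Lemma sum_degree : \sum_(v : G) degree v = 2 * #|edges G|.
Proof.
pose f (p : G * G) := [set p.1; p.2].
rewrite pair_big /=; transitivity (\sum_(p : G * G | adj p.1 p.2) 1).
  by rewrite [RHS]big_mkcond; apply: eq_bigr => p _; case: adj.
rewrite (partition_big f (mem (edges G))) /=; last first.
  by move=> p ap; apply/imsetP; exists p => //; rewrite inE.
rewrite mulnC -sum_nat_const; apply: eq_bigr => E /imsetP[[a b] /= ab ->].
rewrite inE /= in ab; have neq : a != b by apply: contraTneq ab => ->; rewrite adj_irr.
rewrite sum1dep_card.
rewrite (_ : [set x | _] = [set (a, b); (b, a)]); first by rewrite cards2 xpair_eqE negb_and neq.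
apply/setP=> -[c d]; rewrite !inE /= !xpair_eqE.
apply/andP/idP => [[cd /eqP eq]|].
  have: c \in [set a; b] by rewrite -eq !inE eqxx.
  have: d \in [set a; b] by rewrite -eq !inE eqxx orbT.
  rewrite !inE /= => /orP[]/eqP ed /orP[]/eqP ec; move: cd; rewrite ec ed ?adj_irr ?eqxx ?orbT //.
case/orP=> /andP[/eqP -> /eqP ->]; first by rewrite ab.
by rewrite adj_sym ab; split=> //; apply/eqP; rewrite /f setUC.
Qed.

Lemma matching_max : exists2 M, @matching G M & #|M| = matching_number G.
Proof.
have m0 : @matching G set0.
  by rewrite /matching sub0set; apply/trivIsetP => A B; rewrite inE.
have pos : 0 < #|[pred M | @matching G M]| by apply/card_gt0P; exists set0.
have [M mM e] := eq_bigmax_cond (fun M : {set {set G}} => #|M|) pos.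
by exists M; rewrite // /matching_number e.
Qed.

Lemma matching_bound M : @matching G M -> #|M| <= matching_number G.
Proof. by move=> mM; apply: (leq_bigmax_cond (F := fun M => #|M|)). Qed.

Lemma edgesP E : reflect (exists u v, adj u v /\ E = [set u; v]) (E \in edges G).
Proof.
apply: (iffP imsetP) => [[[a b]]|[u [v [uv ->]]]].
  by rewrite inE /= => ab ->; exists a, b.
by exists (u, v); rewrite ?inE.
Qed.

Lemma matching_cover C : (forall u v, adj u v -> (u \in C) || (v \in C)) ->
  matching_number G <= #|C|.
Proof.
move=> cov; have [M /andP[Me tM] <-] := matching_max.
pose g (E : {set G}) := [pick x in E :&: C].
have gP E : E \in M -> exists2 x, g E = Some x & x \in E :&: C.
  move=> /(subsetP Me) /edgesP[u [v [uv ->]]]; rewrite /g; case: pickP => [x xin|no].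
    by exists x.
  by have := cov _ _ uv; have := no u; have := no v; rewrite !inE !eqxx ?orbT /= => -> ->.
have ginj : {in M &, injective g}.
  move=> E F EM FM; have [x -> /setIP[xE _]] := gP E EM; have [y -> /setIP[yF _]] := gP F FM.
  case=> eqxy; apply/eqP; apply: contraT => neq.
  have /pred0P /(_ x) := trivIsetP tM E F EM FM neq.
  by rewrite /= xE eqxy yF.
rewrite -(card_in_imset ginj) -(card_imset C (@Some_inj _)).
apply/subset_leq_card/subsetP => o /imsetP[E EM ->].
by have [x -> /setIP[_ xC]] := gP E EM; apply: imset_f.
Qed.

Lemma matching_number_half : 2 * matching_number G <= #|G|.
Proof.
have [M /andP[Me /eqP tM] <-] := matching_max.
apply: leq_trans (max_card (mem (cover M))).
rewrite -tM mulnC -sum_nat_const; apply: leq_sum => E /(subsetP Me) /edgesP[u [v [uv ->]]].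
by rewrite cards2; case: eqVneq uv => // ->; rewrite adj_irr.
Qed.

Lemma matching_del M v : @matching G M -> #|M| <= #|[set E in M | v \notin E]|.+1.
Proof.
move=> /andP[Me tM]; rewrite -(cardsID [set E : {set G} | v \notin E] M) -setIdE -addn1 leq_add2l.
rewrite leqNgt; apply/negP => /card_gt1P[E [F []]]; rewrite !inE => /andP[]; rewrite negbK => vE EM.
move=> /andP[]; rewrite negbK => vF FM neq.
by have /pred0P /(_ v) := trivIsetP tM E F EM FM neq; rewrite /= vE vF.
Qed.

Lemma matching_sub M N : @matching G M -> N \subset M -> @matching G N.
Proof.
by move=> /andP[Me tM] NM; rewrite /matching (subset_trans NM Me) (trivIsetS NM tM).
Qed.

Lemma matching_add M u v : @matching G M -> adj u v ->
  (forall E, E \in M -> (u \notin E) && (v \notin E)) -> @matching G ([set u;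
    v] |: M) /\ #|[set u; v] |: M| = #|M|.+1.
Proof.
move=> /andP[Me tM] uv av.
have notin : [set u; v] \notin M by apply/negP => /av; rewrite !inE eqxx.
split; last by rewrite cardsU1 notin.
apply/andP; split.
  by apply/subsetP => E /setU1P[->|/(subsetP Me)//]; apply/edgesP; exists u, v.
have dis E : E \in M -> [disjoint [set u; v] & E].
  by move=> /av /andP[uE vE]; apply/pred0P => x /=; rewrite !inE;
    apply/negP => /andP[/orP[]/eqP->]; apply/negP.
apply/trivIsetP => A B /setU1P[->|AM] /setU1P[->|BM]; rewrite ?eqxx //.
- by move=> _; apply: dis.
- by move=> _; rewrite disjoint_sym; apply: dis.
- by apply: (trivIsetP tM).
Qed.

End DegreesMatchings.

(** * Induced subgraphs that keep distances *)

Section Induced.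
Variables (G : sgraph) (S : {set G}).

Definition induced_adj : rel {x : G | x \in S} := fun x y => adj (val x) (val y).
Lemma induced_sym : symmetric induced_adj. Proof. by move=> x y; apply: adj_sym. Qed.
Lemma induced_irr : irreflexive induced_adj. Proof. by move=> x; apply: adj_irr. Qed.
Definition induced : sgraph := SGraph induced_sym induced_irr.

Lemma card_induced : #|induced| = #|S|.
Proof. by rewrite card_sig; apply: eq_card => x; rewrite inE. Qed.

Lemma sum_induced (F : G -> nat) : \sum_(x : induced) F (val x) = \sum_(x in S) F x.
Proof.
rewrite [RHS](reindex_omap (val : induced -> G) insub) /=; last first.
  by move=> x xS; rewrite insubT.
by apply: eq_bigl => x; rewrite (valP x) valK eqxx.
Qed.

Lemma matching_induced M : @matching G M -> (forall E : {set G}, E \in M -> E \subset S) ->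
  #|M| <= matching_number induced.
Proof.
move=> /andP[Me tM] sub.
pose f (E : {set G}) : {set induced} := [set x | sval x \in E].
have finj : {in M &, injective f}.
  move=> E F /sub ES /sub FS /setP eq; apply/setP => x.
  case: (boolP (x \in S)) => [xS|xS]; last first.
    by rewrite !(contraNF (subsetP _ x) xS).
  by have := eq (exist _ x xS); rewrite !inE.
rewrite -(card_in_imset finj); apply: matching_bound; apply/andP; split.
  apply/subsetP => _ /imsetP[E EM ->]; have := subsetP Me _ EM => /edgesP[u [v [uv eqE]]].
  have /subsetP ES := sub _ EM.
  have uS : u \in S by apply: ES; rewrite eqE !inE eqxx.
  have vS : v \in S by apply: ES; rewrite eqE !inE eqxx orbT.
  apply/edgesP; exists (exist _ u uS), (exist _ v vS); split=> //.
  by apply/setP => x; rewrite !inE eqE !inE.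
apply/trivIsetP => _ _ /imsetP[E EM ->] /imsetP[F FM ->] neq.
have EF : E != F by apply: contraNneq neq => ->.
apply/pred0P => x /=; rewrite !inE.
by have /pred0P /(_ (val x)) := trivIsetP tM E F EM FM EF.
Qed.

Lemma matching_number_induced : matching_number induced <= matching_number G.
Proof.
have [M /andP[Me tM] <-] := matching_max induced.
have finj : injective (fun E : {set induced} => [set val x | x in E]).
  by move=> E F eq; apply: (imset_inj val_inj).
rewrite -(card_imset _ finj); apply: matching_bound; apply/andP; split.
  apply/subsetP => _ /imsetP[E EM ->]; have := subsetP Me _ EM => /edgesP[u [v [uv ->]]].
  by apply/edgesP; exists (val u), (val v); split=> //; rewrite imsetU !imset_set1.
apply/trivIsetP => _ _ /imsetP[E EM ->] /imsetP[F FM ->] neq.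
have EF : E != F by apply: contraNneq neq => ->.
apply/pred0P => x /=; apply/negP => /andP[/imsetP[y yE ->] /imsetP[z zF /val_inj eqz]].
have /pred0P /(_ y) := trivIsetP tM E F EM FM EF.
by rewrite /= yE eqz zF.
Qed.

Lemma degree_induced (x : induced) : degree x = \sum_(y in S) adj (val x) y.
Proof. by rewrite -sum_induced. Qed.

Hypothesis conG : connected G.
Hypothesis desc : forall u v, u \in S -> v \in S -> u != v ->
  exists w, [/\ w \in S, adj u w & dist w v < dist u v].

(** The hypothesis [desc] is the descent step required by [dist_unique], so the restricted distance
    of [G] is the distance of the induced graph. *)
Lemma dist_induced (u v : induced) :
  dist u v = dist (val u) (val v) /\ connect (@adj induced) u v.
Proof.
apply: (dist_unique (d := fun u : induced => dist (val u) (val v))) => [|a b ab|a neq].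
- exact: distxx.
- exact: dist_lip.
- have [w [wS aw lt]] := desc (valP a) (valP v) neq.
  by exists (exist _ w wS).
Qed.

Lemma connected_induced : connected induced.
Proof. by move=> u v; have [] := dist_induced u v. Qed.

Lemma ecc_induced (u : induced) : eccentricity u <= eccentricity (val u).
Proof.
apply/bigmax_leqP => w _; have [-> _] := dist_induced w u; exact: dist_le_ecc.
Qed.

(** Passing to [S] loses the distances from kept to deleted vertices and the whole terms of deleted
    vertices. What remains can only drop further, since distances persist and eccentricities do not
    grow. *)
Lemma ecc_dist_sum_induced :
  ecc_dist_sum induced + \sum_(u in S) eccentricity u * (\sum_(t | t \notin S) dist t u)
    + \sum_(u | u \notin S) eccentricity u * dist_sum u <= ecc_dist_sum G.
Proof.
rewrite [X in _ <= X](bigID (mem S)) /= leq_add2r.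
rewrite /ecc_dist_sum -(sum_induced (fun u => eccentricity u * _)).
rewrite -[X in _ <= X](sum_induced (fun u => eccentricity u * dist_sum u)) -big_split /=.
apply: leq_sum => u _.
rewrite [X in _ <= _ * X](bigID (mem S)) /= mulnDr leq_add2r.
apply: leq_mul; first exact: ecc_induced.
rewrite -(sum_induced (fun t => dist t _)) leq_eqVlt; apply/orP; left; apply/eqP.
by apply: eq_bigr => t _; have [] := dist_induced t u.
Qed.

End Induced.

(** * Breadth-first trees of unicyclic graphs *)

Section Unicyclic.
Variable G : sgraph.
Hypothesis conG : connected G.
Implicit Types u v w c x y z : G.

(** Follow a geodesic from [u]: while it stays in [X] the claim passes to its next vertex, and its
    first vertex outside [X] is [c]. *)
Lemma dist_cut c (X : {pred G}) u z :
  (forall t t', t \in X -> adj t t' -> t' \notin X -> t' = c) ->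
  u \in X -> z \notin X -> dist u c + dist c z <= dist u z.
Proof.
move=> clos; have [k] := ubnP (dist u z); elim: k u => // k IH u /ltnSE ltk uX zX.
have neq : u != z by apply: contraNneq zX => <-.
have [t ut e] := dist_desc conG neq; have [tX|tX] := boolP (t \in X).
  by have := IH t; rewrite -e ltk => /(_ isT tX zX); have := dist_lip conG c ut; lia.
by have := clos _ _ uX ut tX => eqt; move: ut; rewrite e eqt -(dist_eq1 conG) => /eqP; lia.
Qed.

Lemma nonnbr_card c : #|[set v | (v != c) && ~~ adj c v]| + (degree c).+1 = #|G|.
Proof.
rewrite degree_card -(cardsC [set v | (v != c) && ~~ adj c v]); congr addn.
have cN : c \notin [set u | adj c u] by rewrite inE adj_irr.
have <- : #|c |: [set u | adj c u]| = (#|[set u | adj c u]|).+1 by rewrite cardsU1 cN.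
by apply: eq_card => v; rewrite !inE negb_and !negbK.
Qed.

Lemma dist1_adj c v : dist v c = 1 -> adj c v.
Proof. by move=> e; rewrite adj_sym -(dist_eq1 conG) e. Qed.

Hypothesis sumdeg : \sum_(v : G) degree v = 2 * #|G|.

(* The edges of a unicyclic graph are those of a breadth-first tree, plus exactly one. *)
Definition bfs_tree (c : G) (p : G -> G) (x y : G) : Prop :=
  [/\ forall v, v != c -> adj v (p v) /\ dist v c = (dist (p v) c).+1,
      adj x y, x != c -> y != p x, y != c -> x != p y &
      forall u v, adj u v ->
        [\/ u != c /\ v = p u, v != c /\ u = p v, u = x /\ v = y | u = y /\ v = x]].

Lemma bfs_treeP c : exists p x y, bfs_tree c p x y.
Proof.
pose p v := odflt v [pick w | adj v w && (dist v c == (dist w c).+1)].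
have pP v : v != c -> adj v (p v) /\ dist v c = (dist (p v) c).+1.
  move=> /(dist_desc conG)[w vw e]; rewrite /p; case: pickP => [t /andP[vt /eqP]//|/(_ w)].
  by rewrite vw e eqxx.
(* Of the [2 n] ordered adjacent pairs, [n - 1] lead from child to parent and [n - 1] back; these
   families are disjoint because the distance to [c] drops towards the parent. The two remaining
   pairs must be reversals of each other. *)
pose P := [set q : G * G | adj q.1 q.2].
pose T1 := [set (v, p v) | v in [set~ c]]; pose T2 := [set (p v, v) | v in [set~ c]].
have cP : #|P| = 2 * #|G|.
  rewrite -sumdeg pair_big /= -sum1dep_card big_mkcond.
  by apply: eq_bigr => q _; case: adj.
have c1 : #|T1| = #|G|.-1.
  by rewrite card_imset ?cardsC1 // => u v [].
have c2 : #|T2| = #|G|.-1.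
  by rewrite card_imset ?cardsC1 // => u v [].
have sub : T1 :|: T2 \subset P.
  apply/subsetP => q /setUP[] /imsetP[v]; rewrite !inE => /pP[vp _] -> //=.
  by rewrite adj_sym.
have dis : T1 :&: T2 = set0.
  apply/setP => q; rewrite !inE; apply/negP => /andP[/imsetP[u + ->] /imsetP[v + [e1 e2]]].
  by rewrite !inE => /pP[_ eu] /pP[_ ev]; rewrite e2 in eu; rewrite -e1 in ev; lia.
have G0 : 0 < #|G| by apply/card_gt0P; exists c.
have cR : #|P :\: (T1 :|: T2)| = 2.
  by rewrite cardsD (setIidPr sub) cardsU dis cards0 c1 c2 cP; lia.
have /card_gt0P[[x y]] : 0 < #|P :\: (T1 :|: T2)| by rewrite cR.
rewrite !inE /= negb_or => /andP[/andP[x1 x2] xy].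
have y1 : (y, x) \notin T1.
  by apply: contra x2 => /imsetP[v vc [-> ->]]; apply: imset_f.
have y2 : (y, x) \notin T2.
  by apply: contra x1 => /imsetP[v vc [-> ->]]; apply: imset_f.
have neq : (x, y) != (y, x).
  by rewrite xpair_eqE; apply: contraTN xy => /andP[/eqP -> _]; rewrite adj_irr.
have eqR : [set (x, y); (y, x)] = P :\: (T1 :|: T2).
  apply/eqP; rewrite eqEcard cR cards2 neq leqnn andbT; apply/subsetP => q.
  by rewrite !inE => /orP[]/eqP->; rewrite negb_or /= ?x1 ?x2 ?y1 ?y2 ?xy // adj_sym.
exists p, x, y; split=> // [xc|yc|u v uv].
- by apply: contra x1 => /eqP ->; apply: imset_f; rewrite !inE.
- by apply: contra x2 => /eqP ->; apply: imset_f; rewrite !inE.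
have [/imsetP[w + [-> ->]]|n1] := boolP ((u, v) \in T1).
  by rewrite !inE; constructor 1.
have [/imsetP[w + [-> ->]]|n2] := boolP ((u, v) \in T2).
  by rewrite !inE; constructor 2.
have : (u, v) \in P :\: (T1 :|: T2) by rewrite in_setD in_setU (negPf n1) (negPf n2) inE.
by rewrite -eqR !inE => /orP[]/eqP[-> ->]; [constructor 3|constructor 4].
Qed.

Lemma degree_bound c : matching_number G + degree c <= #|G|.+1.
Proof.
have [p [x [y [pP _ _ _ eP]]]] := bfs_treeP c.
pose C := x |: (c |: [set v | (v != c) && ~~ adj c v]).
have : matching_number G <= #|C|.
  apply: matching_cover => u v uv; rewrite !inE.
  have [->|uc] := eqVneq u c; first by rewrite orbT.
  have [->|vc] := eqVneq v c; first by rewrite !orbT.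
  have [cu|] := boolP (adj c u); last by rewrite !orbT.
  have [cv|] := boolP (adj c v); last by rewrite !orbT.
  (* An edge between two neighbours of [c] is not a tree edge, since both have parent [c]; hence it
     is [xy]. *)
  have tree t : t != c -> adj c t -> p t = c.
    rewrite adj_sym -(dist_eq1 conG) => /pP[_ ->] /eqP[] /eqP.
    by rewrite (dist_eq0 conG) => /eqP.
  case: (eP _ _ uv) => -[]; rewrite ?tree // => e1 e2.
  - by rewrite e2 eqxx in vc.
  - by rewrite e2 eqxx in uc.
  - by rewrite e1 eqxx.
  - by rewrite e2 eqxx !orbT.
move=> /leq_trans le; have := nonnbr_card c.
have := le _ (leqnn _); rewrite /C !cardsU1; lia.
Qed.

End Unicyclic.

Lemma unicyclic_sum_degree G : unicyclic G -> \sum_(v : G) degree v = 2 * #|G|.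
Proof. by move=> [_ ->]; apply: sum_degree. Qed.

Lemma card3_le (V : finType) (a b d : V) : #|a |: (b |: [set d])| <= 3.
Proof. by rewrite !cardsU1 cards1; lia. Qed.

(** * Vertex covers read off from a breadth-first tree *)

Section Covers.
Variable G : sgraph.
Hypothesis conG : connected G.
Implicit Types u v w c x y z : G.

Lemma bfs_tree_sym c p x y : @bfs_tree G c p x y -> bfs_tree c p y x.
Proof.
case=> pP xy nx ny eP; split=> //; first by rewrite adj_sym.
by move=> u v /eP[]; [constructor 1|constructor 2|constructor 4|constructor 3].
Qed.

Lemma tree_cover c p x y (C : {set G}) : bfs_tree c p x y -> x \in C ->
  (forall v, v != c -> (v \in C) || (p v \in C)) -> matching_number G <= #|C|.
Proof.
case=> pP xy nx ny eP xC cov; apply: matching_cover => u v /eP[][].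
- by move=> /cov + ->.
- by move=> /cov + ->; rewrite orbC.
- by move=> -> _; rewrite xC.
- by move=> _ ->; rewrite xC orbT.
Qed.

Lemma tree_parent_root c p x y v : bfs_tree c p x y -> adj c v -> p v = c.
Proof.
case=> pP _ _ _ _ cv; have vc : v != c by apply: contraTneq cv => ->; rewrite adj_irr.
have [_] := pP _ vc; have -> : dist v c = 1 by apply/eqP; rewrite (dist_eq1 conG) adj_sym.
by case=> /esym /eqP; rewrite (dist_eq0 conG) => /eqP.
Qed.

(** If [x] were the root, [y] would have parent [c = x], making [xy] a tree edge. *)
Lemma tree_extra_root c p x y : bfs_tree c p x y -> x != c.
Proof.
move=> T; have [_ xy _ ny _] := T; apply/eqP => xc; rewrite xc in xy.
have yc : y != c by apply: contraTneq xy => ->; rewrite adj_irr.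
by have := ny yc; rewrite (tree_parent_root T xy) xc eqxx.
Qed.

(** The cover by [x], [c] and [R] has no vertex to spare. A failing claim would save one: drop [r]
    if its parent is in [R]; replace [R] by its parents if two coincide; drop [x] if it is itself a
    parent; and if [x] lies in [R], let [x] cover the tree edge to its own parent. *)
Lemma extremal_structure c p x y (R := [set v | (v != c) && ~~ adj c v]) :
  matching_number G + degree c = #|G|.+1 -> bfs_tree c p x y ->
  [/\ forall r, r \in R -> adj c (p r), {in R &, injective p},
      adj c x & x \notin [set p r | r in R]].
Proof.
move=> ex T; have [pP _ _ _ _] := T.
have cR : #|R|.+2 = matching_number G by have := nonnbr_card c; rewrite -/R; lia.
have NR v : v != c -> (v \in R) || (p v == c).
  move=> vc; rewrite inE vc /=; have [cv|] //= := boolP (adj c v).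
  by rewrite (tree_parent_root T cv).
have neqp r : r != c -> p r != r.
  by move=> /pP[rp _]; apply: contraTneq rp => ->; rewrite adj_irr.
have a r : r \in R -> adj c (p r).
  move=> rR; have := rR; rewrite inE => /andP[rc ncr]; apply: contraT => np.
  have pc : p r != c by have [rp _] := pP _ rc; apply: contraNneq ncr => <-; rewrite adj_sym.
  have : matching_number G <= #|x |: (c |: (R :\ r))|.
    apply: (tree_cover T) => [|v vc]; first by rewrite !inE eqxx.
    have [->|vr] := eqVneq v r; first by rewrite !inE pc np (neqp _ rc) ?orbT.
    by case/orP: (NR v vc) => [vR|/eqP ->]; [rewrite !in_setU in_setD1 vR vr ?orbT|rewrite !inE
      eqxx ?orbT].
  have := cardsD1 r R; rewrite !cardsU1 rR; lia.
have inj : {in R &, injective p}.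
  apply/imset_injP; rewrite eqn_leq leq_imset_card /=.
  have : matching_number G <= #|x |: (c |: (p @: R))|.
    apply: (tree_cover T) => [|v vc]; first by rewrite !inE eqxx.
    by case/orP: (NR v vc) => [vR|/eqP ->]; rewrite !in_setU ?in_set1 ?eqxx ?orbT // imset_f ?orbT.
  by rewrite !cardsU1; lia.
have xP : x \notin p @: R.
  apply/negP => xP; have : matching_number G <= #|c |: (p @: R)|.
    apply: (tree_cover T) => [|v vc]; first by rewrite in_setU xP orbT.
    by case/orP: (NR v vc) => [vR|/eqP ->]; rewrite !in_setU ?in_set1 ?eqxx ?orbT // imset_f ?orbT.
  rewrite !cardsU1; have := leq_imset_card p R; lia.
split=> //; apply: contraT => cx; have xR : x \in R by rewrite inE (tree_extra_root T).
have : matching_number G <= #|x |: (c |: (p @: (R :\ x)))|.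
  apply: (tree_cover T) => [|v vc]; first by rewrite !inE eqxx.
  case/orP: (NR v vc) => [vR|/eqP ->]; last by rewrite !inE eqxx ?orbT.
  have [->|vx] := eqVneq v x; first by rewrite !inE eqxx.
  by rewrite !in_setU imset_f ?orbT // in_setD1 vx.
rewrite !cardsU1; have := leq_imset_card p (R :\ x); have := cardsD1 x R; rewrite xR; lia.
Qed.

End Covers.

(** * Trees rooted at a vertex of eccentricity at most 2 *)

Section RadiusTwo.
Variable G : sgraph.
Hypothesis conG : connected G.
Implicit Types u v w x y z : G.
Variables (c : G) (p : G -> G) (x y : G).
Hypothesis T : bfs_tree c p x y.
Hypothesis ecc2 : eccentricity c <= 2.

(* The subtrees hanging at [c] are indexed by the neighbours of [c]; two of them are linked when
   the extra edge [x y] joins them. *)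
Definition branch v := if adj c v then v else p v.
Definition linked a b :=
  (a == branch x) && (b == branch y) || (a == branch y) && (b == branch x).

Lemma dist_root v : v != c -> dist v c = if adj c v then 1 else 2.
Proof.
move=> vc; have := dist_le_ecc v c; rewrite -(dist_eq1 conG c v) (dist_sym conG c).
by move: (dist_eq0 conG v c) ecc2; rewrite (negPf vc); case: dist => [|[|[|]]] //; lia.
Qed.

Lemma adj_branch v : v != c -> adj c (branch v).
Proof.
move=> vc; rewrite /branch; case cv : (adj c v) => //.
have [pP _ _ _ _] := T; have [_ e] := pP v vc.
by apply: dist1_adj => //; have := dist_root vc; rewrite cv e => -[].
Qed.

Lemma branch_adj v : adj c v -> branch v = v.
Proof. by rewrite /branch => ->. Qed.

Lemma nonadj_parent v : v != c -> ~~ adj c v -> branch v = p v /\ adj c (p v).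
Proof. by move=> vc ncv; have := adj_branch vc; rewrite /branch (negPf ncv). Qed.

(** [dist_cut] is applied to the branch of [u], enlarged to the branches of both [x] and [y] if it
    is one of these. Such a set can be left only through [c], and [z] is outside because the
    branches are not linked. *)
Lemma dist_unlinked u z : u != c -> z != c -> branch u != branch z ->
  ~~ linked (branch u) (branch z) -> dist u c + dist c z <= dist u z.
Proof.
move=> uc zc neq nl.
pose lk w := (w == branch x) || (w == branch y).
apply: (@dist_cut G conG c [pred t | (t != c) && ((branch t == branch u) || lk (branch u) &&
  lk (branch t))]).
- move=> t t' /=; rewrite !inE => /andP[tc tX] tt'; apply: contraNeq => t'c.
  rewrite t'c /=; have [_ _ _ _ eP] := T; case: (eP _ _ tt') => -[] e1 e2.
  + have ct' : adj c t'.
      rewrite e2; have [|ct] := boolP (adj c t); last by have [] := nonadj_parent tc ct.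
      by move=> /(tree_parent_root conG T) => ep; rewrite e2 ep eqxx in t'c.
    have -> : branch t' = branch t; last by [].
    rewrite (branch_adj ct') /branch; case: ifP => // ct.
    by rewrite e2 (tree_parent_root conG T ct) eqxx in t'c.
  + have ct : adj c t.
      rewrite e2; have [|ct] := boolP (adj c t'); last by have [] := nonadj_parent t'c ct.
      by move=> /(tree_parent_root conG T) => ep; rewrite e2 ep eqxx in tc.
    have -> : branch t' = branch t; last by [].
    rewrite (branch_adj ct) /branch; case: ifP => // ct'.
    by rewrite e2 (tree_parent_root conG T ct') eqxx in tc.
  + rewrite e1 in tX; have -> : lk (branch t') by rewrite e2 /lk eqxx ?orbT.
    case/orP: tX => [/eqP <-|/andP[-> _]]; last by rewrite orbT.
    by rewrite /lk eqxx ?orbT.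
  + rewrite e1 in tX; have -> : lk (branch t') by rewrite e2 /lk eqxx ?orbT.
    case/orP: tX => [/eqP <-|/andP[-> _]]; last by rewrite orbT.
    by rewrite /lk eqxx ?orbT.
- by rewrite !inE uc eqxx.
rewrite !inE zc /= eq_sym (negPf neq) /=; apply: contra nl.
rewrite /lk /linked => /andP[/orP[]/eqP e1 /orP[]/eqP e2]; move: neq; rewrite e1 e2 ?eqxx ?orbT //.
Qed.

Let parents := [set p r | r in [set v | (v != c) && ~~ adj c v]].

Lemma root_cover (C : {set G}) : c \in C -> parents \subset C ->
  (x \in C) || (y \in C) -> matching_number G <= #|C|.
Proof.
move=> cC /subsetP PC xyC.
have cov v : v != c -> (v \in C) || (p v \in C).
  move=> vc; have [cv|cv] := boolP (adj c v); first by rewrite (tree_parent_root conG T cv) cC orbT.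
  by rewrite (PC (p v)) ?orbT //; apply: imset_f; rewrite inE vc.
case/orP: xyC => [xC|yC]; first exact: (tree_cover T).
exact: (tree_cover (bfs_tree_sym T)).
Qed.

Let extra_root := tree_extra_root conG T.
Let extra_root' := tree_extra_root conG (bfs_tree_sym T).

(** If [xy] has an end among [c], [u], [w], these three cover. Otherwise [x] and [y] are children of
    [u] and [w]. A child of [w] other than [y] could be within distance 2 of [u] only via an edge
    [uw], which does not exist; so [c], [u], [y] cover. *)
Lemma adjacent_centers_linked u w : adj c u -> eccentricity u <= 2 -> u != w ->
  (forall r, r != c -> ~~ adj c r -> p r = u \/ p r = w) ->
  branch x = u -> branch y = w -> matching_number G <= 3.
Proof.
move=> cu eccu neq par bx bw.
have uc : u != c by apply: contraTneq cu => ->; rewrite adj_irr.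
have cw : adj c w by rewrite -bw adj_branch.
have wc : w != c by apply: contraTneq cw => ->; rewrite adj_irr.
have [xy3|] := boolP ((x \in c |: (u |: [set w])) || (y \in c |: (u |: [set w]))).
  apply: leq_trans (card3_le c u w); apply: root_cover => //; first by rewrite !inE eqxx.
  apply/subsetP => _ /imsetP[r + ->]; rewrite !inE => /andP[rc cr].
  by have [->|->] := par r rc cr; rewrite eqxx !orbT.
rewrite !inE !negb_or => /andP[/and3P[_ xu xw] /and3P[_ yu yw]].
have cx : ~~ adj c x by apply: contraNN xu => /branch_adj; rewrite bx => ->.
have cy : ~~ adj c y by apply: contraNN yw => /branch_adj; rewrite bw => ->.
have [px _] := nonadj_parent extra_root cx; have [py _] := nonadj_parent extra_root' cy.
rewrite bx in px; rewrite bw in py.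
have [_ _ _ _ eP] := T.
have pN v : adj c v -> p v = c by apply: (tree_parent_root conG T).
have uniq z : z != c -> ~~ adj c z -> p z = w -> z = y.
  move=> zc cz pz; apply/eqP; apply: contraT => zy.
  have zx : z != x by apply: contraNneq neq => zx; rewrite px -zx pz.
  have uz : u != z by apply: contraNneq cz => <-.
  have nuz : ~~ adj u z.
    apply/negP => /eP[] [] e1 e2.
    - by rewrite e2 (pN _ cu) eqxx in zc.
    - by rewrite -pz -e2 eqxx in neq.
    - by rewrite e1 eqxx in xu.
    - by rewrite e1 eqxx in yu.
  have [t ut e] := dist_desc conG uz.
  have : dist u z <= 2 by rewrite (dist_sym conG); apply: leq_trans (dist_le_ecc _ _) eccu.
  have tz : adj t z.
    rewrite -(dist_eq1 conG); have := leq_trans (dist_le_ecc z u) eccu.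
    rewrite (dist_sym conG) e; have : dist t z != 0.
      by rewrite (dist_eq0 conG); apply: contraNneq nuz => <-.
    by case: dist => [|[|]].
  move=> _; have tc : t != c by apply: contraNneq cz => <-.
  have tw : t = w.
    case: (eP _ _ tz) => -[] e1 e2.
    + move: cz; rewrite e2; have [ct|ct] := boolP (adj c t);
      first by rewrite e2 (pN _ ct) eqxx in zc.
      by have [_ ->] := nonadj_parent tc ct.
    + by rewrite e2 pz.
    + by rewrite e2 eqxx in zy.
    + by rewrite e2 eqxx in zx.
  rewrite tw in ut; case: (eP _ _ ut) => -[] e1 e2.
  - by rewrite e2 (pN _ cu) eqxx in wc.
  - by rewrite e2 (pN _ cw) eqxx in uc.
  - by rewrite e1 eqxx in xu.
  - by rewrite e1 eqxx in yu.
apply: leq_trans (card3_le c u y); apply: (tree_cover (bfs_tree_sym T));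
  first by rewrite !inE eqxx !orbT.
move=> v vc; have [cv|cv] := boolP (adj c v); first by rewrite (pN _ cv) !inE eqxx orbT.
have [->|pw] := par v vc cv; first by rewrite !inE eqxx !orbT.
by rewrite (uniq v vc cv pw) !inE eqxx !orbT.
Qed.

(** Otherwise a geodesic from [u] to [r] runs through [c] and has length 3. *)
Lemma parent_linked u r : adj c u -> eccentricity u <= 2 -> r != c -> ~~ adj c r ->
  p r = u \/ linked u (p r).
Proof.
move=> cu eccu rc cr; have [br cp] := nonadj_parent rc cr.
have uc : u != c by apply: contraTneq cu => ->; rewrite adj_irr.
have [->|neq] := eqVneq (p r) u; first by left.
right; apply: contraT => nl.
have := @dist_unlinked u r uc rc; rewrite br branch_adj // eq_sym => /(_ neq nl).
rewrite (dist_sym conG c r) !dist_root // cu (negPf cr).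
by have := leq_trans (dist_le_ecc r u) eccu; rewrite (dist_sym conG r); lia.
Qed.

Lemma root_cover1 w : (forall r, r != c -> ~~ adj c r -> p r = w) -> matching_number G <= 3.
Proof.
move=> par; apply: leq_trans (card3_le c w x); apply: root_cover; rewrite ?inE ?eqxx ?orbT //.
by apply/subsetP => _ /imsetP[r + ->]; rewrite !inE => /andP[rc /(par _ rc) ->]; rewrite eqxx orbT.
Qed.

(** A central neighbour other than [p r] must be linked to [p r]; this identifies the two branches
    of the extra edge, and every central neighbour of [c] is then one of them. *)
Lemma center_nbrs : [exists r, (r != c) && ~~ adj c r] ->
  #|[set u | adj c u && (eccentricity u <= 2)]| <= 2.
Proof.
move=> /existsP[r /andP[rc cr]].
suff sub : [set u | adj c u && (eccentricity u <= 2)] \subset [set branch x; branch y] \/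
           [set u | adj c u && (eccentricity u <= 2)] \subset [set p r].
  by case: sub => /subset_leq_card le; apply: leq_trans le _; rewrite ?cards1 // cards2; case: eqP.
have [/existsP[w /and3P[cw ew pw]]|none] :=
  boolP [exists u, [&& adj c u, eccentricity u <= 2 & p r != u]]; last first.
  right; apply/subsetP => u; rewrite !inE => /andP[cu eu].
  by move/existsPn: none => /(_ u); rewrite cu eu negbK /= eq_sym.
left; have [pe|] := parent_linked cw ew rc cr; first by rewrite pe eqxx in pw.
move=> lw; apply/subsetP => u; rewrite !inE => /andP[cu eu].
have [<-|/orP[]/andP[-> _]] := parent_linked cu eu rc cr; rewrite ?orbT //.
by case/orP: lw => /andP[_ ->]; rewrite ?orbT.
Qed.

(** Otherwise [r] and [w] would be at distance 4, through [c]. *)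
Lemma far_ecc_linked r w : r != c -> ~~ adj c r -> eccentricity r <= 3 -> w != c -> ~~ adj c w ->
  p w = p r \/ linked (p r) (p w).
Proof.
move=> rc cr er wc cw; have [br _] := nonadj_parent rc cr; have [bw _] := nonadj_parent wc cw.
have [->|neq] := eqVneq (p w) (p r); first by left.
right; apply: contraT => nl.
have := @dist_unlinked r w rc wc; rewrite br bw eq_sym => /(_ neq nl).
rewrite (dist_sym conG c w) !dist_root // (negPf cr) (negPf cw).
by have := leq_trans (dist_le_ecc w r) er; rewrite (dist_sym conG r); lia.
Qed.

(** The vertices [x], [c], [a], [b] cover, whence [m = 4]. Both branches have a second vertex at
    distance 2: if [x] were the only child of [a], then [c], [b], [x] would cover, and similarly for
    [y] and [b]. *)
Lemma far_ecc_aux a b : a != b ->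
  (forall r, r != c -> ~~ adj c r -> p r = a \/ p r = b) ->
  branch x = a -> branch y = b -> 4 <= matching_number G ->
  matching_number G = 4 /\ 4 <= #|[set v | (v != c) && ~~ adj c v]|.
Proof.
move=> neq par bx bw m4; set R := [set v | _].
have ca : adj c a by rewrite -bx adj_branch.
have cb : adj c b by rewrite -bw adj_branch.
have pN v : adj c v -> p v = c by apply: (tree_parent_root conG T).
have [|] := boolP ((x \in c |: (a |: [set b])) || (y \in c |: (a |: [set b]))).
  move=> xy3; suff : matching_number G <= 3 by rewrite leqNgt m4.
  apply: leq_trans (card3_le c a b); apply: root_cover => //; first by rewrite !inE eqxx.
  apply/subsetP => _ /imsetP[r + ->]; rewrite !inE => /andP[rc cr].
  by have [->|->] := par r rc cr; rewrite eqxx !orbT.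
rewrite !inE !negb_or => /andP[/and3P[_ xu xw] /and3P[_ yu yw]].
have cx : ~~ adj c x by apply: contraNN xu => /branch_adj; rewrite bx => ->.
have cy : ~~ adj c y by apply: contraNN yw => /branch_adj; rewrite bw => ->.
have [px _] := nonadj_parent extra_root cx; have [py _] := nonadj_parent extra_root' cy.
rewrite bx in px; rewrite bw in py; split.
  apply/eqP; rewrite eqn_leq m4 andbT.
  have : #|x |: (c |: (a |: [set b]))| <= 4.
    by rewrite cardsU1; move: (card3_le c a b); case: (_ \notin _); clear; lia.
  apply: leq_trans; apply: root_cover; rewrite ?inE ?eqxx ?orbT //.
  apply/subsetP => _ /imsetP[r + ->]; rewrite !inE => /andP[rc cr].
  by have [->|->] := par r rc cr; rewrite eqxx !orbT.
have two (e d q : G) : q \in [set x; y] -> p q = e ->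
    (forall r, r != c -> ~~ adj c r -> p r = e \/ p r = d) ->
    exists2 z, (z \in R) && (p z == e) & z != q.
  move=> qxy pq par'; have [/existsP[z /andP[zR zq]]|none] := boolP [exists z, (z \in R) &&
    (p z == e) && (z != q)].
    by exists z.
  suff : matching_number G <= 3 by rewrite leqNgt m4.
  have cov v : v != c -> (v \in c |: (d |: [set q])) || (p v \in c |: (d |: [set q])).
    move=> vc; have [cv|cv] := boolP (adj c v); first by rewrite (pN _ cv) !inE eqxx orbT.
    have [pv|->] := par' v vc cv; last by rewrite !inE eqxx !orbT.
    move/existsPn: none => /(_ v); rewrite !inE vc cv pv eqxx /= negbK => /eqP ->.
    by rewrite eqxx !orbT.
  have qin : q \in c |: (d |: [set q]) by rewrite !inE eqxx !orbT.
  apply: leq_trans (card3_le c d q); move: qxy qin cov; rewrite !inE.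
  case/orP=> /eqP->; first by move=> qin cov; apply: (tree_cover T); rewrite ?inE.
  by move=> qin cov; apply: (tree_cover (bfs_tree_sym T)); rewrite ?inE.
have [|z /andP[zR /eqP pz] zx] := two a b x _ (esym px) par; first by rewrite !inE eqxx.
have [||t /andP[tR /eqP pt] ty] := two b a y _ (esym py).
- by rewrite !inE eqxx orbT.
- by move=> r rc cr; have [] := par r rc cr; auto.
have : #|x |: (z |: (y |: [set t]))| <= #|R|.
  apply/subset_leq_card/subsetP => v; rewrite !in_setU !in_set1.
  by case/or4P=> /eqP-> //; rewrite inE ?extra_root ?extra_root'.
apply: leq_trans; rewrite !cardsU1 cards1 !in_setU !in_set1 (eq_sym x z) (eq_sym y t).
rewrite (negPf zx) (negPf ty).
have df u v : p u = a -> p v = b -> (u == v) = false.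
  by move=> pu pv; apply: contraNF neq => /eqP uv; rewrite -pu uv pv.
by rewrite !df.
Qed.

End RadiusTwo.

Section RadiusTwoSummary.
Variable G : sgraph.
Hypothesis conG : connected G.
Hypothesis sumdeg : \sum_(v : G) degree v = 2 * #|G|.
Implicit Types u v w c r : G.

(** The extra edge is unordered, so its ends may be named such that [x] lies in branch [a] and [y]
    in branch [b]. *)
Lemma linked_cases (P : Prop) c p x y a b : @bfs_tree G c p x y ->
  (forall x' y', bfs_tree c p x' y' -> branch c p x' = a -> branch c p y' = b -> P) ->
  linked c p x y a b -> P.
Proof.
move=> T H /orP[] /andP[/eqP e1 /eqP e2]; first exact: (H x y).
by apply: (H y x) => //; apply: bfs_tree_sym.
Qed.

(* The matching number is bounded by a vertex cover of size 3 containing both [c] and [u]. *)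
Lemma adjacent_centers c u : adj c u -> eccentricity c <= 2 -> eccentricity u <= 2 ->
  matching_number G <= 3.
Proof.
move=> cu ec eu; have [p [x [y T]]] := bfs_treeP conG sumdeg c.
have link := parent_linked conG T ec cu eu.
have [/existsP[r /and3P[rc cr pu]]|none] :=
  boolP [exists r, [&& r != c, ~~ adj c r & p r != u]]; last first.
  apply: (root_cover1 conG T (w := u)) => r rc cr.
  by move/existsPn: none => /(_ r); rewrite rc cr negbK /= => /eqP.
have [pe|lk] := link r rc cr; first by rewrite pe eqxx in pu.
apply: (linked_cases T _ lk) => x' y' T' bx by'.
have eqp r' : r' != c -> ~~ adj c r' -> p r' = u \/ p r' = p r.
  move=> rc' cr'; have [|lk'] := link r' rc' cr'; [by left|right].
  by case/orP: lk lk' => /andP[/eqP e1 /eqP e2] /orP[]/andP[/eqP e3 /eqP e4]; congruence.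
by apply: (adjacent_centers_linked conG T' ec cu eu _ eqp bx by'); rewrite eq_sym.
Qed.

(** For the twin step: either all vertices at distance 2 from a central vertex have eccentricity at
    least 4, or there are at least four of them and [m = 4]. *)
Lemma far_ecc c r : eccentricity c <= 2 -> r != c -> ~~ adj c r -> eccentricity r <= 3 ->
  4 <= matching_number G ->
  matching_number G = 4 /\ 4 <= #|[set v | (v != c) && ~~ adj c v]|.
Proof.
move=> ec rc cr er m4; have [p [x [y T]]] := bfs_treeP conG sumdeg c.
have link w := @far_ecc_linked _ conG c p x y T ec r w rc cr er.
have [/existsP[w /and3P[wc cw pw]]|none] :=
  boolP [exists w, [&& w != c, ~~ adj c w & p w != p r]]; last first.
  suff : matching_number G <= 3 by lia.
  apply: (root_cover1 conG T (w := p r)) => w wc cw.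
  by move/existsPn: none => /(_ w); rewrite wc cw negbK /= => /eqP.
have [pe|lk] := link w wc cw; first by rewrite pe eqxx in pw.
apply: (linked_cases T _ lk) => x' y' T' bx by'.
have eqp r' : r' != c -> ~~ adj c r' -> p r' = p r \/ p r' = p w.
  move=> rc' cr'; have [|lk'] := link r' rc' cr'; [by left|right].
  by case/orP: lk lk' => /andP[/eqP e1 /eqP e2] /orP[]/andP[/eqP e3 /eqP e4]; congruence.
by apply: (far_ecc_aux conG T' ec _ eqp bx by' m4); rewrite eq_sym.
Qed.

Lemma card_adjacent_centers c : eccentricity c <= 2 -> degree c + 2 <= #|G| ->
  #|[set u | adj c u && (eccentricity u <= 2)]| <= 2.
Proof.
move=> ec dc; have [p [x [y T]]] := bfs_treeP conG sumdeg c.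
apply: (center_nbrs conG T ec).
have /card_gt0P[r] : 0 < #|[set v | (v != c) && ~~ adj c v]| by have := nonnbr_card c; lia.
by rewrite inE => rP; apply/existsP; exists r.
Qed.

End RadiusTwoSummary.

(** * Estimates of distance sums *)

Lemma sum_delta (V : finType) (v : V) (F : V -> nat) : \sum_(u : V) (u == v) * F u = F v.
Proof.
rewrite (bigD1 v) //= eqxx mul1n big1 ?addn0 // => u /negPf ->; exact: mul0n.
Qed.

Lemma sum_const (V : sgraph) (k : nat) : \sum_(u : V) k = k * #|V|.
Proof. by rewrite sum_nat_const mulnC. Qed.

Section DistanceSums.
Variable G : sgraph.
Implicit Types u v w z : G.

(* The number of walks of length 2 from [v]: it bounds the number of vertices at distance 2. *)
Definition walks2 v := \sum_(w : G) adj v w * degree w.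
(** Counting walks of length at most 2 credits a vertex with distance at most 3, so each vertex
    counted here improves [dist_sum_ge3] by one. *)
Definition far v := \sum_(u : G) (4 <= dist u v).

Lemma walks2_sum v : walks2 v = \sum_(u : G) \sum_(w : G) adj v w * adj w u.
Proof. by rewrite exchange_big; apply: eq_bigr => w _; rewrite -big_distrr. Qed.

Lemma sum_walks2 : \sum_(v : G) walks2 v = \sum_(v : G) degree v * degree v.
Proof.
rewrite exchange_big /=; apply: eq_bigr => w _; rewrite -big_distrl /=; congr (_ * _).
by apply: eq_bigr => v _; rewrite adj_sym.
Qed.

Lemma closed_walks2 v : \sum_(w : G) adj v w * adj w v = degree v.
Proof. by apply: eq_bigr => w _; rewrite (adj_sym w); case: adj. Qed.

Hypothesis conG : connected G.

Lemma ecc_attained v : exists u, dist u v = eccentricity v.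
Proof.
have [u e] := eq_bigmax (fun u => dist u v) (introT card_gt0P (ex_intro _ v isT)).
by exists u; rewrite -e.
Qed.

Lemma ecc_le_dist k v : (eccentricity v <= k) = [forall u, dist u v <= k].
Proof.
apply/bigmax_leqP/forallP => [H u|H u _]; [exact: H|exact: H].
Qed.

Lemma dist2_walk u v : dist u v = 2 -> 0 < \sum_(w : G) adj v w * adj w u.
Proof.
move=> e; have neq : u != v by rewrite -(dist_eq0 conG) e.
have [w uw] := dist_desc conG neq; rewrite e => -[] /esym/eqP; rewrite (dist_eq1 conG) => wv.
by rewrite (bigD1 w) //= adj_sym wv adj_sym uw.
Qed.

Lemma dist_cases u v :
  [\/ u = v /\ dist u v = 0, [/\ u != v, adj v u & dist u v = 1],
      [/\ u != v, ~~ adj v u, dist u v = 2 & 0 < \sum_(w : G) adj v w * adj w u] |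
      [/\ u != v, ~~ adj v u & 3 <= dist u v]].
Proof.
have := dist_eq0 conG u v; have := dist_eq1 conG u v; rewrite adj_sym.
case e : (dist u v) => [|[|[|k]]] /= <- => [/esym/eqP ->||/esym/negbT|/esym/negbT].
- by constructor 1.
- by constructor 2; rewrite -(dist_eq0 conG) e.
- by constructor 3; rewrite dist2_walk.
- by constructor 4.
Qed.

Lemma dist_sum_ge2 v : 2 * #|G| <= dist_sum v + degree v + 2.
Proof.
have H : \sum_(u : G) 2 <= \sum_(u : G) (dist u v + adj v u + (u == v) * 2).
  apply: leq_sum => u _.
  by case: (dist_cases u v) => [[-> ->]|[_ -> ->]|[_ _ -> _]|[_ _ ?]]; rewrite ?eqxx; lia.
rewrite !big_split /= sum_delta sum_const -/(degree v) -/(dist_sum v) in H; lia.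
Qed.

(** To lift every distance to 3, a neighbour uses adjacency twice and a vertex at distance 2 uses a
    walk of length 2. The [degree v] closed walks at [v] cancel one of the two degrees. *)
Lemma dist_sum_ge3 v : 3 * #|G| + far v <= dist_sum v + degree v + walks2 v + 3.
Proof.
have H : \sum_(u : G) (3 + (4 <= dist u v) + (u == v) * degree v) <=
       \sum_(u : G) (dist u v + adj v u + adj v u + \sum_(w : G) adj v w * adj w u + (u == v) * 3).
  apply: leq_sum => u _; case: (dist_cases u v) => [[-> ->]|[/negPf -> -> ->]|[/negPf -> _ ->
    ?]|[/negPf -> _ ?]].
  - by rewrite closed_walks2 eqxx; lia.
  - lia.
  - lia.
  - lia.
rewrite !big_split /= !sum_delta sum_const -walks2_sum -/(degree v) in H.
rewrite -/(far v) -/(dist_sum v) in H; lia.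
Qed.

Lemma ball2_card v : eccentricity v <= 2 -> #|G| <= walks2 v + 1.
Proof.
rewrite ecc_le_dist => /forallP le2.
have H : \sum_(u : G) (1 + (u == v) * degree v) <=
       \sum_(u : G) (adj v u + \sum_(w : G) adj v w * adj w u + (u == v) * 1).
  apply: leq_sum => u _; have := le2 u; case: (dist_cases u v) => [[-> ->]|[/negPf -> ->
    ->]|[/negPf -> _ -> ?]|[/negPf -> _ ?]].
  - by rewrite closed_walks2 eqxx; lia.
  - lia.
  - lia.
  - lia.
rewrite !big_split /= !sum_delta sum_const -walks2_sum -/(degree v) in H; lia.
Qed.

Lemma ecc_ge2 v : degree v + 2 <= #|G| -> 2 <= eccentricity v.
Proof.
move=> dv; have /card_gt0P[u] : 0 < #|[set u | (u != v) && ~~ adj v u]| by have := nonnbr_card v;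
  lia.
rewrite inE => /andP[uv nadj]; apply: leq_trans (dist_le_ecc u v).
by move: uv nadj; case: (dist_cases u v) => [[-> _]|[_ -> _]|[_ _ -> _]|[_ _ ?]];
  rewrite ?eqxx //; lia.
Qed.

Lemma dist_sum_gt2 v : 3 <= eccentricity v -> 2 * #|G| + 1 <= dist_sum v + degree v + 2.
Proof.
move=> ev; have [t et] := ecc_attained v.
have H : \sum_(u : G) (2 + (u == t) * 1) <= \sum_(u : G) (dist u v + adj v u + (u == v) * 2).
  apply: leq_sum => u _; case: (eqVneq u t) => [->|_].
    by rewrite et; lia.
  by case: (dist_cases u v) => [[-> ->]|[_ -> ->]|[_ _ -> _]|[_ _ ?]]; rewrite ?eqxx; lia.
rewrite !big_split /= !sum_delta sum_const in H; rewrite -/(degree v) -/(dist_sum v) in H; lia.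
Qed.

Lemma dist_sum_ecc2 v : eccentricity v <= 2 -> dist_sum v + degree v + 2 <= 2 * #|G|.
Proof.
rewrite ecc_le_dist => /forallP le2.
have H : \sum_(u : G) (dist u v + adj v u + (u == v) * 2) <= \sum_(u : G) 2.
  apply: leq_sum => u _; have := le2 u.
  by case: (dist_cases u v) => [[-> ->]|[/negPf -> -> ->]|[/negPf -> /negPf -> -> _]|[/negPf ->
    /negPf -> ?]]; rewrite ?eqxx ?adj_irr; lia.
rewrite !big_split /= sum_delta sum_const -/(degree v) -/(dist_sum v) in H; lia.
Qed.

Lemma leaf_nbr v w u : degree v = 1 -> adj v w -> adj v u = (u == w).
Proof.
rewrite degree_card => /eqP/cards1P[t /setP eqt] vw.
by have := eqt u; have := eqt w; rewrite !inE vw => /esym/eqP ->.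
Qed.

Lemma leaf_dist v w u : degree v = 1 -> adj v w -> u != v -> dist u v = (dist u w).+1.
Proof.
move=> dv vw uv; rewrite eq_sym in uv; have [t vt] := dist_desc conG uv.
have := leaf_nbr t dv vw; rewrite vt => /esym/eqP ->.
by rewrite (dist_sym conG u v) (dist_sym conG u w).
Qed.

Lemma leaf_dist_sum v w : degree v = 1 -> adj v w -> dist_sum v + 2 = dist_sum w + #|G|.
Proof.
move=> dv vw.
have H : \sum_(u : G) (dist u v + (u == v) * 2) = \sum_(u : G) (dist u w + 1).
  apply: eq_bigr => u _; case: (eqVneq u v) => [->|uv]; last by rewrite (leaf_dist dv vw uv); lia.
  by rewrite (distxx v); have /eqP -> : dist v w == 1 by rewrite (dist_eq1 conG).
rewrite !big_split /= sum_delta sum_const -/(dist_sum v) -/(dist_sum w) in H; lia.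
Qed.

(** The condition on [w] ensures that a vertex farthest from [w] is not [v]; it is then one step
    farther from [v]. *)
Lemma leaf_ecc v w : degree v = 1 -> adj v w -> 2 <= eccentricity w ->
  (eccentricity w).+1 <= eccentricity v.
Proof.
move=> dv vw ew; have [u eu] := ecc_attained w.
have uv : u != v.
  apply: contraTneq ew => uv; rewrite -eu uv.
  have -> : dist v w = 1; last by []. by apply/eqP; rewrite (dist_eq1 conG).
by rewrite -eu -(leaf_dist dv vw uv) dist_le_ecc.
Qed.

End DistanceSums.

(** * Degree excesses in a unicyclic graph *)

Section UnicyclicSums.
Variable G : sgraph.
Hypothesis conG : connected G.
Hypothesis nontriv : 1 < #|G|.
Implicit Types u v w z : G.

Definition excess v := (degree v).-1.
Definition leaves := \sum_(v : G) (degree v == 1).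

Lemma degree_gt0 v : 0 < degree v.
Proof.
have /card_gt1P[a [b [_ _ ab]]] : 1 < #|G| by [].
have [u uv] : exists u, v != u.
  by have [e|] := eqVneq v a; [exists b; rewrite e|exists a].
have [w vw _] := dist_desc conG uv.
by rewrite /degree (bigD1 w) //= vw.
Qed.

Lemma degreeE v : degree v = (excess v).+1.
Proof. by have := degree_gt0 v; rewrite /excess; lia. Qed.

Lemma leafE v : (degree v == 1) = (excess v == 0).
Proof. by rewrite degreeE. Qed.

Hypothesis sumdeg : \sum_(v : G) degree v = 2 * #|G|.

Lemma sum_excess : \sum_(v : G) excess v = #|G|.
Proof.
have H : \sum_(v : G) degree v = \sum_(v : G) excess v + \sum_(v : G) 1.
  by rewrite -big_split; apply: eq_bigr => v _ /=; rewrite degreeE addn1.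
rewrite sum_const sumdeg in H; lia.
Qed.

Lemma total_dist_sum : 3 * #|G| * #|G| + \sum_(v : G) far v <=
  \sum_(v : G) dist_sum v + \sum_(v : G) excess v * excess v + 8 * #|G|.
Proof.
have H : \sum_(v : G) (3 * #|G| + far v) <= \sum_(v : G) (dist_sum v + degree v + walks2 v + 3).
  by apply: leq_sum => v _; apply: dist_sum_ge3.
rewrite !big_split /= !sum_const sum_walks2 sumdeg in H.
have E : \sum_(v : G) degree v * degree v =
    \sum_(v : G) excess v * excess v + (\sum_(v : G) excess v + (\sum_(v : G) excess v +
      \sum_(v : G) 1)).
  by rewrite -!big_split; apply: eq_bigr => v _ /=; rewrite degreeE; nia.
rewrite !sum_excess sum_const in E; move: H; rewrite E; set n := #|G|; nia.
Qed.

(** For [1 <= e <= X] one has [(e - 1) (e - X) <= 0]; at a leaf, where [e = 0], the product is [X].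
    The excesses sum to [n]. *)
Lemma sum_excess2 X : (forall v, excess v <= X) ->
  \sum_(v : G) excess v * excess v <= #|G| + X * leaves.
Proof.
move=> le.
have H : \sum_(v : G) (excess v * excess v + X) <=
       \sum_(v : G) ((X.+1) * excess v + X * (degree v == 1)).
  apply: leq_sum => v _; rewrite leafE; have := le v.
  by case: (excess v) => [|e] /=; rewrite ?eqxx; nia.
rewrite !big_split /= -!big_distrr /= sum_excess sum_const -/leaves in H; lia.
Qed.

Lemma excess_ge1 v : 1 <= excess v + (degree v == 1).
Proof. by rewrite leafE; case: (excess v). Qed.

(** Non-leaves have excess at least 1 and the average is 1, so a large excess is paid for by
    leaves. *)
Lemma excess_leaves v : excess v <= leaves.+1.
Proof.
have H : \sum_(u : G) (1 + (u == v) * (excess v).-1) <= \sum_(u : G) (excess u + (degree u == 1)).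
  apply: leq_sum => u _; have := excess_ge1 u; case: (eqVneq u v) => [->|_] /=; last by lia.
  by lia.
rewrite !big_split /= sum_delta sum_const sum_excess -/leaves in H; lia.
Qed.

Lemma excess2_leaves u v : u != v -> excess u + excess v <= leaves + 2.
Proof.
move=> uv.
have H : \sum_(t : G) (1 + (t == u) * (excess u).-1 + (t == v) * (excess v).-1) <= \sum_(t : G)
  (excess t + (degree t == 1)).
  apply: leq_sum => t _; have := excess_ge1 t; case: (eqVneq t u) => [->|_] /=.
    by rewrite (negPf uv); lia.
  by case: (eqVneq t v) => [->|_] /=; lia.
rewrite !big_split /= !sum_delta sum_const sum_excess -/leaves in H; lia.
Qed.

Lemma excess2_le u v : u != v -> excess u + excess v <= #|G|.
Proof.
move=> uv; rewrite -sum_excess (bigD1 u) //= leq_add2l (bigD1 v) 1?eq_sym //=; exact: leq_addr.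
Qed.

End UnicyclicSums.

(** * Removing leaves and pendant paths *)

Section Removal.
Variable G : sgraph.
Hypothesis conG : connected G.
Implicit Types (u v w y : G) (K : {set G}).

Lemma sum_setC K (F : G -> nat) : \sum_(x | x \notin ~: K) F x = \sum_(x in K) F x.
Proof. by apply: eq_bigl => x; rewrite inE negbK. Qed.

Lemma sum_degree_induced K :
  \sum_(x : induced (~: K)) degree x + 2 * \sum_(x in K) degree x =
  \sum_(x : G) degree x + \sum_(x in K) \sum_(y in K) adj x y.
Proof.
have -> : \sum_(x : induced (~: K)) degree x = \sum_(x in ~: K) \sum_(y in ~: K) adj x y.
  rewrite -(sum_induced (~: K) (fun x => \sum_(y in ~: K) adj x y)).
  by apply: eq_bigr => x _; rewrite degree_induced.
have E1 : \sum_(x : G) degree x = \sum_(x in ~: K) degree x + \sum_(x in K) degree x.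
  by rewrite (bigID (mem (~: K))) /= sum_setC.
have E2 : \sum_(x in ~: K) degree x =
    \sum_(x in ~: K) \sum_(y in ~: K) adj x y + \sum_(x in ~: K) \sum_(y in K) adj x y.
  rewrite -big_split; apply: eq_bigr => x _ /=.
  by rewrite /degree (bigID (mem (~: K))) /= sum_setC.
have E3 : \sum_(x in K) degree x =
    \sum_(x in ~: K) \sum_(y in K) adj x y + \sum_(x in K) \sum_(y in K) adj x y.
  rewrite [X in _ = X + _]exchange_big /= -big_split; apply: eq_bigr => x _ /=.
  rewrite /degree (bigID (mem (~: K))) /= sum_setC; congr addn.
  by apply: eq_bigr => y _; rewrite adj_sym.
lia.
Qed.

(** A geodesic ending elsewhere does not enter the leaf, from which it could only turn back. *)
Lemma leaf_descent v w : degree v = 1 -> adj v w ->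
  forall u t, u \in ~: [set v] -> t \in ~: [set v] -> u != t ->
  exists z, [/\ z \in ~: [set v], adj u z & dist z t < dist u t].
Proof.
move=> dv vw u t; rewrite !inE => uv tv ut; have [z uz e] := dist_desc conG ut.
exists z; rewrite !inE e; split=> //; apply: contraTneq uz => zv.
apply/negP => uz; have := leaf_nbr u dv vw; rewrite -zv adj_sym uz => /esym/eqP uw.
have := leaf_dist conG dv vw tv; rewrite -zv -uw (dist_sym conG t u) e (dist_sym conG t z); lia.
Qed.

Lemma deg2_nbr w v y u : degree w = 2 -> adj w v -> adj w y -> v != y ->
  adj w u = (u == v) || (u == y).
Proof.
move=> dw wv wy vy.
have sub : [set v; y] \subset [set t | adj w t].
  by apply/subsetP => t; rewrite !inE => /orP[]/eqP->.
have /setP/(_ u) : [set v; y] = [set t | adj w t].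
  by apply/eqP; rewrite eqEcard sub -degree_card dw cards2 vy.
by rewrite !inE => <-.
Qed.

Section PendantPath.
Variables v w y : G.
Hypotheses (dv : degree v = 1) (vw : adj v w) (dw : degree w = 2) (wy : adj w y) (yv : y != v).

Lemma path_mid_nbr u : adj w u = (u == v) || (u == y).
Proof. by apply: deg2_nbr => //; rewrite 1?adj_sym // eq_sym. Qed.

Lemma path_distE u : u != v -> u != w -> dist u w = (dist u y).+1 /\ dist u v = (dist u y).+2.
Proof.
move=> uv uw; have e : dist u w = (dist u y).+1.
  have wu : w != u by rewrite eq_sym.
  have [t wt] := dist_desc conG wu; rewrite !(dist_sym conG w) => e; rewrite e.
  have := wt; rewrite path_mid_nbr.
  case/orP=> /eqP et; last by rewrite et (dist_sym conG y).
  by have := leaf_dist conG dv vw uv; move: e; rewrite et (dist_sym conG v); lia.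
by split=> //; rewrite (leaf_dist conG dv vw uv) e.
Qed.

Lemma path_descent u t : u \in ~: [set v; w] -> t \in ~: [set v; w] -> u != t ->
  exists z, [/\ z \in ~: [set v; w], adj u z & dist z t < dist u t].
Proof.
rewrite !inE !negb_or => /andP[uv uw] /andP[tv tw] ut; have [z uz e] := dist_desc conG ut.
have [d1 d2] := path_distE tv tw.
exists z; rewrite !inE !negb_or e; split=> //; apply/andP; split; apply/negP => /eqP ez.
  have := leaf_nbr u dv vw; rewrite -ez adj_sym uz => /esym/eqP euw.
  by rewrite euw eqxx in uw.
have : adj w u by rewrite -ez adj_sym.
rewrite path_mid_nbr (negPf uv) /= => /eqP uy; move: e; rewrite ez uy !(dist_sym conG _ t); lia.
Qed.

End PendantPath.

Lemma leaf_edge_disjoint v w M E : degree v = 1 -> adj v w -> @matching G M -> E \in M ->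
  w \notin E -> v \notin E.
Proof.
move=> dv vw /andP[Me _] /(subsetP Me) /edgesP[a [b [ab ->]]]; rewrite !inE !negb_or.
move=> /andP[wa wb]; rewrite !(eq_sym v); apply/andP; split; apply/negP => /eqP e.
  by rewrite e (leaf_nbr _ dv vw) eq_sym (negPf wb) in ab.
by rewrite adj_sym e (leaf_nbr _ dv vw) eq_sym (negPf wa) in ab.
Qed.

(** In a maximum matching, exchange the edge at [w], if any, for [v'w]: the size does not drop and
    no edge at [v] remains. *)
Lemma matching_remove_twin v v' w : degree v = 1 -> degree v' = 1 -> adj v w -> adj v' w ->
  v != v' ->
  matching_number G <= matching_number (induced (~: [set v])).
Proof.
move=> dv dv' vw vw' neq; have [M mM <-] := matching_max G.
pose N := [set E in M | w \notin E].
have mN : matching N by apply: matching_sub mM _; apply/subsetP => E; rewrite inE => /andP[].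
have [|mA cA] := matching_add mN vw' (u := v') (v := w).
  move=> E; rewrite inE => /andP[EM wE]; rewrite wE andbT.
  exact: (leaf_edge_disjoint dv' vw' mM EM wE).
apply: leq_trans (matching_del w mM) _; rewrite -/N -cA.
apply: matching_induced mA _ => E /setU1P[->|].
  apply/subsetP => z; rewrite !inE => /orP[]/eqP->; first by rewrite eq_sym.
  by apply: contraTneq vw => <-; rewrite adj_irr.
rewrite inE => /andP[EM wE]; apply/subsetP => z zE; rewrite !inE.
by apply: contraTneq zE => ->; apply: (leaf_edge_disjoint dv vw mM EM wE).
Qed.

(** Only a matching edge at [w] is lost, because an edge at [v] is also an edge at [w]. *)
Lemma matching_remove_path v w : degree v = 1 -> adj v w ->
  matching_number G <= (matching_number (induced (~: [set v; w]))).+1.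
Proof.
move=> dv vw; have [M mM <-] := matching_max G.
pose N := [set E in M | w \notin E].
have mN : matching N by apply: matching_sub mM _; apply/subsetP => E; rewrite inE => /andP[].
apply: leq_trans (matching_del w mM) _; rewrite -/N ltnS.
apply: matching_induced mN _ => E.
rewrite inE => /andP[EM wE]; apply/subsetP => z zE; rewrite !inE negb_or.
apply/andP; split; apply: contraTneq zE => -> //; exact: (leaf_edge_disjoint dv vw mM EM wE).
Qed.

End Removal.

Section Gains.
Variable G : sgraph.
Hypothesis conG : connected G.
Variable n : nat.
Hypothesis cardG : #|G| = n.
Implicit Types (u v w y : G).

Lemma leaf_gain v w : degree v = 1 -> adj v w ->
  ecc_dist_sum (induced (~: [set v])) + \sum_(u : G) eccentricity u * dist u v +
    eccentricity v * dist_sum v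
    <= ecc_dist_sum G.
Proof.
move=> dv vw; have := ecc_dist_sum_induced conG (leaf_descent conG dv vw).
rewrite sum_setC big_set1; apply: leq_trans; rewrite leq_add2r leq_add2l.
rewrite (bigID (mem (~: [set v]))) /= sum_setC big_set1 (distxx v) muln0 addn0.
apply: leq_sum => u _; rewrite sum_setC big_set1 (dist_sym conG u); exact: leqnn.
Qed.

(** Here [dist_sum v >= 3 n - 3 - degree w]. The term of [v] contains it four times; the other terms
    contain it three times up to 2 per neighbour of [w], since all remaining vertices have
    eccentricity at least 3. *)
Lemma leaf_gain_far v w : degree v = 1 -> adj v w -> (forall u, 2 <= eccentricity u) ->
  3 <= eccentricity w ->
  ecc_dist_sum (induced (~: [set v])) + 21 * n <= ecc_dist_sum G + 9 * degree w + 21.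
Proof.
move=> dv vw e2 e3; have := leaf_gain dv vw.
have e4 : 4 <= eccentricity v by have := leaf_ecc conG dv vw; lia.
have D1 := leaf_dist_sum conG dv vw; have D2 := dist_sum_gt2 conG e3; rewrite cardG in D1 D2.
have H : \sum_(u : G) (dist u v * 3) <= \sum_(u : G) (eccentricity u * dist u v + (adj w u +
  adj w u)).
  apply: leq_sum => u _; have := e2 u; have := dist_le_ecc v u; rewrite (dist_sym conG v).
  have [->|uv] := eqVneq u v; first by rewrite (distxx v); lia.
  have := leaf_dist conG dv vw uv; have := dist_eq1 conG u w; rewrite (adj_sym u);
    have := dist_eq0 conG u w.
  case: (eqVneq u w) => [->|_]; first by rewrite (distxx w) => _ _; nia.
  by case: (dist u w) => [//|[|k]] _ <- -> /=; nia.
rewrite -big_distrl !big_split /= -/(dist_sum v) -/(degree w) in H.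
have : 4 * dist_sum v <= eccentricity v * dist_sum v by rewrite leq_mul2r e4 orbT.
lia.
Qed.

(** Now [w] may have eccentricity 2. A deficit of 1 arises at [w] and of 2 at its central
    neighbours; a non-neighbour of eccentricity at least 4 brings a bonus of 3, being at distance at
    least 3 from [v]. *)
Lemma leaf_gain_near v w : degree v = 1 -> adj v w -> (forall u, 2 <= eccentricity u) ->
  ecc_dist_sum (induced (~: [set v])) + 18 * n
    + 3 * #|[set r | [&& r != w, ~~ adj w r & 4 <= eccentricity r]]|
  <= ecc_dist_sum G + 6 * degree w + 2 * #|[set u | adj w u && (eccentricity u <= 2)]| + 25.
Proof.
move=> dv vw e2; have := leaf_gain dv vw.
have e4 : 3 <= eccentricity v by have := leaf_ecc conG dv vw; have := e2 w; lia.
have D1 := leaf_dist_sum conG dv vw; have D2 := dist_sum_ge2 conG w; rewrite cardG in D1 D2.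
set B := [set r | _]; set S := [set u | _].
have H : \sum_(u : G) (dist u v * 3 + (u \in B) * 3) <=
         \sum_(u : G) (eccentricity u * dist u v + (u == w) * 1 + (u \in S) * 2).
  apply: leq_sum => u _; rewrite !inE.
  have := e2 u; have := dist_le_ecc v u; rewrite (dist_sym conG v).
  have [->|uv] := eqVneq u v; first by rewrite (distxx v) (adj_sym w) vw; lia.
  have := leaf_dist conG dv vw uv; have := dist_eq1 conG u w; rewrite (adj_sym u);
    have := dist_eq0 conG u w.
  case: (eqVneq u w) => [->|_]; first by rewrite (distxx w) adj_irr => _ _ -> /=; lia.
  case: (dist u w) => [//|[|k]] _ <- -> /=; first by lia.
  by case: (leqP 4 (eccentricity u)) => ? ? ? /=; nia.
rewrite !big_split /= sum_delta -!big_distrl /= -/(dist_sum v) in H.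
have cs (K : {set G}) : \sum_(u : G) (u \in K) = #|K|.
  by rewrite -sum1_card [RHS]big_mkcond; apply: eq_bigr => u _; case: (u \in K).
rewrite !cs in H.
have : 3 * dist_sum v <= eccentricity v * dist_sum v by rewrite leq_mul2r e4 orbT.
lia.
Qed.

Section PendantPath.
Variables v w y : G.
Hypotheses (dv : degree v = 1) (vw : adj v w) (dw : degree w = 2) (wy : adj w y) (yv : y != v).
Hypothesis e2 : forall u, 2 <= eccentricity u.
Hypothesis dy : degree y + 3 <= n.

Let R := [set r | (r != y) && ~~ adj y r].

Lemma path_neq : [/\ v != w, w != v & y != w].
Proof.
have vw' : v != w by apply: contraTneq vw => ->; rewrite adj_irr.
by split=> //; [rewrite eq_sym|apply: contraTneq wy => ->; rewrite adj_irr].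
Qed.

Lemma path_leaf_dist u : u != v -> u != w -> dist u w = (dist u y).+1 /\ dist u v = (dist u y).+2.
Proof. exact: (path_distE conG dv vw dw wy yv). Qed.

Lemma path_dist_base : [/\ dist w v = 1, dist w y = 1 & dist v y = 2].
Proof.
have [_ wv yw] := path_neq.
have dwv : dist w v = 1 by apply/eqP; rewrite (dist_eq1 conG) adj_sym.
have dwy : dist w y = 1 by apply/eqP; rewrite (dist_eq1 conG).
split=> //; have [_ e] := path_leaf_dist yv yw; rewrite dist_sym // e (distxx y) //.
Qed.

Lemma card_R : #|R| + degree y + 1 = n.
Proof. by have := nonnbr_card y; rewrite cardG addnS -addn1. Qed.

Lemma leaf_in_R : v \in R.
Proof.
rewrite inE eq_sym yv /= adj_sym (leaf_nbr _ dv vw); by have [_ _ ->] := path_neq.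
Qed.

Lemma R_dist r : r \in R -> r != v -> [/\ r != w, 2 <= dist r y, 3 <= dist r w & 4 <= dist r v].
Proof.
rewrite inE => /andP[ry nry] rv.
have rw : r != w by apply: contraNneq nry => ->; rewrite adj_sym.
have [e1 e3] := path_leaf_dist rv rw.
have : 2 <= dist r y.
  have := dist_eq0 conG r y; have := dist_eq1 conG r y; rewrite adj_sym (negPf nry) (negPf ry).
  by case: dist => [|[|]].
by split=> //; lia.
Qed.

Lemma R_other : 1 < #|R| -> exists2 r, r \in R & r != v.
Proof.
move=> R2; have : 0 < #|R :\ v| by have := cardsD1 v R; rewrite leaf_in_R; lia.
by move=> /card_gt0P[r]; rewrite in_setD1 => /andP[? ?]; exists r.
Qed.

Lemma path_ecc : [/\ 4 <= eccentricity v, 3 <= eccentricity w,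
  forall u, u \in R -> 4 <= eccentricity u & forall u, adj y u -> 3 <= eccentricity u].
Proof.
have cR := card_R; have [|r rR rv] := R_other; first by lia.
have [rw r1 r2 r3] := R_dist rR rv.
have ev : 4 <= eccentricity v by apply: leq_trans (dist_le_ecc r v).
have ew : 3 <= eccentricity w by apply: leq_trans (dist_le_ecc r w).
split=> // u.
  have [-> //|uv] := eqVneq u v; move=> uR; have [_ _ _ u4] := R_dist uR uv.
  by apply: leq_trans (dist_le_ecc v u); rewrite (dist_sym conG).
have [->|uv] := eqVneq u v; first by move=> _; apply: leq_trans ev.
have [-> //|uw] := eqVneq u w; move=> yu.
have [_ d] := path_leaf_dist uv uw; apply: leq_trans (dist_le_ecc v u).
by rewrite (dist_sym conG) d; have /eqP -> : dist u y == 1 by rewrite (dist_eq1 conG) adj_sym.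
Qed.

Lemma path_gain :
  ecc_dist_sum (induced (~: [set v; w])) + 53 * n <= ecc_dist_sum G + 20 * degree y + 115.
Proof.
have [ev ew eR eN] := path_ecc; have [nvw nwv nyw] := path_neq.
have [bwv bwy bvy] := path_dist_base.
have := ecc_dist_sum_induced conG (path_descent conG dv vw dw wy yv).
set S := ~: [set v; w].
have sumK (F : G -> nat) : \sum_(x | x \notin S) F x = F v + F w.
  by rewrite /S sum_setC big_setU1 ?inE //= big_set1.
rewrite !sumK.
have Dv : dist_sum v = \sum_(u in S) dist u v + 1.
  by rewrite /dist_sum (bigID (mem S)) /= sumK (distxx v) bwv.
have Dw : dist_sum w = \sum_(u in S) dist u w + 1.
  by rewrite /dist_sum (bigID (mem S)) /= sumK (distxx w) (dist_sym conG) bwv.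
have degS : \sum_(u in S) adj y u + 1 = degree y.
  rewrite [RHS](bigID (mem S)) /= sumK (adj_sym y w) wy adj_sym (leaf_nbr _ dv vw) (negPf nyw).
  by [].
(* A vertex at distance [k] from [y] accounts for at least [e (2 k + 3) + 4 (k + 2) + 3 (k + 1)],
   with [e = 4] for [k >= 2], [e = 3] for [k = 1] and [e = 2] for [k = 0]. This is at least 53, 33
   and 17, respectively. *)
have H : \sum_(u in S) 53 <= \sum_(u in S) (eccentricity u * \sum_(t | t \notin S) dist t u
    + dist u v * 4 + dist u w * 3 + (u == y) * 36 + adj y u * 20).
  apply: leq_sum => u; rewrite !inE negb_or => /andP[uv uw].
  rewrite sumK !(dist_sym conG _ u).
  have [-> ->] := path_leaf_dist uv uw; have := eR u; have := eN u; have := e2 u.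
  rewrite inE adj_sym -(dist_eq1 conG u y) -(dist_eq0 conG u y).
  by case: (dist u y) => [|[|k]] /=; move: ev ew; clear; nia.
have cS : #|S| + 2 = n by rewrite -cardG -(cardsC [set v; w]) cards2 nvw addnC.
have dS : \sum_(u in S) (u == y) <= 1.
  have := sum_delta y (fun _ => 1); rewrite (bigID (mem S)) /= => <-.
  by apply: leq_trans (leq_addr _ _); apply: leq_sum => u _; rewrite muln1.
rewrite !big_split /= -!big_distrl sum_nat_const /= in H.
have Hv : 4 * dist_sum v + (eccentricity v - 4) <= eccentricity v * dist_sum v by rewrite Dv; nia.
have Hw : 3 * dist_sum w + (eccentricity w - 3) <= eccentricity w * dist_sum w by rewrite Dw; nia.
lia.
Qed.

(** Only [y] can have eccentricity 2, and then [dist_sum y <= 2 n - 2 - degree y] limits the loss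
    against the factor 3. On [R] the factor is 4. *)
Lemma path_direct : 3 * \sum_(u : G) dist_sum u + \sum_(r in R) dist_sum r + degree y + 2
  <= ecc_dist_sum G + 2 * n.
Proof.
have [ev ew eR eN] := path_ecc.
have H : \sum_(u : G) (dist_sum u * 3 + (u \in R) * dist_sum u + (u == y) * (degree y + 2)) <=
         \sum_(u : G) (eccentricity u * dist_sum u + (u == y) * (2 * n)).
  apply: leq_sum => u _; have := eR u; have := eN u; rewrite inE.
  have [->|uy] := eqVneq u y => /=; last first.
    by case: (adj y u) => /= [/(_ isT) ? _|_ /(_ isT) ?]; nia.
  move=> _ _; have [e3|] := leqP 3 (eccentricity y).
    by have := leq_mul2r (dist_sum y) 3 (eccentricity y); rewrite e3 orbT; lia.
  move=> e3; have := dist_sum_ecc2 conG (v := y); rewrite cardG; have := e2 y; nia.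
have mk : \sum_(u : G) (u \in R) * dist_sum u = \sum_(r in R) dist_sum r.
  by rewrite [RHS]big_mkcond; apply: eq_bigr => u _; case: (u \in R); rewrite ?mul1n.
rewrite !big_split /= !sum_delta mk -big_distrl /= in H; rewrite /ecc_dist_sum; lia.
Qed.

Lemma path_leaf_dist_sum : 4 * n <= dist_sum v + degree y + 8.
Proof.
have [bwv bwy bvy] := path_dist_base; have [nvw nwv nyw] := path_neq.
have := dist_sum_ge2 conG y; rewrite cardG.
have H : \sum_(u : G) (dist u y + 2) = \sum_(u : G) (dist u v + (u == w) * 2 + (u == v) * 4).
  apply: eq_bigr => u _; have [->|uv] := eqVneq u v; first by rewrite (distxx v) bvy (negPf nvw).
  have [->|uw] := eqVneq u w; first by rewrite bwv bwy.
  by have [_ ->] := path_leaf_dist uv uw; lia.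
rewrite !big_split /= !sum_delta sum_const cardG -/(dist_sum v) -/(dist_sum y) in H; lia.
Qed.

(** From [r], the vertices [w] and [v] are at distance at least 3 and 4, which adds 3 to
    [dist_sum_ge2]. *)
Lemma path_far_dist_sum r : r \in R -> r != v -> 2 * n + 1 <= dist_sum r + degree r.
Proof.
move=> rR rv; have [rw r1 r2 r3] := R_dist rR rv; have [nvw nwv nyw] := path_neq.
have H : \sum_(u : G) (2 + (u == w) * 1 + (u == v) * 2) <= \sum_(u : G) (dist u r + adj r u +
  (u == r) * 2).
  apply: leq_sum => u _; have [->|uv] := eqVneq u v.
    by rewrite (dist_sym conG v) (negPf nvw); move: r3; clear; lia.
  have [->|uw] := eqVneq u w; first by rewrite (dist_sym conG w); move: r2; clear; lia.
  by case: (dist_cases conG u r) => [[-> ->]|[_ -> ->]|[_ _ -> _]|[_ _]]; rewrite ?eqxx; clear; lia.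
rewrite !big_split /= !sum_delta sum_const cardG -/(dist_sum r) -/(degree r) in H; move: H; clear;
  lia.
Qed.

(** The leaf [v] is at distance at least 4 from all other elements of [R], and each such pair is
    counted from both ends. *)
Lemma path_far : 2 * #|R| <= \sum_(u : G) far u + 2.
Proof.
have R1 := leaf_in_R.
have E : \sum_(r in R :\ v) 1 = #|R| - 1.
  by have := cardsD1 v R; rewrite R1 sum1_card; lia.
have f1 : \sum_(r in R :\ v) 1 <= far v.
  rewrite /far [X in _ <= X](bigID (mem (R :\ v))) /=; apply: leq_trans (leq_addr _ _).
  apply: leq_sum => r; rewrite in_setD1 => /andP[rv rR]; by have [_ _ _ ->] := R_dist rR rv.
have f2 : \sum_(r in R :\ v) 1 <= \sum_(r in R :\ v) far r.
  apply: leq_sum => r; rewrite in_setD1 => /andP[rv rR]; have [_ _ _ f] := R_dist rR rv.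
  by rewrite /far (bigD1 v) //= (dist_sym conG) f.
rewrite (bigD1 v) //= (bigID (mem (R :\ v))) /=.
rewrite (eq_bigl (fun r => r \in R :\ v)); last by move=> r; rewrite /= in_setD1; case: eqP.
lia.
Qed.

End PendantPath.
End Gains.

(** * Pendant paths in graphs without twin leaves *)

Definition twin_free (G : sgraph) : Prop := forall v v' w : G,
  degree v = 1 -> degree v' = 1 -> adj v w -> adj v' w -> v = v'.

Definition pendant_path_free (G : sgraph) : Prop := forall v w : G,
  degree v = 1 -> adj v w -> degree w <> 2.

Section TwinFree.
Variable G : sgraph.
Hypothesis conG : connected G.
Variable n : nat.
Hypothesis cardG : #|G| = n.
Hypothesis n3 : 3 <= n.
Implicit Types (u v w y : G).

Let nontriv : 1 < #|G|. Proof. by rewrite cardG; apply: ltn_trans n3. Qed.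

Lemma leaf_leaf v w : degree v = 1 -> adj v w -> degree w <> 1.
Proof.
move=> dv vw dw; have : 0 < #|~: [set v; w]|.
  have := cardsC [set v; w]; rewrite cards2 cardG; case: (v != w); lia.
move=> /card_gt0P[u]; rewrite !inE negb_or => /andP[uv uw].
have wv : adj w v by rewrite adj_sym.
have := leaf_dist conG dv vw uv; have := leaf_dist conG dw wv uw; lia.
Qed.

Lemma leaf_support v : degree v = 1 -> exists w, adj v w.
Proof.
rewrite degree_card => /eqP/cards1P[w e]; exists w.
have : w \in [set u | adj v u] by rewrite e inE.
by rewrite inE.
Qed.

Lemma leaves_card : leaves G = #|[set v : G | degree v == 1]|.
Proof. by rewrite -sum1dep_card [RHS]big_mkcond; apply: eq_bigr => v _; case: eqP. Qed.

(** The pendant edges form a matching, as two leaves neither are adjacent nor share a neighbour. *)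
Lemma leaves_le_matching : twin_free G -> leaves G <= matching_number G.
Proof.
move=> tf; pose sup v := odflt v [pick w | adj v w].
have supP v : degree v = 1 -> adj v (sup v).
  by move=> /leaf_support[w vw]; rewrite /sup; case: pickP => //= /(_ w); rewrite vw.
have disj v v' : degree v = 1 -> degree v' = 1 -> v != v' -> [disjoint [set v; sup v] & [set v';
  sup v']].
  move=> dv dv' neq; apply/pred0P => x /=; rewrite !inE; apply/negP.
  have sv := supP _ dv; have sv' := supP _ dv'.
  case/andP=> /orP[]/eqP-> /orP[]/eqP e.
  - by rewrite e eqxx in neq.
  - by apply: (leaf_leaf dv' sv'); rewrite -e.
  - by apply: (leaf_leaf dv sv); rewrite e.
  - by move: neq; rewrite (tf v v' (sup v) dv dv' sv) ?eqxx // e.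
pose M := [set [set v; sup v] | v in [set v : G | degree v == 1]].
have inj : {in [set v : G | degree v == 1] &, injective (fun v => [set v; sup v])}.
  move=> v v'; rewrite !inE => /eqP dv /eqP dv' e; apply/eqP; apply: contraT => neq.
  by have /pred0P/(_ v) := disj _ _ dv dv' neq; rewrite /= -e !inE eqxx.
rewrite leaves_card -(card_in_imset inj); apply: matching_bound; apply/andP; split.
  apply/subsetP => _ /imsetP[v + ->]; rewrite inE => /eqP dv; apply/edgesP.
  by exists v, (sup v); rewrite supP.
apply/trivIsetP => _ _ /imsetP[v + ->] /imsetP[v' + ->]; rewrite !inE => /eqP dv /eqP dv' neq.
by apply: disj => //; apply: contraNneq neq => ->.
Qed.

Hypothesis sumdeg : \sum_(v : G) degree v = 2 * #|G|.

Section PendantPath.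
Variables v w y : G.
Hypotheses (dv : degree v = 1) (vw : adj v w) (dw : degree w = 2) (wy : adj w y) (yv : y != v).
Hypothesis e2 : forall u, 2 <= eccentricity u.

Lemma path_bound3 : (forall u, degree u + 3 <= n) -> leaves G <= 3 -> 6 <= n ->
  6 * n * n < ecc_dist_sum G + 5 * n + 53.
Proof.
move=> dle L3 n6; have dy := dle y.
have A1 := path_direct conG cardG dv vw dw wy yv e2 dy.
have A2 := total_dist_sum conG nontriv sumdeg; rewrite cardG in A2.
have A3 := path_far conG cardG dv vw dw wy yv dy.
have A4 := card_R cardG y.
have A5 := path_leaf_dist_sum conG cardG dv vw dw wy yv dy.
have R2 : 1 < #|[set r | (r != y) && ~~ adj y r]| by lia.
have [r rR rv] := R_other cardG dv vw dw wy yv dy R2.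
have A6 := path_far_dist_sum conG cardG dv vw dw wy yv dy rR rv.
have A7 : dist_sum v + dist_sum r <= \sum_(r in [set r | (r != y) && ~~ adj y r]) dist_sum r.
  rewrite [X in _ <= X](bigD1 v) ?(leaf_in_R dv vw wy yv) //= leq_add2l (bigD1 r) /=;
    first exact: leq_addr.
  by rewrite rR rv.
have xle u : excess u + 4 <= n by have := dle u; have := degreeE conG nontriv u; lia.
have xle4 u : excess u <= 4 by have := excess_leaves conG nontriv sumdeg u; lia.
have dr := degreeE conG nontriv r; have xr := xle r; have xr4 := xle4 r.
have S k : (forall u, excess u <= k) -> \sum_(u : G) excess u * excess u <= n + k * 3.
  move=> H; have := sum_excess2 conG nontriv sumdeg H; rewrite cardG => le.
  by apply: leq_trans le _; rewrite leq_add2l leq_mul2l L3 orbT.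
(* The leaf bound 4 on the excess suffices from [n = 8] on; for [n = 6, 7] the degree bound [n - 4]
   is sharper. *)
have [n8|n8] := leqP 8 n.
  have nn : 8 * n <= n * n by rewrite leq_mul2r n8 orbT.
  by have := S 4 xle4; lia.
have : n = 6 \/ n = 7 by lia.
case=> en; [have := S 2|have := S 3]; rewrite en in A1 A2 A3 A4 A5 A6 A7 xle xr dy *.
  by move=> /(_ (fun u => ltac:(have := xle u; lia))); lia.
by move=> /(_ (fun u => ltac:(have := xle u; lia))); lia.
Qed.

(** At [m = 4] the bound of part (iii) is [6 n^2 + 5 n - 47]; 52 is 47 plus the slack 5 of
    [lower_bounds]. The degree bound puts two vertices besides [v] into [R], whose distance sums are
    both used. *)
Lemma path_bound4 : (forall u, degree u + 4 <= n) -> leaves G <= 4 -> 8 <= n ->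
  6 * n * n + 5 * n <= ecc_dist_sum G + 52 /\
  (9 <= n -> 6 * n * n + 5 * n < ecc_dist_sum G + 47).
Proof.
move=> dle L4 n8; have dy : degree y + 3 <= n by have := dle y; lia.
have A1 := path_direct conG cardG dv vw dw wy yv e2 dy.
have A2 := total_dist_sum conG nontriv sumdeg; rewrite cardG in A2.
have A3 := path_far conG cardG dv vw dw wy yv dy.
have A4 := card_R cardG y.
have A5 := path_leaf_dist_sum conG cardG dv vw dw wy yv dy.
set R := [set r | (r != y) && ~~ adj y r] in A1 A3 A4.
have vR : v \in R by exact: (leaf_in_R dv vw wy yv).
have R3 : 1 < #|R :\ v| by have := cardsD1 v R; rewrite vR; have := dle y; lia.
have /card_gt1P[r [r' []]] := R3; rewrite !in_setD1 => /andP[rv rR] /andP[rv' rR'] neq.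
have A6 := path_far_dist_sum conG cardG dv vw dw wy yv dy rR rv.
have A6' := path_far_dist_sum conG cardG dv vw dw wy yv dy rR' rv'.
have A7 : dist_sum v + (dist_sum r + dist_sum r') <= \sum_(r in R) dist_sum r.
  rewrite [X in _ <= X](bigD1 v) //= leq_add2l (bigD1 r) /=; last by rewrite rR rv.
  rewrite leq_add2l (bigD1 r') /=; first exact: leq_addr.
  by rewrite rR' rv' eq_sym.
have xle u : excess u + 5 <= n by have := dle u; have := degreeE conG nontriv u; lia.
have xle5 u : excess u <= 5 by have := excess_leaves conG nontriv sumdeg u; lia.
have dr := degreeE conG nontriv r; have dr' := degreeE conG nontriv r'.
have xx := excess2_leaves conG nontriv sumdeg neq.
have S k : (forall u, excess u <= k) -> \sum_(u : G) excess u * excess u <= n + k * 4.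
  move=> H; have := sum_excess2 conG nontriv sumdeg H; rewrite cardG => le.
  by apply: leq_trans le _; rewrite leq_add2l leq_mul2l L4 orbT.
have dley := dle y.
have [n10|n10] := leqP 10 n.
  have nn : 10 * n <= n * n by rewrite leq_mul2r n10 orbT.
  by have := S 5 xle5; lia.
have : n = 8 \/ n = 9 by lia.
case=> en; [have := S 3|have := S 4]; rewrite en in A1 A2 A3 A4 A5 A6 A6' A7 xle dy dley *.
  by move=> /(_ (fun u => ltac:(have := xle u; lia))); lia.
by move=> /(_ (fun u => ltac:(have := xle u; lia))); lia.
Qed.

End PendantPath.
End TwinFree.

(** * Cycles with at most one leaf at each vertex *)

Section Sun.
Variable G : sgraph.
Hypothesis conG : connected G.
Variable n : nat.
Hypothesis cardG : #|G| = n.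
Hypothesis n3 : 3 <= n.
Hypothesis tf : twin_free G.
Hypothesis pf : pendant_path_free G.
Implicit Types (u v w t p : G).

Let nontriv : 1 < #|G|. Proof. by rewrite cardG; apply: ltn_trans n3. Qed.

Definition leaf_nbrs v := \sum_(u : G) adj v u * (degree u == 1).
(** Without twins [leaf_nbrs] is at most 1, so this is the number of neighbours that carry a
    leaf. *)
Definition leafed_nbrs v := \sum_(u : G) adj v u * leaf_nbrs u.
Local Notation l := leaf_nbrs.
Local Notation h := leafed_nbrs.
Local Notation L := (leaves G).
Local Notation lf v := (degree v == 1).

Lemma leaf_nbrs_le1 v : l v <= 1.
Proof.
rewrite leqNgt; apply/negP => gt.
have E : l v = #|[set u | adj v u && (degree u == 1)]|.
  by rewrite /leaf_nbrs -sum1dep_card [RHS]big_mkcond; apply: eq_bigr => u _; case: adj; case: eqP.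
move: gt; rewrite E => /card_gt1P[a [b []]]; rewrite !inE => /andP[va /eqP da] /andP[vb /eqP db].
by rewrite (tf da db (w := v)) ?eqxx // adj_sym.
Qed.

Lemma leaf_nbrs_leaf v : degree v = 1 -> l v = 0.
Proof.
move=> dv; apply: big1 => u _; case vu : (adj v u) => //=.
by case: eqP => // du; have := leaf_leaf conG cardG n3 dv vu.
Qed.

Lemma leaf_nbrs_gt0 v : 0 < l v -> exists2 t, degree t = 1 & adj t v.
Proof.
rewrite lt0n sum_nat_eq0 negb_forall => /existsP[t /=].
have [dt|_] := eqVneq (degree t) 1; last by rewrite muln0.
by case vt : (adj v t) => // _; exists t; rewrite // adj_sym.
Qed.

Lemma support_leaf_nbrs t v : degree t = 1 -> adj t v -> l v = 1.
Proof.
move=> dt tv; apply/eqP; rewrite eqn_leq leaf_nbrs_le1 /= /leaf_nbrs (bigD1 t) //=.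
by rewrite adj_sym tv dt.
Qed.

Lemma degree_ge v : 2 + l v <= degree v + lf v.
Proof.
have d0 := degree_gt0 conG nontriv v.
have [dv|dv] := eqVneq (degree v) 1; first by rewrite (leaf_nbrs_leaf dv) dv.
have := leaf_nbrs_le1 v; case e : (l v) => [|[|]] // _; first by lia.
have [t dt tv] : exists2 t, degree t = 1 & adj t v by apply: leaf_nbrs_gt0; rewrite e.
by have := pf dt tv; lia.
Qed.

Lemma sum_leaf_nbrs : \sum_(v : G) l v = L.
Proof.
rewrite exchange_big; apply: eq_bigr => u _ /=; rewrite -big_distrl /=.
rewrite (eq_bigr (fun i => (adj u i : nat))) => [|i _]; last by rewrite adj_sym.
by rewrite -/(degree u); case: eqP => [->|]; rewrite ?muln1 ?muln0.
Qed.

Hypothesis sumdeg : \sum_(v : G) degree v = 2 * #|G|.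

(* Both sides have the same sum over all vertices, so [degree_ge] is an equality everywhere: the
   vertices of degree at least 2 form a cycle, each carrying at most one leaf. *)
Lemma sun_degree v : degree v + lf v = 2 + l v.
Proof.
have S : \sum_(u : G) (2 + l u) = \sum_(u : G) (degree u + lf u).
  by rewrite !big_split /= sum_const sum_leaf_nbrs sumdeg.
have le u : 2 + l u <= degree u + lf u ?= iff (2 + l u == degree u + lf u).
  by split=> //; apply: degree_ge.
have := leqif_sum (P := predT) (fun u _ => le u).
by case=> _; rewrite S eqxx => /esym/forallP/(_ v)/eqP <-.
Qed.

Lemma sun_excess v : excess v + lf v = 1 + l v.
Proof. by have := sun_degree v; rewrite degreeE //; case: (excess v == 0); lia. Qed.

Lemma sun_leaves : 2 * L <= n.
Proof.
have H : \sum_(v : G) (lf v + l v) <= \sum_(v : G) 1.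
  apply: leq_sum => v _; case: eqP => [/leaf_nbrs_leaf ->|_] //; exact: leaf_nbrs_le1.
rewrite big_split /= sum_leaf_nbrs sum_const cardG -/(leaves G) in H; lia.
Qed.

(** The excess is 0 at a leaf, 2 at a cycle vertex with a leaf, and 1 at the other cycle
    vertices. *)
Lemma sun_excess2 : \sum_(v : G) excess v * excess v = n + 2 * L.
Proof.
have H : \sum_(v : G) (excess v * excess v + lf v) = \sum_(v : G) (1 + l v * 3).
  apply: eq_bigr => v _; have := sun_excess v; have := leaf_nbrs_le1 v.
  have [/leaf_nbrs_leaf ->|_] := eqVneq (degree v) 1; first by move=> _ /=; nia.
  by case: (l v) => [|[|]] //= _; case: (excess v) => [|[|[|]]].
rewrite !big_split /= -big_distrl /= sum_leaf_nbrs sum_const cardG -/(leaves G) in H; lia.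
Qed.

Lemma sun_total : 9 * n * n + 3 * \sum_(v : G) far v <= 3 * \sum_(v : G) dist_sum v + 27 * n +
  6 * L.
Proof.
have := total_dist_sum conG nontriv sumdeg; rewrite sun_excess2 cardG; lia.
Qed.

Lemma sun_walks2 v : walks2 v + l v = 2 * degree v + h v.
Proof.
have H : \sum_(u : G) (adj v u * degree u + adj v u * lf u) = \sum_(u : G) (adj v u * 2 +
  adj v u * l u).
  by apply: eq_bigr => u _; rewrite -!mulnDr sun_degree.
by rewrite !big_split /= -big_distrl /= in H; rewrite mulnC.
Qed.

Definition core v := degree v != 1.

Lemma core_nbrs v : core v -> \sum_(u : G) adj v u * core u = 2.
Proof.
move=> cv; have H : \sum_(u : G) (adj v u * core u + adj v u * lf u) = \sum_(u : G) adj v u.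
  by apply: eq_bigr => u _; rewrite /core; case: (adj v u); case: eqP.
rewrite big_split /= -/(leaf_nbrs v) -/(degree v) in H.
have E := sun_degree v; rewrite (negPf (cv : degree v != 1)) in E; lia.
Qed.

Lemma leafed_nbrs_le2 v : core v -> h v <= 2.
Proof.
move=> cv; rewrite -(core_nbrs cv); apply: leq_sum => u _; rewrite leq_mul2l /core.
by apply/orP; right; case: eqP => [/leaf_nbrs_leaf ->|_] //; apply: leaf_nbrs_le1.
Qed.

Lemma leaf_support_core t p : degree t = 1 -> adj t p -> core p.
Proof. by move=> dt tp; apply/eqP; apply: (leaf_leaf conG cardG n3 dt tp). Qed.

Lemma core_degree v : core v -> degree v = 2 + l v.
Proof. by rewrite /core => cv; have := sun_degree v; case: eqP cv => //; rewrite addn0. Qed.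

Lemma core_walks2 v : core v -> walks2 v = 4 + l v + h v.
Proof. by move=> cv; have := sun_walks2 v; rewrite core_degree //; lia. Qed.

(** The support has degree 3 and at most [4 + 1 + 2] walks of length 2, hence distance sum at least
    [3 n - 13]; moving to the leaf adds [n - 2]. *)
Lemma leaf_dist_sum_ge t : degree t = 1 -> 4 * n <= dist_sum t + 15.
Proof.
move=> dt; have [p tp] := leaf_support dt; have cp := leaf_support_core dt tp.
have := leaf_dist_sum conG dt tp; have := dist_sum_ge3 conG p.
have := leaf_nbrs_le1 p; have := leafed_nbrs_le2 cp.
by rewrite core_walks2 // core_degree // (support_leaf_nbrs dt tp) cardG; lia.
Qed.

Lemma sun_ecc3 v : 9 <= n -> 3 <= eccentricity v.
Proof.
move=> n9; rewrite ltnNge; apply/negP => /(ball2_card conG); rewrite cardG.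
have [dv|cv] := boolP (degree v == 1).
  have [p vp] := leaf_support (eqP dv); have cp := leaf_support_core (eqP dv) vp.
  have : walks2 v = degree p.
    rewrite -(sum_delta p (fun w => degree w)); apply: eq_bigr => w _.
    by rewrite (leaf_nbr _ (eqP dv) vp).
  by rewrite core_degree //; have := leaf_nbrs_le1 p; lia.
by rewrite core_walks2 //; have := leaf_nbrs_le1 v; have := leafed_nbrs_le2 cv; lia.
Qed.

Lemma core_desc v t : core v -> t != v -> exists t', [/\ core t',
  adj t t' & dist t v = (dist t' v).+1].
Proof.
move=> cv tv; have [t' tt' e] := dist_desc conG tv; exists t'; split=> //.
apply/negP => /eqP dt'; have t'v : t' != v by apply: contraNneq cv => <-; rewrite dt'.
have [z t'z ez] := dist_desc conG t'v.
have : z == t by rewrite -(leaf_nbr z dt' (w := t)) // adj_sym.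
by move=> /eqP ezt; move: ez; rewrite ezt; lia.
Qed.

Definition sphere v k := \sum_(t : G) core t * (dist t v == k).

Lemma sphere1 v : core v -> sphere v 1 = 2.
Proof.
move=> cv; rewrite -(core_nbrs cv); apply: eq_bigr => t _.
by rewrite (dist_eq1 conG) adj_sym mulnC.
Qed.

(** A cycle vertex at distance [k + 1] has two neighbours on the cycle; one is nearer to [v], so at
    most one is farther. *)
Lemma sphereS v k : core v -> sphere v k.+2 <= sphere v k.+1.
Proof.
move=> cv.
have step t : core t * (dist t v == k.+2) <=
    \sum_(t' : G) (core t' * (dist t' v == k.+1)) * (adj t' t * core t * (dist t v == k.+2)).
  case ct : (core t) => //; case: eqP => // e; have tv : t != v by rewrite -(dist_eq0 conG) e.
  have [t' [ct' tt' e']] := core_desc cv tv; rewrite (bigD1 t') //= ct' adj_sym tt'.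
  by move: e'; rewrite e => -[<-]; rewrite eqxx.
have H1 : sphere v k.+2 <= \sum_(t : G) \sum_(t' : G)
    (core t' * (dist t' v == k.+1)) * (adj t' t * core t * (dist t v == k.+2)).
  by apply: leq_sum => t _; apply: step.
apply: leq_trans H1 _; rewrite exchange_big /=.
apply: leq_sum => t' _; rewrite -big_distrr /=.
case ct' : (core t') => //; case: eqP => // e; rewrite !mul1n.
have tv : t' != v by rewrite -(dist_eq0 conG) e.
have [t0 [ct0 tt0 e0]] := core_desc cv tv.
have H : \sum_(t : G) (adj t' t * core t * (dist t v == k.+2) +
  (t == t0) * 1) <= \sum_(t : G) adj t' t * core t.
  apply: leq_sum => t _; have [->|_] := eqVneq t t0; last by rewrite addn0; case: (dist t v == _);
    lia.
  by rewrite ct0 tt0; case: eqP => // e1; move: e0; rewrite e e1; lia.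
by rewrite big_split /= sum_delta (core_nbrs ct') in H; lia.
Qed.

(** At most [1 + 2 + 2 + 2] cycle vertices are within distance 3 of [v]; all others are leaves. *)
Lemma ball3_card v : core v -> eccentricity v <= 3 -> n <= L + 7.
Proof.
move=> cv; rewrite ecc_le_dist => /forallP e3.
have H : \sum_(t : G) 1 <= \sum_(t : G) (lf t + core t * (dist t v == 0) + core t * (dist t v == 1)
   + core t * (dist t v == 2) + core t * (dist t v == 3)).
  apply: leq_sum => t _; rewrite /core; case: eqP => //= _.
  by have := e3 t; case: (dist t v) => [|[|[|[|]]]].
rewrite !big_split /= sum_const cardG -/(leaves G) -!/(sphere v _) in H.
have s0 : sphere v 0 = 1.
  rewrite -(sum_delta v (fun _ => 1)); apply: eq_bigr => t _; rewrite (dist_eq0 conG) muln1 mulnC.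
  by case: eqP => [->|]; rewrite ?mul0n ?mul1n ?cv.
have s1 := sphere1 cv; have s2 := sphereS 0 cv; have s3 := sphereS 1 cv; lia.
Qed.

Lemma leaf_ecc4 t p : degree t = 1 -> adj t p -> 3 <= eccentricity p -> 4 <= eccentricity t.
Proof. by move=> dt tp ep; have := leaf_ecc conG dt tp; lia. Qed.

Lemma sun_all4 : (forall v, 3 <= eccentricity v) -> L + 8 <= n ->
  12 * n * n <= ecc_dist_sum G + 36 * n + 8 * L.
Proof.
move=> e3 nL; have e4 v : 4 <= eccentricity v.
  have [dv|cv] := boolP (degree v == 1).
    by have [p vp] := leaf_support (eqP dv); apply: (leaf_ecc4 (eqP dv) vp).
  by rewrite ltnNge; apply/negP => /(ball3_card cv); lia.
have H : \sum_(v : G) dist_sum v * 4 <= ecc_dist_sum G.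
  by apply: leq_sum => v _; rewrite mulnC leq_mul2r e4 orbT.
by rewrite -big_distrl /= in H; have := sun_total; lia.
Qed.

Lemma sun_mixed : (forall v, 3 <= eccentricity v) ->
  9 * n * n + 4 * L * n + 3 * \sum_(v : G) far v <= ecc_dist_sum G + 27 * n + 21 * L.
Proof.
move=> e3.
have H : \sum_(v : G) (dist_sum v * 3 + lf v * (4 * n)) <= \sum_(v : G) (eccentricity v * dist_sum
  v + lf v * 15).
  apply: leq_sum => v _; have := e3 v; case: eqP => [dv|_] /=; last by nia.
  have := leaf_dist_sum_ge dv; have [p vp] := leaf_support dv.
  by have := leaf_ecc4 dv vp (e3 p); nia.
rewrite !big_split /= -!big_distrl /= -/(leaves G) in H; have := sun_total; rewrite /ecc_dist_sum;
  lia.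
Qed.

Lemma sun_large m : 9 <= n -> 2 * m <= n ->
  6 * n * n + m * m + 9 * m * n + 57 < ecc_dist_sum G + 30 * m +
    31 * n /\ 6 * n * n < ecc_dist_sum G + 5 * n + 53.
Proof.
move=> n9 mn; have e3 v := sun_ecc3 v n9.
(* The part of the bound depending on [m] is largest at [m = n / 2], where four times it is
   [19 n^2 - 60 n]. *)
have fm : 4 * (m * m + 9 * m * n) + 60 * n <= 19 * (n * n) + 120 * m by nia.
have nn : 9 * n <= n * n by rewrite leq_mul2r n9 orbT.
have L2 := sun_leaves.
have [nL|nL] := leqP (L + 8) n.
  by have := sun_all4 e3 nL; lia.
(* Now [n <= L + 7] and [2 L <= n], which leaves six values of [n]. *)
have mx := sun_mixed e3; have : n <= 14 by lia.
move: mx L2 nL fm; move: (L) (ecc_dist_sum G) (\sum_(v : G) far v) => k xi fr.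
clear -n9; move=> mx L2 nL fm n14; have : n \in iota 9 6 by rewrite mem_iota; lia.
by rewrite !inE => /orP[|/orP[|/orP[|/orP[|/orP[|]]]]] /eqP e; subst n; lia.
Qed.

Lemma far_ge2 t : 4 <= eccentricity t -> 2 <= \sum_(v : G) far v.
Proof.
have [u <-] := ecc_attained t => tu.
have ut : u != t by apply: contraTneq tu => ->; rewrite (distxx t).
have f (a b : G) : 4 <= dist a b -> 0 < far b by move=> ab; rewrite /far (bigD1 a) //= ab.
rewrite (bigD1 t) //= (bigD1 u) //=; have := f _ _ tu; rewrite (dist_sym conG) in tu.
have := f _ _ tu; lia.
Qed.

(** * Cycles with leaves on six, seven or eight vertices *)

Section SmallSun.
Hypothesis n6 : 6 <= n.

Local Notation central v := (eccentricity v <= 2).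

Lemma sun_ecc2 v : 2 <= eccentricity v.
Proof.
apply: (ecc_ge2 conG); rewrite cardG; have := sun_degree v; have := leaf_nbrs_le1 v; lia.
Qed.

Lemma central_core v : central v -> core v.
Proof.
move=> cv; apply/negP => /eqP dv; have [p vp] := leaf_support dv.
by have := leaf_ecc conG dv vp (sun_ecc2 p); have := sun_ecc2 p; lia.
Qed.

Lemma central_card v : central v -> n <= 5 + l v + h v.
Proof.
by move=> cv; have := ball2_card conG cv; rewrite (core_walks2 (central_core cv)) cardG; lia.
Qed.

Lemma central_leafed v p : central v -> l p = 1 -> p = v \/ adj v p.
Proof.
move=> cv lp; have [t dt tp] : exists2 t, degree t = 1 & adj t p by apply: leaf_nbrs_gt0;
  rewrite lp.
have vt : v != t by apply: contraTneq (central_core cv) => ->; rewrite /core dt.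
have := leaf_dist conG dt tp vt; have := leq_trans (dist_le_ecc t v) cv.
rewrite (dist_sym conG t) (dist_sym conG v p) => le e.
case: (dist_cases conG p v) => [[-> _]|[_ ? _]|[_ _ ? _]|[_ _ ?]]; [by left|by right|lia|lia].
Qed.

Lemma central_leaves v : central v -> L = l v + h v.
Proof.
move=> cv; rewrite -sum_leaf_nbrs -(sum_delta v l) -big_split; apply: eq_bigr => p _ /=.
have := leaf_nbrs_le1 p; case e : (l p) => [|[|]] // _; first by rewrite !muln0.
by case: (central_leafed cv e) => [->|vp]; [rewrite eqxx adj_irr|rewrite vp;
  case: eqP vp => // ->; rewrite adj_irr].
Qed.

Lemma central_triangle v a b : central v -> adj v a -> adj v b -> adj a b -> n + 2 <= 5 + l v + h v.
Proof.
move=> cv va vb ab; have := cv; rewrite ecc_le_dist => /forallP le2.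
have neq : a != b by apply: contraTneq ab => ->; rewrite adj_irr.
have va' : (a == v) = false by apply: contraTF va => /eqP ->; rewrite adj_irr.
have vb' : (b == v) = false by apply: contraTF vb => /eqP ->; rewrite adj_irr.
have w (x z : G) : adj v x -> adj x z -> 0 < \sum_(t : G) adj v t * adj t z.
  by move=> vx xz; rewrite (bigD1 x) //= vx xz.
have H : \sum_(u : G) (1 + (u == v) * degree v + (u == a) * 1 + (u == b) * 1) <=
       \sum_(u : G) (adj v u + \sum_(w : G) adj v w * adj w u + (u == v) * 1).
  apply: leq_sum => u _; have [->|ua] := eqVneq u a.
    by rewrite (negPf neq) va' va; have := w b a vb; rewrite adj_sym ab => /(_ isT); lia.
  have [->|ub] := eqVneq u b; first by rewrite vb' vb; have := w a b va ab; lia.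
  have := le2 u; case: (dist_cases conG u v) => [[-> ->]|[/negPf -> -> ->]|[/negPf -> _ ->
    ?]|[/negPf -> _ ?]].
  - by rewrite closed_walks2 eqxx; lia.
  - lia.
  - lia.
  - lia.
rewrite !big_split /= !sum_delta sum_const -walks2_sum -/(degree v) cardG in H.
by rewrite (core_walks2 (central_core cv)) in H; lia.
Qed.

Definition centers := \sum_(v : G) (central v).
Definition leafed_centers := \sum_(v : G) (central v) * l v.

Lemma leafed_centers_le : leafed_centers <= L.
Proof.
rewrite -sum_leaf_nbrs; apply: leq_sum => v _; case: (central v); lia.
Qed.

(** Compare with three times the total distance sum. A central vertex loses its own distance sum, at
    most [2 n - 4 - l v]; a leaf with non-central support has eccentricity at least 4 and gains at
    least [b]. *)
Lemma sun_bound b : (forall t p, degree t = 1 -> adj t p -> ~~ central p -> b <= dist_sum t) ->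
  9 * n * n + 3 * \sum_(v : G) far v + L * b + leafed_centers <=
  ecc_dist_sum G + 27 * n + 6 * L + centers * (2 * n - 4) + leafed_centers * b.
Proof.
move=> Hb.
have E : \sum_(t : G) lf t * (\sum_(p : G) adj t p * (central p)) = leafed_centers.
  rewrite (eq_bigr (fun t => \sum_(p : G) (central p) * (adj p t * lf t))) => [|t _]; last first.
    by rewrite big_distrr; apply: eq_bigr => p _ /=; rewrite (adj_sym t); case: adj; case: leqP;
      case: eqP.
  by rewrite exchange_big; apply: eq_bigr => p _; rewrite -big_distrr.
have H : \sum_(v : G) (dist_sum v * 3 + lf v * b + (central v) * l v) <=
   \sum_(v : G) (eccentricity v * dist_sum v + (central v) * (2 * n - 4)
     + (lf v * (\sum_(p : G) adj v p * (central p))) * b).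
  apply: leq_sum => v _; have [dv|cv] := eqVneq (degree v) 1.
    have [p vp] := leaf_support dv; have := leaf_ecc conG dv vp (sun_ecc2 p); have := sun_ecc2 p.
    have -> : \sum_(p : G) adj v p * (central p) = central p.
      rewrite -(sum_delta p (fun p => (central p : nat))); apply: eq_bigr => u _.
      by rewrite (leaf_nbr u dv vp).
    rewrite (leaf_nbrs_leaf dv) mul1n; case: (leqP (eccentricity p) 2) => ep; last first.
      by have := Hb v p dv vp; rewrite -ltnNge ep => /(_ isT); nia.
    by move=> ? ?; nia.
  rewrite mul0n; have := sun_ecc2 v; case: (leqP (eccentricity v) 2) => [ev|ev] /=; last by nia.
  by move=> e2; have := dist_sum_ecc2 conG ev; rewrite (core_degree cv) cardG; nia.
rewrite !big_split /= -!big_distrl /= E -/(leaves G) -/leafed_centers -/centers in H.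
have := sun_total; rewrite /ecc_dist_sum; lia.
Qed.

Lemma centers_eq0 : centers = 0 -> leafed_centers = 0.
Proof.
move=> /eqP; rewrite sum_nat_eq0 => /forallP c0; apply: big1 => v _.
by have := c0 v; rewrite implyTb eqb0 => /negPf ->.
Qed.

Lemma centers_gt0 : centers <> 0 -> exists v, central v.
Proof.
move=> /eqP; rewrite sum_nat_eq0 negb_forall => /existsP[v].
by rewrite implyTb eqb0 negbK; exists v.
Qed.

Lemma leafed_exists : 0 < L -> exists p, l p = 1.
Proof.
rewrite -sum_leaf_nbrs lt0n sum_nat_eq0 negb_forall => /existsP[p /=].
by have := leaf_nbrs_le1 p; case e : (l p) => [|[|]] // _ _; exists p.
Qed.

Lemma centers_le3 p : l p = 1 -> centers <= 3.
Proof.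
move=> lp; have cp : core p by apply/negP => /eqP/leaf_nbrs_leaf; rewrite lp.
have H : centers <= \sum_(v : G) ((v == p) * 1 + adj p v * core v).
  apply: leq_sum => v _; case: (leqP (eccentricity v) 2) => // cv; rewrite (central_core cv).
  by have [->|pv] := central_leafed cv lp; [rewrite eqxx|rewrite adj_sym pv; lia].
by rewrite big_split /= sum_delta (core_nbrs cp) in H.
Qed.

(** 206 is [6 n^2 - 5 n - 53] and 13 is [4 n - 15], from [leaf_dist_sum_ge]. The same formulas give
    133 and 9 in [sun6]. *)
Lemma sun7 : n = 7 -> 206 < ecc_dist_sum G.
Proof.
move=> en; have L2 := sun_leaves.
have B := sun_bound (b := 13).
have /B : forall t p, degree t = 1 -> adj t p -> ~~ central p -> 13 <= dist_sum t.
  by move=> t p dt _ _; have := leaf_dist_sum_ge dt; lia.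
rewrite en in L2 *; have [c0|] := eqVneq centers 0; first by rewrite c0 (centers_eq0 c0); lia.
move=> /eqP/centers_gt0[v cv]; have nL := central_card cv; have eL := central_leaves cv.
have [p lp] : exists p, l p = 1 by apply: leafed_exists; lia.
have := centers_le3 lp; have := leafed_centers_le; lia.
Qed.

Lemma two_leafed : 1 < L -> exists p q, [/\ p != q, l p = 1 & l q = 1].
Proof.
move=> L1; have E : L = #|[set p | l p == 1]|.
  rewrite -sum_leaf_nbrs -sum1dep_card [RHS]big_mkcond; apply: eq_bigr => p _.
  by have := leaf_nbrs_le1 p; case: (l p) => [|[|]].
by move: L1; rewrite E => /card_gt1P[p [q []]]; rewrite !inE => /eqP ? /eqP ? ?; exists p, q.
Qed.

(** If [p] and [q] are adjacent, a third central vertex would close a triangle with them. If not,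
    neither is central, and the centers are among the two cycle neighbours of [p]. *)
Lemma centers_le2 p q : n = 6 -> L = 2 -> p != q -> l p = 1 -> l q = 1 -> centers <= 2.
Proof.
move=> en eL pq lp lq; have cp : core p by apply/negP => /eqP/leaf_nbrs_leaf; rewrite lp.
have [apq|apq] := boolP (adj p q).
  have H : centers <= \sum_(v : G) ((v == p) * 1 + (v == q) * 1).
    apply: leq_sum => v _; case: (leqP (eccentricity v) 2) => // cv; case: (eqVneq v p) => // vp;
      case: (eqVneq v q) => // vq.
    have [/eqP|av] := central_leafed cv lp; first by rewrite eq_sym (negPf vp).
    have [/eqP|bv] := central_leafed cv lq; first by rewrite eq_sym (negPf vq).
    by have := central_triangle cv av bv apq; have := central_leaves cv; lia.
  by rewrite big_split /= !sum_delta in H.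
rewrite -(core_nbrs cp); apply: leq_sum => v _; case: (leqP (eccentricity v) 2) => // cv;
  rewrite (central_core cv) muln1.
have [vp|] := central_leafed cv lp; last by rewrite adj_sym => ->.
have [vq|] := central_leafed cv lq; first by rewrite vp vq eqxx in pq.
by rewrite -vp (negPf apq).
Qed.

Lemma sun6 : n = 6 -> 133 <= ecc_dist_sum G /\ (ecc_dist_sum G = 133 -> L = 1).
Proof.
move=> en; have L2 := sun_leaves.
have B := sun_bound (b := 9).
have /B : forall t p, degree t = 1 -> adj t p -> ~~ central p -> 9 <= dist_sum t.
  by move=> t p dt _ _; have := leaf_dist_sum_ge dt; lia.
have Jle := leafed_centers_le.
rewrite en in L2 *; have [c0|] := eqVneq centers 0; first by rewrite c0 (centers_eq0 c0); lia.
move=> /eqP/centers_gt0[v cv]; have nL := central_card cv; have eL := central_leaves cv.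
have [p lp] : exists p, l p = 1 by apply: leafed_exists; lia.
have K3 := centers_le3 lp.
have [e1|e1] := eqVneq L 1; first by lia.
have [e2|e2] := eqVneq L 2.
  have [|a [b [ab la lb]]] := two_leafed; first by lia.
  by have := centers_le2 en e2 ab la lb; lia.
move=> _; have e3 : L = 3 by lia.
(* With three leaves, a leaf contributes at least [3 * 11 = 17 + 16] and a cycle vertex at least
   [2 (8 - l u)]. *)
have H : \sum_(u : G) (lf u * 17 + 16) <= \sum_(u : G) (eccentricity u * dist_sum u + l u * 2).
  apply: leq_sum => u _; have := sun_ecc2 u; have := dist_sum_ge2 conG u; rewrite cardG en.
  have [du|cu] := eqVneq (degree u) 1; last by rewrite (core_degree cu); nia.
  have [t ut] := leaf_support du; have := leaf_ecc conG du ut (sun_ecc2 t); have := sun_ecc2 t.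
  have := leaf_dist_sum conG du ut; have := dist_sum_ge2 conG t.
  rewrite (core_degree (leaf_support_core du ut)) (support_leaf_nbrs du ut) cardG en.
  by move=> *; rewrite mul1n; nia.
rewrite !big_split /= -!big_distrl sum_const cardG en /= sum_leaf_nbrs e3 -/(leaves G) e3 in H.
rewrite /ecc_dist_sum; lia.
Qed.

(** 372 is the bound for [m = 4] lowered by the slack 5. A central vertex here carries a leaf, has
    two leafed neighbours and lies in no triangle, which makes it the only central vertex. *)
Lemma sun8 : n = 8 -> 372 <= ecc_dist_sum G.
Proof.
move=> en; have L2 := sun_leaves.
have B17 := sun_bound (b := 17).
have {}/B17 B17 : forall t p, degree t = 1 -> adj t p -> ~~ central p -> 17 <= dist_sum t.
  by move=> t p dt _ _; have := leaf_dist_sum_ge dt; lia.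
have [c0|] := eqVneq centers 0.
  have e3 v : 3 <= eccentricity v.
    rewrite ltnNge; apply/negP => cv; move/eqP: c0; rewrite sum_nat_eq0 => /forallP/(_ v).
    by rewrite cv.
  rewrite c0 (centers_eq0 c0) in B17.
  have [L0|Lpos] := posnP L; first by have := sun_all4 e3; rewrite L0 en => /(_ isT); lia.
  have [p lp] := leafed_exists Lpos.
  have [t dt tp] : exists2 t, degree t = 1 & adj t p by apply: leaf_nbrs_gt0; rewrite lp.
  have := far_ge2 (leaf_ecc4 dt tp (e3 p)); rewrite en in L2 B17 *; lia.
move=> /eqP/centers_gt0[v cv]; have nL := central_card cv; have eL := central_leaves cv.
have lv := leaf_nbrs_le1 v; have hv := leafed_nbrs_le2 (central_core cv).
have notri a b : adj v a -> adj v b -> adj a b -> False.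
  by move=> va vb ab; have := central_triangle cv va vb ab; lia.
have K1 : centers = 1.
  rewrite -(sum_delta v (fun _ => 1)); apply: eq_bigr => v' _; rewrite muln1.
  have [->|vv'] := eqVneq v' v; first by rewrite cv.
  case: (leqP (eccentricity v') 2) => // cv'; exfalso; have nL' := central_card cv';
    have eL' := central_leaves cv'.
  have lv' := leaf_nbrs_le1 v'; have hv' := leafed_nbrs_le2 (central_core cv').
  have [/eqP|avv] := central_leafed cv (p := v') ltac:(lia); first by rewrite (negPf vv').
  have : 1 < #|[set p | adj v p && (l p == 1)]|.
    have <- : h v = #|[set p | adj v p && (l p == 1)]|; last by lia.
    rewrite /leafed_nbrs -sum1dep_card [RHS]big_mkcond; apply: eq_bigr => p _.
    by have := leaf_nbrs_le1 p; case: adj; case: (l p) => [|[|]].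
  move=> /card_gt1P[a [b []]]; rewrite !inE => /andP[va /eqP la] /andP[vb /eqP lb] ab.
  wlog av' : a b va la vb lb ab / a != v'.
    move=> W; have [e|] := eqVneq a v'; last exact: (W a b).
    by apply: (W b a) => //; rewrite -?e eq_sym.
  have [/eqP|aav'] := central_leafed cv' la; first by rewrite (negPf av').
  exact: (notri v' a).
have J1 : leafed_centers = 1.
  have : leafed_centers <= centers.
    by apply: leq_sum => u _; have := leaf_nbrs_le1 u; case: (central u); lia.
  have : l v <= leafed_centers by rewrite /leafed_centers (bigD1 v) //= cv mul1n leq_addr.
  lia.
(* One more than [4 n - 15]: a non-central support has at most one leafed neighbour, since another
   one besides [v] would close a triangle at [v]. *)
have B := sun_bound (b := 18).
have {}/B B : forall t p, degree t = 1 -> adj t p -> ~~ central p -> 18 <= dist_sum t.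
  move=> t p dt tp ncp; have cp := leaf_support_core dt tp.
  have lp := support_leaf_nbrs dt tp.
  have pv : p != v by apply: contraNneq ncp => ->.
  have avp : adj v p by case: (central_leafed cv lp) pv => [->|//]; rewrite eqxx.
  have hp : h p <= 1.
    rewrite -(sum_delta v (fun _ => 1)); apply: leq_sum => q _.
    case pq : (adj p q) => //; have := leaf_nbrs_le1 q; case e : (l q) => [|[|]] // _.
    have [//|qv] := eqVneq q v; exfalso.
    by have [/eqP|avq] := central_leafed cv e; [rewrite (negPf qv)|apply: (notri p q)].
  have := leaf_dist_sum conG dt tp; have := dist_sum_ge3 conG p.
  by rewrite (core_walks2 cp) (core_degree cp) cardG; lia.
have [p [q [pq lp lq]]] : exists p q, [/\ p != q, l p = 1 & l q = 1] by apply: two_leafed; lia.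
wlog pv : p q pq lp lq / p != v.
  move=> W; have [e|] := eqVneq p v; last exact: (W p q).
  by apply: (W q p) => //; rewrite -?e eq_sym.
have [t dt tp] : exists2 t, degree t = 1 & adj t p by apply: leaf_nbrs_gt0; rewrite lp.
have e3 : 3 <= eccentricity p.
  rewrite ltnNge; apply/negP => cp; have : (central p) + (central v) <= centers.
    by rewrite /centers (bigD1 v) //= (bigD1 p) //= addnCA addnA leq_addr.
  by rewrite cp cv K1.
have := far_ge2 (leaf_ecc4 dt tp e3); rewrite K1 J1 in B; rewrite en in B L2 nL; lia.
Qed.

End SmallSun.

End Sun.

(** * The graphs with a vertex of degree n - m + 1 *)

Section Extremal.
Variable G : sgraph.
Hypothesis conG : connected G.
Variables (n m : nat) (c : G) (p : G -> G) (x y : G).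
Hypotheses (cardG : #|G| = n) (matG : matching_number G = m).
Hypothesis ext : m + degree c = n.+1.
Hypothesis T : bfs_tree c p x y.
Implicit Types u v w : G.

Let R := [set v | (v != c) && ~~ adj c v].

Lemma ext_struct : [/\ forall r, r \in R -> adj c (p r), {in R &, injective p},
  adj c x /\ adj c y, x \notin [set p r | r in R] & y \notin [set p r | r in R]].
Proof.
have e : matching_number G + degree c = #|G|.+1 by rewrite matG cardG.
have [h1 h2 h3 h4] := extremal_structure conG e T.
by have [_ _ h5 h6] := extremal_structure conG e (bfs_tree_sym T).
Qed.

Lemma ext_neq v : adj c v -> (v == c) = false.
Proof. by apply: contraTF => /eqP ->; rewrite adj_irr. Qed.

Lemma ext_R v : v \in R -> (v == c) = false /\ adj c v = false.
Proof. by rewrite inE => /andP[/negPf -> /negPf ->]. Qed.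

Lemma ext_dist v : dist v c = if v == c then 0 else if adj c v then 1 else 2.
Proof.
have [->|vc] := eqVneq v c; first exact: distxx.
have [h1 _ _ _ _] := ext_struct.
case cv : (adj c v); first by apply/eqP; rewrite (dist_eq1 conG) adj_sym.
have [tP _ _ _ _] := T; have [_ ->] := tP v vc; congr S; apply/eqP.
by rewrite (dist_eq1 conG) adj_sym h1 // inE vc cv.
Qed.

Lemma ext_ecc : eccentricity c <= 2.
Proof. by rewrite ecc_le_dist; apply/forallP => v; rewrite ext_dist; case: eqP => //;
  case: adj. Qed.

Lemma ext_cardR : #|R| + 2 = m.
Proof. by have := nonnbr_card c; rewrite cardG -/R; lia. Qed.

(* The excess of the path from [u] to [v] through the centre [c] over a shortest one. *)
Definition pair_fix u v := (u == v) * (2 * dist v c) + (u == x) * (v == y) + (u == y) * (v == x)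
  + (u \in R) * (p u == v) * 2 + (v \in R) * (p v == u) * 2.

(** Each branch is a neighbour of [c] with at most one child, and the extra edge links the
    one-vertex branches of [x] and [y]; all other pairs from different branches meet through [c]. *)
Lemma ext_pair u v : dist u v + pair_fix u v = dist u c + dist v c.
Proof.
have [h1 h2 [cx cy] h4 h5] := ext_struct; have [tP xy _ _ _] := T.
have nx : x \notin R by rewrite inE cx andbF.
have ny : y \notin R by rewrite inE cy andbF.
have xny : (x == y) = false by apply: contraTF xy => /eqP ->; rewrite adj_irr.
have pN r : r \in R -> p r \notin R by move=> /h1 cr; rewrite inE cr andbF.
have pneq r : r \in R -> (p r == r) = false.
  by move=> rR; apply: contraNF (pN r rR) => /eqP ->.
have px r : r \in R -> (p r == x) = false.
  by move=> rR; apply: contraNF h4 => /eqP <-; apply: imset_f.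
have py r : r \in R -> (p r == y) = false.
  by move=> rR; apply: contraNF h5 => /eqP <-; apply: imset_f.
have Rx r : r \in R -> (r == x) = false by move=> rR; apply: contraNF nx => /eqP <-.
have Ry r : r \in R -> (r == y) = false by move=> rR; apply: contraNF ny => /eqP <-.
have pd r : r \in R -> dist r (p r) = 1.
  move=> rR; have [rc _] := ext_R rR; apply/eqP; rewrite (dist_eq1 conG).
  by have [] := tP r (negbT rc).
have dR r : r \in R -> dist r c = 2 by move=> rR; rewrite ext_dist; have [-> ->] := ext_R rR.
have dN v' : adj c v' -> dist v' c = 1 by move=> cv; rewrite ext_dist cv ext_neq.
have br v' : v' != c -> branch c p v' = if v' \in R then p v' else v'.
  by move=> vc; rewrite /branch inE vc; case: (adj c v').
rewrite /pair_fix; have [->|uv] := eqVneq u v.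
  rewrite distxx; case vR : (v \in R); first by rewrite pneq // (Rx v) // (Ry v) //; clear; lia.
  by have [->|_] := eqVneq v x; rewrite ?xny ?muln0; clear; lia.
have [uR|uR] := boolP (u \in R).
  rewrite (Rx u) // (Ry u) //; have [<-|ne] := eqVneq (p u) v.
    by rewrite (negPf (pN u uR)) pd // (dR u) // dN ?h1 //; clear; lia.
  have [vR|vR] := boolP (v \in R).
    have -> : (p v == u) = false.
      by apply: contraNF (pN v vR) => /eqP ->.
    have [uc _] := ext_R uR; have [vc _] := ext_R vR.
    have := dist_unlinked conG T ext_ecc (negbT uc) (negbT vc).
    rewrite !br ?uc ?vc // uR vR /linked !br ?ext_neq // (negPf nx) (negPf ny) (px u) // (py u) //
      => H.
    have pp : p u != p v by apply: contraNneq uv => /h2 ->.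
    have := H pp isT; have := dist_tri conG u c v; rewrite (dist_sym conG c v); clear; lia.
  have [->|vc] := eqVneq v c; first by rewrite distxx.
  have [uc _] := ext_R uR.
  have := dist_unlinked conG T ext_ecc (negbT uc) vc.
  rewrite !br ?uc ?vc // uR (negPf vR) /linked !br ?ext_neq // (negPf nx) (negPf ny) (px u) // (py
    u) // => /(_ ne isT).
  have := dist_tri conG u c v; rewrite (dist_sym conG c v); clear; lia.
have [vR|vR] := boolP (v \in R).
  rewrite (Rx v) // (Ry v) //; have [<-|ne] := eqVneq (p v) u.
    by rewrite (dist_sym conG) pd // (dR v) // dN ?h1 //; clear; lia.
  have [->|uc] := eqVneq u c; first by rewrite (dist_sym conG) distxx; clear; lia.
  have [vc _] := ext_R vR.
  have := dist_unlinked conG T ext_ecc uc (negbT vc).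
  rewrite !br ?uc ?vc // vR (negPf uR) /linked !br ?ext_neq // (negPf nx) (negPf ny) (px v) // (py
    v) // !andbF eq_sym => /(_ ne isT).
  have := dist_tri conG u c v; rewrite (dist_sym conG c v); clear; lia.
have [->|uc] := eqVneq u c.
  by rewrite (dist_sym conG) distxx ![c == x]eq_sym ![c == y]eq_sym !(ext_neq cx) !(ext_neq cy);
    clear; lia.
have [->|vc] := eqVneq v c.
  by rewrite distxx ![c == x]eq_sym ![c == y]eq_sym !(ext_neq cx) !(ext_neq cy); clear; lia.
have cu : adj c u by move: uR; rewrite inE uc /= negbK.
have cv : adj c v by move: vR; rewrite inE vc /= negbK.
have := dist_unlinked conG T ext_ecc uc vc.
rewrite !br // (negPf uR) (negPf vR) /linked !br ?ext_neq // (negPf nx) (negPf ny) => /(_ uv).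
have := dist_tri conG u c v; rewrite (dist_sym conG c v) !dN // => le2 ge2.
have [eux|nux] := eqVneq u x.
  have [evy|nvy] := eqVneq v y.
    have -> : dist u v = 1 by apply/eqP; rewrite (dist_eq1 conG) eux evy.
    by rewrite eux xny.
  move: ge2 le2; rewrite eux eqxx (negPf nvy) xny /=; clear; lia.
have [euy|nuy] := eqVneq u y.
  have [evx|nvx] := eqVneq v x.
    by have -> : dist u v = 1 by apply/eqP; rewrite (dist_eq1 conG) euy evx adj_sym.
  by move: ge2 le2; rewrite (negPf nux) (negPf nvx) andbF /=; clear; lia.
by move: ge2 le2; rewrite (negPf nux) (negPf nuy) /=; clear; lia.
Qed.

Definition children v := \sum_(u : G) (u \in R) * (p u == v).

Lemma ext_dist_sum v : dist_sum v + 2 * dist v c + (v == x) + (v == y) + 2 * children v +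
  (v \in R) * 2
  = (\sum_(u : G) dist u c) + n * dist v c.
Proof.
have H : \sum_(u : G) (dist u v + ((u == v) * (2 * dist v c) + (u == x) * (v == y) +
  (u == y) * (v == x)
  + (u \in R) * (p u == v) * 2 + (u == p v) * ((v \in R) * 2))) = \sum_(u : G) (dist u c +
    dist v c).
  apply: eq_bigr => u _; rewrite -ext_pair /pair_fix [p v == u]eq_sym; congr (_ + (_ + _)).
  by rewrite mulnA [_ * (v \in R)]mulnC.
rewrite !big_split /= !sum_delta -!big_distrl sum_const cardG -/(dist_sum v) -/(children v) in H.
move: H; rewrite /=; clear; lia.
Qed.

Lemma ext_root_sum : \sum_(u : G) dist u c = degree c + 2 * #|R|.
Proof.
rewrite /degree -sum1_card big_distrr [in X in _ + X]big_mkcond -big_split;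
  apply: eq_bigr => v _ /=.
by rewrite ext_dist inE; case: eqP => [->|_] /=; rewrite ?adj_irr //; case: adj.
Qed.

Lemma sum_children : \sum_(v : G) children v = #|R|.
Proof.
rewrite exchange_big -sum1_card [RHS]big_mkcond; apply: eq_bigr => u _ /=.
have -> : \sum_(v : G) (u \in R) * (p u == v) = \sum_(v : G) (v == p u) * (u \in R).
  by apply: eq_bigr => v _; rewrite mulnC eq_sym.
by rewrite sum_delta; case: (u \in R).
Qed.

Lemma childrenP r : r \in R -> children (p r) = 1.
Proof.
have [h1 h2 _ _ _] := ext_struct => rR.
rewrite -(sum_delta r (fun _ => 1)); apply: eq_bigr => u _; rewrite muln1.
have [->|ur] := eqVneq u r; first by rewrite rR eqxx.
by case uR : (u \in R) => //; case: eqP => // /h2 e; rewrite e ?eqxx // in ur.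
Qed.

Lemma children_gt0 v : 0 < children v -> exists2 r, r \in R & p r = v.
Proof.
rewrite lt0n sum_nat_eq0 negb_forall => /existsP[r /=].
have [e|_] := eqVneq (p r) v; last by rewrite muln0.
by case rR : (r \in R) => // _; exists r.
Qed.

Lemma children_nbr v : 0 < children v -> adj c v.
Proof. by move=> /children_gt0[r rR <-]; have [h1 _ _ _ _] := ext_struct; apply: h1. Qed.

Lemma children_le1 v : children v <= 1.
Proof. by case: (posnP (children v)) => [->|/children_gt0[r rR <-]] //; rewrite childrenP. Qed.

Lemma ext_far u v : u \in R -> v != u -> p u != v -> dist u v = 2 + dist v c.
Proof.
move=> uR vu pu; have := ext_pair u v; rewrite /pair_fix (ext_dist u).
have [-> ->] := ext_R uR; have [h1 h2 [cx cy] h4 h5] := ext_struct.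
have nx : x \notin R by rewrite inE cx andbF.
have ny : y \notin R by rewrite inE cy andbF.
rewrite eq_sym (negPf vu) (negPf pu) /= muln0.
have -> : (u == x) = false by apply: contraNF nx => /eqP <-.
have -> : (u == y) = false by apply: contraNF ny => /eqP <-.
have -> : (v \in R) * (p v == u) = 0; last by clear; lia.
case vR : (v \in R) => //; case: eqP => // e.
by have := h1 v vR; rewrite e; have [_ ->] := ext_R uR.
Qed.

Lemma ext_ecc_le v : eccentricity v <= 2 + dist v c.
Proof.
rewrite ecc_le_dist; apply/forallP => u; have := ext_pair u v; rewrite (ext_dist u).
by case: eqP => _; [|case: adj]; lia.
Qed.

(** The distance is attained at an element of [R] outside the branch of [v]; the first hypothesis
    provides one when that branch itself meets [R]. *)
Lemma ext_ecc_ge v : (forall r, r \in R -> p r = v \/ r = v -> 1 < #|R|) -> 0 < #|R| ->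
  2 + dist v c <= eccentricity v.
Proof.
move=> H R0.
suff [u [uR vu pu]] : exists u, [/\ u \in R, v != u & p u != v].
  by rewrite -(ext_far uR vu pu) dist_le_ecc.
have [/existsP[u /and3P[uR vu pu]]|none] := boolP [exists u, [&& u \in R, v != u & p u != v]].
  by exists u.
have bad u : u \in R -> p u = v \/ u = v.
  move=> uR; move/existsPn: none => /(_ u); rewrite uR /= negb_and !negbK.
  by case/orP=> /eqP; [right|left].
have [r rR] := card_gt0P R0; have /card_gt1P[a [b [aR bR ab]]] := H r rR (bad r rR).
have [h1 h2 _ _ _] := ext_struct.
have cross u w : u \in R -> w \in R -> p u = v -> w = v -> False.
  by move=> uR wR pu wv; have := h1 u uR; rewrite pu -wv; have [_ ->] := ext_R wR.
case: (bad a aR) (bad b bR) => [pa|ea] [pb|eb].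
- by rewrite (h2 a b aR bR) ?eqxx ?pa // in ab.
- by case: (cross a b).
- by case: (cross b a).
- by rewrite ea eb eqxx in ab.
Qed.

Lemma sum_R : \sum_(v : G) (v \in R) = #|R|.
Proof. by rewrite -sum1_card [RHS]big_mkcond; apply: eq_bigr => v _; case: (v \in R). Qed.

Lemma ext_xy v : [/\ (v == x) <= adj c v, (v == y) <= adj c v & (v \in R) + (v == c) + adj c v = 1].
Proof.
have [_ _ [cx cy] _ _] := ext_struct; split.
- by case: eqP => // ->; rewrite cx.
- by case: eqP => // ->; rewrite cy.
by rewrite inE; case: eqP => [->|_] /=; rewrite ?adj_irr //; case: adj.
Qed.

Lemma ext_value4 : 4 <= m ->
  ecc_dist_sum G + 30 * m + 31 * n = 6 * n * n + m * m + 9 * m * n + 57.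
Proof.
move=> m4; have cR := ext_cardR; have S := ext_root_sum.
have nE : n = degree c + #|R| + 1 by lia.
have mE : m = #|R| + 2 by lia.
set Lam := \sum_(u : G) dist u c in S.
have ee v : eccentricity v = 2 + dist v c.
  apply/eqP; rewrite eqn_leq ext_ecc_le ext_ecc_ge //; last by lia.
  by move=> *; lia.
have H : \sum_(v : G) (eccentricity v * dist_sum v + adj c v * 6 + (v \in R) * 24 +
  (v == x) * 3 + (v == y) * 3 + children v * 6)
  = \sum_(v : G) ((v == c) * (2 * Lam) + adj c v * (3 * (Lam + n)) + (v \in R) * (4 * (Lam +
    2 * n))).
  apply: eq_bigr => v _; have := ext_dist_sum v; rewrite -/Lam ee ext_dist.
  have [] := ext_xy v; have := children_nbr (v := v).
  case: (v == c); case: (adj c v); case: (v \in R) => //= ch; last by move: ch;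
    case: (children v) => [|k] ch; [lia|have := ch isT].
  - by move: ch; case: (children v) => [|k] ch; [lia|have := ch isT].
  - lia.
rewrite !big_split /= !sum_delta -!big_distrl /= sum_R sum_children -/(degree c) in H.
rewrite /ecc_dist_sum; rewrite S in H; move: H; rewrite nE mE; move: (#|R|) (degree c) => b a;
  clear; lia.
Qed.

Lemma ext_R_xy r : r \in R -> [/\ (r == x) = false, (r == y) = false,
  (p r == x) = false & (p r == y) = false].
Proof.
have [h1 h2 [cx cy] h4 h5] := ext_struct => rR.
split; [apply: contraTF cx|apply: contraTF cy|apply: contraNF h4|apply: contraNF h5] => /eqP <-;
  try exact: imset_f.
- by have [_ ->] := ext_R rR.
- by have [_ ->] := ext_R rR.
Qed.

Lemma ext_value3 : m = 3 -> ecc_dist_sum G + 9 * n + 14 = 6 * n * n.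
Proof.
move=> m3; have cR := ext_cardR; have S := ext_root_sum.
set Lam := \sum_(u : G) dist u c in S.
have R1 : #|R| = 1 by lia.
have nE : n = degree c + 2 by lia.
have /card_gt0P[r rR] : 0 < #|R| by lia.
have Rr v : (v \in R) = (v == r).
  have /setP/(_ v) : [set r] = R by apply/eqP; rewrite eqEcard sub1set rR cards1 R1.
  by rewrite inE => <-.
have [h1 h2 [cx cy] _ _] := ext_struct; have cp := h1 r rR; have [rx ry px py] := ext_R_xy rR.
have [rc ncr] := ext_R rR.
have chr v : children v = (v == p r).
  have [->|ne] := eqVneq v (p r); first exact: childrenP.
  by case: (posnP (children v)) => // /children_gt0[r']; rewrite Rr => /eqP -> e;
    rewrite e eqxx in ne.
have lev u : dist u c <= 1 + (u == r).
  by have := Rr u; rewrite inE ext_dist; case: (u == c); case: (adj c u) => //= <-.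
have xR : (x \in R) = false by rewrite inE cx andbF.
(* With a single vertex [r] in [R], both [r] and its parent lack a vertex of [R] in another branch,
   so their eccentricities are one smaller. *)
have ee v : eccentricity v + children v + (v \in R) = 2 + dist v c.
  rewrite chr Rr; have [->|vp] := eqVneq v (p r).
    have -> : (p r == r) = false by apply: contraTF cp => /eqP ->; rewrite ncr.
    rewrite ext_dist cp ext_neq //; suff -> : eccentricity (p r) = 2 by [].
    apply/eqP; rewrite eqn_leq; apply/andP; split.
      rewrite ecc_le_dist; apply/forallP => u; have := ext_pair u (p r);
        rewrite /pair_fix (ext_dist (p r)).
      rewrite cp ext_neq // Rr; have := lev u; case: (eqVneq u r) => [->|ur]; last by clear; lia.
      by rewrite eqxx; clear; lia.
    have := ext_pair x (p r); rewrite /pair_fix !ext_dist cp cx !ext_neq // xR px py.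
    have -> : (p r \in R) = false by rewrite inE cp andbF.
    rewrite eq_sym px => e; have <- : dist x (p r) = 2 by move: e; clear; lia.
    exact: dist_le_ecc.
  have [->|vr] := eqVneq v r.
    rewrite ext_dist rc ncr; suff -> : eccentricity r = 3 by [].
    apply/eqP; rewrite eqn_leq; apply/andP; split.
      rewrite ecc_le_dist; apply/forallP => u; have := ext_pair u r;
        rewrite /pair_fix (ext_dist r) rc ncr.
      by have := lev u; case: (eqVneq u r) => [->|ur]; [rewrite distxx|clear; lia].
    have := ext_pair x r; rewrite /pair_fix !ext_dist cx rc ncr ext_neq // xR rx ry px.
    rewrite eq_sym rx => e; have <- : dist x r = 3 by move: e; clear; lia.
    exact: dist_le_ecc.
  rewrite !addn0; apply/eqP; rewrite eqn_leq ext_ecc_le ext_ecc_ge //; last by rewrite R1.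
  by move=> r'; rewrite Rr => /eqP -> [] /eqP; rewrite eq_sym ?(negPf vp) ?(negPf vr).
have H : \sum_(v : G) (eccentricity v * dist_sum v + adj c v * 6 + (v \in R) * 18 +
  (v == x) * 3 + (v == y) * 3 + children v * (Lam + n + 2))
  = \sum_(v : G) ((v == c) * (2 * Lam) + adj c v * (3 * (Lam + n)) + (v \in R) * (3 * (Lam +
    2 * n))).
  apply: eq_bigr => v _; have := ext_dist_sum v; have := ee v; rewrite -/Lam ext_dist.
  have [] := ext_xy v; have := children_nbr (v := v); have := children_le1 v.
  have : (v == x) + children v <= 1.
    by rewrite chr; have [->|_] := eqVneq v x; [rewrite eq_sym px|case: (v == p r)].
  have : (v == y) + children v <= 1.
    by rewrite chr; have [->|_] := eqVneq v y; [rewrite eq_sym py|case: (v == p r)].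
  case: (v == c); case: (adj c v); case: (v \in R) => //= yc xc c1 ch vx vy _.
  - by move: ch; case: (children v) => [|k] ch; [move: vx vy; clear; lia|have := ch isT].
  - by move: xc yc c1; case: (children v) => [|[|k]] //; clear; [lia|nia].
  - by move: ch; case: (children v) => [|k] ch; [move: vx vy; clear; lia|have := ch isT].
rewrite !big_split /= !sum_delta -!big_distrl /= sum_R sum_children -/(degree c) R1 in H.
rewrite /ecc_dist_sum.
rewrite S R1 in H; move: H; rewrite nE; move: (degree c) => a; clear; lia.
Qed.

Lemma ext_value2 : m = 2 -> 4 <= n -> ecc_dist_sum G + 9 * n = 4 * n * n + 1.
Proof.
move=> m2 n4; have cR := ext_cardR; have S := ext_root_sum.
set Lam := \sum_(u : G) dist u c in S.
have R0 : #|R| = 0 by lia.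
have nE : n = degree c + 1 by lia.
have dc3 : 3 <= degree c by lia.
have RF v : (v \in R) = false.
  by move/eqP: R0; rewrite cards_eq0 => /eqP ->; rewrite inE.
have [_ _ [cx cy] _ _] := ext_struct.
have ch0 v : children v = 0 by apply: big1 => u _; rewrite RF.
have ee v : eccentricity v = 1 + adj c v.
  have lev u : dist u c = (u != c).
    have := RF u; rewrite ext_dist inE; case: eqP => //= _; by case: adj.
  have [->|vc] := eqVneq v c.
    rewrite adj_irr; apply/eqP; rewrite eqn_leq; apply/andP; split.
      by rewrite ecc_le_dist; apply/forallP => u; rewrite lev; case: (u != c).
    by apply: leq_trans (dist_le_ecc x c); rewrite lev ext_neq.
  have cv : adj c v by have := RF v; rewrite inE vc /=; case: adj.
  rewrite cv; apply/eqP; rewrite eqn_leq; apply/andP; split.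
    rewrite ecc_le_dist; apply/forallP => u; have := ext_pair u v; rewrite !lev.
    by case: (u != c); case: (v != c); clear; lia.
  (* Since [c] has at least three neighbours, one of them is neither [v] nor joined to [v] by the
     extra edge; it is at distance 2 from [v]. *)
  have [z [cz zx zy zv]] : exists z, [/\ adj c z, ~~ ((z == x) && (v == y)), ~~ ((z == y) &&
    (v == x)) & z != v].
    have [vx|vx] := eqVneq v x; last first.
      have [vy|vy] := eqVneq v y; last by exists x; rewrite cx !andbF eq_sym vx.
      have : 0 < #|[set u | adj c u] :\ x :\ y|.
        have := cardsD1 x [set u | adj c u]; have := cardsD1 y ([set u | adj c u] :\ x).
        by rewrite -degree_card; move: dc3; clear; lia.
      move=> /card_gt0P[z]; rewrite !inE => /and3P[zy zx cz]; exists z.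
      by rewrite vy (negPf zx) (negPf zy).
    have : 0 < #|[set u | adj c u] :\ x :\ y|.
      have := cardsD1 x [set u | adj c u]; have := cardsD1 y ([set u | adj c u] :\ x).
      by rewrite -degree_card; move: dc3; clear; lia.
    move=> /card_gt0P[z]; rewrite !inE => /and3P[zy zx cz]; exists z.
    by rewrite vx (negPf zx) (negPf zy).
  apply: leq_trans (dist_le_ecc z v); have := ext_pair z v;
    rewrite /pair_fix !lev !RF !(ext_neq cz) !(ext_neq cv) (negPf zv).
  move: zx zy; case: (z == x); case: (v == y); case: (z == y); case: (v == x) => //=; clear; lia.
have H : \sum_(v : G) (eccentricity v * dist_sum v + adj c v * 4 + (v == x) * 2 + (v == y) * 2)
  = \sum_(v : G) ((v == c) * Lam + adj c v * (2 * (Lam + n))).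
  apply: eq_bigr => v _; have := ext_dist_sum v; rewrite -/Lam ee ext_dist RF ch0.
  have [] := ext_xy v; rewrite RF.
  by case: (v == c); case: (adj c v) => //=; clear; lia.
rewrite !big_split /= !sum_delta -!big_distrl /= -/(degree c) in H.
rewrite /ecc_dist_sum.
rewrite S R0 in H; move: H; rewrite nE; move: (degree c) => a; clear; lia.
Qed.

End Extremal.

(** * Isomorphisms with cycles carrying pendant vertices and paths *)

Section CycleAttachIso.
Variables (k a b : nat) (c : 'I_k).
Hypothesis ordS1 : forall i : 'I_k, ordS i != i.
Hypothesis ordS2 : forall i : 'I_k, ordS (ordS i) != i.
Local Notation V := (cycle_attach_vertex k a b).
Local Notation arc := (@cycle_attach_arc k a b c).

Lemma arc_neq (x y : V) : arc x y -> (x != y) && ~~ arc y x.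
Proof.
case: x y => [[i|i]|[i []]] [[j|j]|[j []]] //=.
- move=> /eqP ->; rewrite [i == _]eq_sym ordS2 andbT; apply/eqP => -[e].
  by have := ordS1 i; rewrite -e eqxx.
- by move=> _; rewrite andbT; apply/eqP => -[].
Qed.

Lemma arc_in (y : V) : exists x, arc x y.
Proof.
case: y => [[j|j]|[j []]].
- by exists (inl (inl (ord_pred j))); rewrite /= ord_predK.
- by exists (inl (inl c)); rewrite /= eqxx.
- by exists (inr (j, false)); rewrite /= eqxx.
- by exists (inl (inl c)); rewrite /= eqxx.
Qed.

(** Every vertex has an incoming arc and no arc occurs with its reversal, so there are at least as
    many edges as vertices. *)
Lemma sum_adj_cycle_attach :
  2 * #|V| <= \sum_(x : cycle_attach a b c) \sum_(y : cycle_attach a b c) adj x y.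
Proof.
have le1 : #|V| <= \sum_(x : V) \sum_(y : V) arc x y.
  rewrite exchange_big -sum1_card; apply: leq_sum => y _ /=.
  by have [x xy] := arc_in y; rewrite (bigD1 x) //= xy.
have -> : \sum_(x : cycle_attach a b c) \sum_(y : cycle_attach a b c) adj x y =
  \sum_(x : V) \sum_(y : V) arc x y + \sum_(x : V) \sum_(y : V) arc y x.
  rewrite -big_split; apply: eq_bigr => x _; rewrite -big_split; apply: eq_bigr => y _ /=.
  rewrite /sym_adj; have := @arc_neq x y; have := @arc_neq y x; rewrite (eq_sym y).
  by case: (arc x y) (arc y x) (x != y) => [] [] [] //= h1 h2;
    first [by have := h1 isT | by have := h2 isT].
by rewrite [X in _ + X]exchange_big /= mul2n -addnn leq_add.
Qed.

(* Both graphs have as many edges as vertices, so an arc-preserving bijection reflects adjacency. *)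
Lemma cycle_attach_iso (G : sgraph) (g : V -> G) :
  injective g -> #|G| = #|V| -> \sum_(v : G) degree v = 2 * #|G| ->
  (forall x y, arc x y -> adj (g x) (g y)) -> isomorphic G (cycle_attach a b c).
Proof.
move=> ginj cardG sumdeg garc.
have [f fK gK] : bijective g by apply: inj_card_bij; rewrite // cardG.
exists f; first by exists g.
have pres (x y : cycle_attach a b c) : adj x y -> adj (g x) (g y).
  by move=> /= /andP[_ /orP[] /garc //]; rewrite adj_sym.
move=> x y; suff E (z t : cycle_attach a b c) : adj z t = adj (g z) (g t) by rewrite E !gK.
have tot : \sum_(x : cycle_attach a b c) \sum_(y : cycle_attach a b c) adj (g x) (g y) = 2 * #|V|.
  rewrite -cardG -sumdeg (reindex g) /=; last by exists f => i _; rewrite ?fK ?gK.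
  by apply: eq_bigr => i0 _; rewrite /degree (reindex g) //; exists f => i _; rewrite ?fK ?gK.
rewrite pair_big /= in tot; have := sum_adj_cycle_attach; rewrite pair_big /= -tot => le.
have lei (q : cycle_attach a b c * cycle_attach a b c) :
  adj q.1 q.2 <= adj (g q.1) (g q.2) ?= iff (adj q.1 q.2 == adj (g q.1) (g q.2)).
  have := @pres q.1 q.2; case: (adj q.1 q.2) (adj (g q.1) (g q.2)) => [] [] //= H; by have := H isT.
have [le2 eq2] := leqif_sum (P := predT) (fun q _ => lei q).
move: eq2; rewrite eqn_leq le2 le => /esym/forallP/(_ (z, t))/eqP.
by rewrite /=; case: sym_adj; case: (adj _ _).
Qed.

Lemma degree_center : 2 + a + b <= degree (inl (inl c) : cycle_attach a b c).
Proof.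
pose F (t : V) : nat := sym_adj arc (inl (inl c)) t.
rewrite /degree big_sumType /= big_sumType /=.
have h1 : 2 <= \sum_(i : 'I_k) F (inl (inl i)).
  have ne : ord_pred c != ordS c.
    by apply: contra (ordS2 c) => /eqP e; rewrite -e ord_predK.
  rewrite (bigD1 (ordS c)) //= (bigD1 (ord_pred c)) //= /F /sym_adj /=.
  rewrite eqxx ord_predK eqxx !orbT !andbT.
  have -> : inl (inl c) != inl (inl (ordS c)) :> V.
    by apply/eqP => -[e]; have := ordS1 c; rewrite -e eqxx.
  have -> : inl (inl c) != inl (inl (ord_pred c)) :> V.
    by apply/eqP => -[e]; have := ordS1 c; rewrite {1}e ord_predK eqxx.
  by rewrite addnA leq_addr.
have h2 : \sum_(i : 'I_a) F (inl (inr i)) = a.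
  by rewrite (eq_bigr (fun=> 1)) ?sum1_card ?card_ord // => i _; rewrite /F /sym_adj /= eqxx.
have h3 : b <= \sum_(q : 'I_b * bool) F (inr q).
  have -> : \sum_(q : 'I_b * bool) F (inr q) = \sum_(q : 'I_b * bool) F (inr (q.1,
    q.2)) by apply: eq_bigr => -[].
  rewrite -(pair_bigA _ (fun i j => F (inr (i, j)))) /= -[X in X <= _](card_ord b) -sum1_card.
  by apply: leq_sum => i _; rewrite (bigD1 false) //= /F /sym_adj /= eqxx.
change (2 + a + b <= \sum_(i : 'I_k) F (inl (inl i)) + \sum_(i : 'I_a) F (inl (inr i)) +
  \sum_(q : 'I_b * bool) F (inr q)).
by rewrite h2; apply: leq_add => //; rewrite leq_add2r.
Qed.

Lemma card_cycle_attach : #|V| = k + a + 2 * b.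
Proof. by rewrite !card_sum card_prod card_bool !card_ord mulnC. Qed.

End CycleAttachIso.

Lemma ordS1_3 (i : 'I_3) : ordS i != i. Proof. by case: i => [[|[|[|]]]]. Qed.
Lemma ordS2_3 (i : 'I_3) : ordS (ordS i) != i. Proof. by case: i => [[|[|[|]]]]. Qed.
Lemma ordS1_5 (i : 'I_5) : ordS i != i. Proof. by case: i => [[|[|[|[|[|]]]]]]. Qed.
Lemma ordS2_5 (i : 'I_5) : ordS (ordS i) != i. Proof. by case: i => [[|[|[|[|[|]]]]]]. Qed.

Section ExtremalIso.
Variable G : sgraph.
Hypothesis conG : connected G.
Variables (n m : nat) (c : G) (p : G -> G) (x y : G).
Hypotheses (cardG : #|G| = n) (matG : matching_number G = m).
Hypothesis ext : m + degree c = n.+1.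
Hypothesis T : bfs_tree c p x y.
Hypothesis sumdeg : \sum_(v : G) degree v = 2 * #|G|.

Let R := [set v | (v != c) && ~~ adj c v].
Let P := [set p r | r in R].
Let A0 := [set v | adj c v] :\: P :\: [set x; y].

Lemma extremal_iso : isomorphic G (U_graph n m).
Proof.
have [h1 h2 [cx cy] h4 h5] := ext_struct conG cardG matG ext T; have [tP xy _ _ _] := T.
rewrite -/R -/P in h1 h2 h4 h5.
have xny : x != y by apply: contraTneq xy => ->; rewrite adj_irr.
have cR : #|R| + 2 = m := ext_cardR cardG matG ext.
have cP : #|P| = #|R| by apply: card_in_imset.
have half := matching_number_half G; rewrite matG cardG in half.
have cA : #|A0| = n - 2 * m + 1.
  have sP : P \subset [set v | adj c v].
    by apply/subsetP => _ /imsetP[r rR ->]; rewrite inE h1.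
  have sxy : [set x; y] \subset [set v | adj c v] :\: P.
    by apply/subsetP => v; rewrite in_setD !inE => /orP[]/eqP->; rewrite ?cx ?cy ?h4 ?h5.
  rewrite /A0 cardsD (setIidPr sxy) cardsD (setIidPr sP).
  by rewrite -degree_card cP cards2 xny; lia.
have cR2 : #|R| = m - 2 by lia.
pose g (t : cycle_attach_vertex 3 (n - 2 * m + 1) (m - 2)) : G :=
  match t with
  | inl (inl i) => nth c [:: c; x; y] i
  | inl (inr j) => enum_val (cast_ord (esym cA) j)
  | inr (j, true) => enum_val (cast_ord (esym cR2) j)
  | inr (j, false) => p (enum_val (cast_ord (esym cR2) j))
  end.
have eA j : enum_val (cast_ord (esym cA) j) \in A0 by apply: enum_valP.
have eR j : enum_val (cast_ord (esym cR2) j) \in R by apply: enum_valP.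
have eP j : p (enum_val (cast_ord (esym cR2) j)) \in P by apply: imset_f.
have Pc v : v \in P -> adj c v by case/imsetP=> r rR ->; apply: h1.
have Ac v : v \in A0 -> [/\ adj c v, v \notin P, v != x & v != y].
  by rewrite !inE negb_or => /andP[/andP[-> ->] /andP[-> ->]].
have Rc v : v \in R -> (v != c) && ~~ adj c v by rewrite inE.
have ncc : adj c c = false by rewrite adj_irr.
have P0 v : v \in P -> v \notin R by move=> /Pc cv; rewrite inE cv andbF.
(* [key] recovers the kind of vertex from its image under [g], so injectivity need only be checked
   within each kind. *)
pose key v := if v \in R then 3 else if v \in P then 2 else if v \in A0 then 1 else 0.
have keyg t : key (g t) = match t with inl (inl _) => 0 | inl (inr _) => 1 | inr (_, false) =>
  2 | inr (_, true) => 3 end.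
  case: t => [[i|j]|[j []]]; rewrite /key /=; last first.
  - by rewrite (negPf (P0 _ (eP j))) eP.
  - by rewrite eR.
  - have := eA j => aj; have [cj pj _ _] := Ac _ aj.
    by rewrite aj (negPf pj) inE cj andbF.
  have cP' : c \notin P by apply/negP => /Pc; rewrite adj_irr.
  case: i => [[|[|[|//]]] /= _].
  - by rewrite !inE eqxx adj_irr (negPf cP') !andbF.
  - by rewrite !inE cx (negPf h4) eqxx !andbF.
  - by rewrite !inE cy (negPf h5) eqxx !orbT !andbF.
apply: (@cycle_attach_iso 3 _ _ ord0 ordS1_3 ordS2_3 G g) => //.
- move=> t t' e; have := congr1 key e; rewrite !keyg.
  case: t e => [[i|j]|[j []]]; case: t' => [[i'|j']|[j' []]] //= e _.
  + congr (inl (inl _)); apply/val_inj; move: e.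
    have cx' : c != x by apply: contraTneq cx => <-; rewrite adj_irr.
    have cy' : c != y by apply: contraTneq cy => <-; rewrite adj_irr.
    case: i i' => [[|[|[|//]]] /= _] [[|[|[|//]]] /= _] //= /eqP.
    * by rewrite (negPf cx').
    * by rewrite (negPf cy').
    * by rewrite eq_sym (negPf cx').
    * by rewrite (negPf xny).
    * by rewrite eq_sym (negPf cy').
    * by rewrite eq_sym (negPf xny).
  + by move: e => /enum_val_inj/cast_ord_inj ->.
  + by move: e => /enum_val_inj/cast_ord_inj ->.
  + by move: e => /(h2 _ _ (eR j) (eR j'))/enum_val_inj/cast_ord_inj ->.
- by rewrite card_cycle_attach cardG; lia.
case=> [[i|j]|[j []]] [[i'|j']|[j' []]] //=.
- move=> /eqP ->; case: i => [[|[|[|//]]] /= _] //; by rewrite adj_sym.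
- by move=> /eqP ->; have [? _ _ _] := Ac _ (eA j').
- by move=> /eqP ->; apply: Pc.
- by move=> /eqP ->; have /andP[rc _] := Rc _ (eR j'); have [] := tP _ rc; rewrite adj_sym.
Qed.

End ExtremalIso.

Lemma iso_degree (G H : sgraph) (f : G -> H) : bijective f ->
  (forall x y, adj (f x) (f y) = adj x y) ->
  forall v, degree (f v) = degree v.
Proof.
move=> [g fK gK] fadj v; rewrite /degree (reindex f) /=; last by exists g => i _; rewrite ?fK ?gK.
by apply: eq_bigr => u _; rewrite fadj.
Qed.

Lemma U_graph_degree (G : sgraph) n m : 2 <= m -> 2 * m <= n -> isomorphic G (U_graph n m) ->
  exists c : G, n.+1 <= m + degree c.
Proof.
move=> m2 mn [f bf fadj]; have [g fK gK] := bf; exists (g (inl (inl ord0))).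
rewrite -(iso_degree bf fadj) gK.
apply: (leq_trans _ (leq_add (leqnn m) (@degree_center 3 (n - 2 * m +
  1) (m - 2) ord0 ordS1_3 ordS2_3))); lia.
Qed.

(** * The pentagon with leaves at one vertex *)

Definition pentagon_base : 'I_5 := Ordinal (isT : 1 < 5).

(** The shape of [U'_graph n 3] stated without [n], so that it survives adding a twin leaf. Chords
    of the cycle are ruled out by the edge count in [pentagon_iso]. *)
Definition pendant_pentagon (G : sgraph) : Prop := exists f : 'I_5 -> G,
  [/\ injective f, forall i, adj (f i) (f (ordS i)) &
      forall v, v \notin codom f -> degree v = 1 /\ adj v (f pentagon_base)].

Section Pentagon.
Variable G : sgraph.
Hypothesis conG : connected G.
Variable n : nat.
Hypothesis cardG : #|G| = n.
Hypothesis n6 : 6 <= n.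

Lemma pentagon_iso : \sum_(v : G) degree v = 2 * #|G| -> pendant_pentagon G ->
  isomorphic G (U'_graph n 3).
Proof.
move=> sumdeg [f [finj fadj fout]]; set A := [set v | v \notin codom f].
have cA : #|A| = n - 2 * 3 + 1.
  have := cardsC [set v in codom f]; rewrite cardsE card_codom // card_ord cardG.
  have -> : ~: [set v in codom f] = A by apply/setP => v; rewrite !inE.
  lia.
pose g (t : cycle_attach_vertex 5 (n - 2 * 3 + 1) (3 - 3)) : G :=
  match t with
  | inl (inl i) => f i
  | inl (inr j) => enum_val (cast_ord (esym cA) j)
  (* A dummy value: there are [3 - 3 = 0] pendant paths. *)
  | inr (j, _) => f pentagon_base
  end.
have eA j : enum_val (cast_ord (esym cA) j) \in A by apply: enum_valP.
apply: (@cycle_attach_iso 5 _ _ _ ordS1_5 ordS2_5 G g) => //.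
- case=> [[i|j]|[[] //]] [[i'|j']|[[] //]] //=.
  + by move=> /finj ->.
  + by move=> e; have := eA j'; rewrite -e inE codom_f.
  + by move=> e; have := eA j; rewrite e inE codom_f.
  + by move=> /enum_val_inj/cast_ord_inj ->.
- by rewrite card_cycle_attach cardG; lia.
case=> [[i|j]|[[] //]] [[i'|j']|[[] //]] //=.
- by move=> /eqP ->.
- move=> /eqP ->; have := eA j'; rewrite inE => /fout[_]; by rewrite adj_sym.
Qed.

Lemma iso_pentagon : isomorphic G (U'_graph n 3) -> pendant_pentagon G.
Proof.
move=> [f bf fadj]; have [g fK gK] := bf.
exists (fun i => g (inl (inl i))); split.
- by move=> i j /(can_inj gK) [].
- move=> i; rewrite -fadj !gK /= /sym_adj /= eqxx andbT.
  by apply/eqP => -[e]; have := ordS1_5 i; rewrite -e eqxx.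
move=> v vout; case e : (f v) => [[i|j]|[[] //]].
  by move/negP: vout; case; rewrite -(fK v) e; apply: codom_f.
have nb (t : U'_graph n 3) : adj (f v) t = (t == inl (inl pentagon_base)).
  by rewrite e; case: t => [[i'|j']|[[] //]] /=; rewrite /sym_adj /= ?andbF ?orbF //= eq_sym.
split; last by rewrite -fadj nb gK.
rewrite -(iso_degree bf fadj) /degree (eq_bigr (fun t => (t == inl (inl pentagon_base)) * 1)).
  by rewrite sum_delta.
by move=> t _; rewrite nb muln1.
Qed.

Lemma sum_codom (f : 'I_5 -> G) (F : G -> nat) : injective f ->
  \sum_(v : G) F v = \sum_i F (f i) + \sum_(v | v \notin codom f) F v.
Proof.
move=> finj; rewrite (bigID (fun v => v \in codom f)) /=; congr addn.
rewrite (reindex_onto f (fun v => odflt pentagon_base [pick i | f i == v])) /=; last first.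
  move=> v /codomP[i ->]; case: pickP => [j /eqP //|/(_ i)]; by rewrite eqxx.
apply: eq_bigl => i; rewrite codom_f /=; case: pickP => [j /eqP/finj -> |/(_ i)]; by rewrite eqxx.
Qed.

(** Explicit walks bound all distances from above; the reverse inequality comes from
    [lower_boundsP]. *)
Lemma pentagon_value : pendant_pentagon G -> ecc_dist_sum G + 5 * n + 53 <= 6 * n * n.
Proof.
move=> [f [finj fadj fout]].
pose o k (h : k < 5) : 'I_5 := Ordinal h.
have A (i j : 'I_5) : j = ordS i -> adj (f i) (f j) by move=> ->.
pose f0 := f (@o 0 isT); pose f1 := f pentagon_base; pose f2 := f (@o 2 isT).
pose f3 := f (@o 3 isT); pose f4 := f (@o 4 isT).
have a01 : adj f0 f1 by apply: A; apply: val_inj.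
have a12 : adj f1 f2 by apply: A; apply: val_inj.
have a23 : adj f2 f3 by apply: A; apply: val_inj.
have a34 : adj f3 f4 by apply: A; apply: val_inj.
have a40 : adj f4 f0 by apply: A; apply: val_inj.
have cases v : [\/ v = f0 \/ v = f1, v = f2, v = f3 \/ v = f4 | degree v = 1 /\ adj v f1].
  have [/codomP[[[|[|[|[|[|//]]]]] h] ->]|/fout] := boolP (v \in codom f); last by constructor 4.
  - by constructor 1; left; congr f; apply: val_inj.
  - by constructor 1; right; congr f; apply: val_inj.
  - by constructor 2; congr f; apply: val_inj.
  - by constructor 3; left; congr f; apply: val_inj.
  - by constructor 3; right; congr f; apply: val_inj.
have d1 (u v : G) : adj u v -> dist u v <= 1 by rewrite -(dist_eq1 conG) => /eqP ->.
have d1' (u v : G) : adj u v -> dist v u <= 1 by move=> /d1; rewrite (dist_sym conG).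
have tri (u v w : G) i j : dist u v <= i -> dist v w <= j -> dist u w <= i + j.
  by move=> h1 h2; apply: leq_trans (dist_tri conG u v w) _; apply: leq_add.
have d2 (u v w : G) : adj u v -> adj v w -> dist u w <= 2 /\ dist w u <= 2.
  by move=> uv vw; rewrite (dist_sym conG w); have := tri u v w 1 1 (d1 _ _ uv) (d1 _ _ vw).
have [d02 d20] := d2 _ _ _ a01 a12; have [d13 d31] := d2 _ _ _ a12 a23.
have [d24 d42] := d2 _ _ _ a23 a34; have [d30 d03] := d2 _ _ _ a34 a40.
have [d41 d14] := d2 _ _ _ a40 a01.
have L0 v : adj v f1 -> dist v f0 <= 2 by move=> v1; apply: (tri v f1 f0 1 1);
  [exact: d1|exact: d1'].
have L2 v : adj v f1 -> dist v f2 <= 2 by move=> v1; apply: (tri v f1 f2 1 1);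
  [exact: d1|exact: d1].
have L3 v : adj v f1 -> dist v f3 <= 3 by move=> v1; apply: (tri v f1 f3 1 2); [exact: d1|].
have L4 v : adj v f1 -> dist v f4 <= 3 by move=> v1; apply: (tri v f1 f4 1 2); [exact: d1|].
have e0 : eccentricity f0 <= 2.
  rewrite ecc_le_dist; apply/forallP => v.
  case: (cases v) => [[->|->]|->|[->|->]|[_ /L0 //]]; rewrite ?distxx //;
    first [by apply: leq_trans (d1 _ _ _) _|by apply: leq_trans (d1' _ _ _) _].
have e1 : eccentricity f1 <= 2.
  rewrite ecc_le_dist; apply/forallP => v.
  case: (cases v) => [[->|->]|->|[->|->]|[_ v1]]; rewrite ?distxx //;
    first [by apply: leq_trans (d1 _ _ _) _|by apply: leq_trans (d1' _ _ _) _].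
have e2 : eccentricity f2 <= 2.
  rewrite ecc_le_dist; apply/forallP => v.
  case: (cases v) => [[->|->]|->|[->|->]|[_ /L2 //]]; rewrite ?distxx //;
    first [by apply: leq_trans (d1 _ _ _) _|by apply: leq_trans (d1' _ _ _) _].
have L1 v : adj v f1 -> dist v f1 <= 1 by apply: d1.
have ne1 v : v \notin codom f -> adj v f1 by move=> /fout[].
have e3 : eccentricity f3 <= 3.
  rewrite ecc_le_dist; apply/forallP => v.
  case: (cases v) => [[->|->]|->|[->|->]|[_ /L3 //]]; rewrite ?distxx //;
    first [by apply: leq_trans (d1 _ _ _) _|by apply: leq_trans (d1' _ _ _) _|exact: leq_trans d03
    _|exact: leq_trans d13 _].
have e4 : eccentricity f4 <= 3.
  rewrite ecc_le_dist; apply/forallP => v.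
  case: (cases v) => [[->|->]|->|[->|->]|[_ /L4 //]]; rewrite ?distxx //;
    first [by apply: leq_trans (d1 _ _ _) _|by apply: leq_trans (d1' _ _ _) _|exact: leq_trans d24
    _|exact: leq_trans d14 _].
have eL v : v \notin codom f -> eccentricity v <= 3.
  move=> /ne1 v1; rewrite ecc_le_dist; apply/forallP => u; rewrite (dist_sym conG).
  case: (cases u) => [[->|->]|->|[->|->]|[_ u1]].
  - exact: leq_trans (L0 _ v1) _.
  - exact: leq_trans (L1 _ v1) _.
  - exact: leq_trans (L2 _ v1) _.
  - exact: L3.
  - exact: L4.
  - by apply: leq_trans (tri v f1 u 1 1 (d1 _ _ v1) (d1' _ _ u1)) _.
have sum5 (F : G -> nat) : \sum_i F (f i) = F f0 + F f1 + F f2 + F f3 + F f4.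
  rewrite !big_ord_recl big_ord0 addn0 !addnA /f0 /f1 /f2 /f3 /f4.
  by congr (F (f _) + F (f _) + F (f _) + F (f _) + F (f _)); apply: val_inj.
have cout : \sum_(v | v \notin codom f) 1 = n - 5.
  have := sum_codom (fun=> 1) finj; rewrite sum_const cardG sum_nat_const card_ord; lia.
have Dle (z : G) (k0 k1 k2 k3 k4 k : nat) : dist f0 z <= k0 -> dist f1 z <= k1 -> dist f2 z <= k2 ->
    dist f3 z <= k3 -> dist f4 z <= k4 -> (forall v, adj v f1 -> dist v z <= k) ->
    dist_sum z <= k0 + k1 + k2 + k3 + k4 + (n - 5) * k.
  move=> h0 h1 h2 h3 h4 hk; rewrite /dist_sum (sum_codom (fun v =>
    dist v z) finj) (sum5 (fun v => dist v z)).
  have : \sum_(v | v \notin codom f) dist v z <= (n - 5) * k.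
    by rewrite -cout big_distrl; apply: leq_sum => v /ne1/hk /=; rewrite mul1n.
  by move=> hs; rewrite !leq_add.
have z0 (z : G) : dist z z <= 0 by rewrite distxx.
have D0 := Dle f0 0 1 2 2 1 2 (z0 _) (d1' _ _ a01) d20 d30 (d1 _ _ a40) L0.
have D1 := Dle f1 1 0 1 2 2 1 (d1 _ _ a01) (z0 _) (d1' _ _ a12) d31 d41 L1.
have D2 := Dle f2 2 1 0 1 2 2 d02 (d1 _ _ a12) (z0 _) (d1' _ _ a23) d42 L2.
have D3 := Dle f3 2 2 1 0 1 3 d03 d13 (d1 _ _ a23) (z0 _) (d1' _ _ a34) L3.
have D4 := Dle f4 1 2 2 1 0 3 (d1' _ _ a40) d14 d24 (d1 _ _ a34) (z0 _) L4.
have DL v : v \notin codom f -> dist_sum v <= 2 * n - 1.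
  move=> vout; have [dv v1] := fout v vout; have := leaf_dist_sum conG dv v1; rewrite cardG -/f1.
  by move: D1 n6; clear; lia.
have sL : \sum_(v | v \notin codom f) eccentricity v * dist_sum v <= (n - 5) * (3 * (2 * n - 1)).
  rewrite -cout big_distrl; apply: leq_sum => v vout /=; rewrite mul1n; apply: leq_mul;
    [exact: eL|exact: DL].
rewrite /ecc_dist_sum (sum_codom _ finj) (sum5 (fun v => eccentricity v * dist_sum v)).
have M0 := leq_mul e0 D0; have M1 := leq_mul e1 D1; have M2 := leq_mul e2 D2.
have M3 := leq_mul e3 D3; have M4 := leq_mul e4 D4.
move: M0 M1 M2 M3 M4 sL; rewrite (_ : n = n - 6 + 6); last by lia.
move: (n - 6) => k; clear; rewrite (_ : k + 6 - 5 = k + 1); last by lia.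
rewrite (_ : 2 * (k + 6) - 1 = 2 * k + 11); last by lia.
lia.
Qed.

(** The twin [v'] is a leaf, hence off the cycle, so the common neighbour [w] is the base vertex. *)
Lemma pentagon_twin (v v' w : G) : degree v = 1 -> degree v' = 1 -> adj v w -> adj v' w ->
  v != v' ->
  pendant_pentagon (induced (~: [set v])) -> pendant_pentagon G.
Proof.
move=> dv dv' vw vw' neq [f [finj fadj fout]].
pose h i := val (f i).
have hadj i : adj (h i) (h (ordS i)) := fadj i.
have hinj : injective h by move=> i j /val_inj/finj.
have hv i : h i != v by have := valP (f i); rewrite !inE.
have two i : degree (h i) != 1.
  apply/eqP => di; have := leaf_nbr (h (ord_pred i)) di (hadj i).
  have := hadj (ord_pred i); rewrite ord_predK adj_sym => -> /esym/eqP/hinj e.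
  by have := ordS2_5 (ord_pred i); rewrite ord_predK -e eqxx.
have ncod u : u != v -> forall uS : u \in ~: [set v], u \notin codom h ->
  exist _ u uS \notin codom f.
  by move=> _ uS; apply: contra => /codomP[i e]; apply/codomP; exists i; rewrite /h -e.
have v'S : v' \in ~: [set v] by rewrite !inE eq_sym.
have v'h : v' \notin codom h.
  by apply/negP => /codomP[i e]; have := two i; rewrite -e dv'.
have wE : w = h pentagon_base.
  have [_ a] := fout _ (ncod v' ltac:(by rewrite eq_sym) v'S v'h).
  by apply/esym/eqP; rewrite -(leaf_nbr _ dv' vw').
exists h; split=> // u uh; have [->|uv] := eqVneq u v; first by rewrite -wE.
have uS : u \in ~: [set v] by rewrite !inE.
have [du a] := fout _ (ncod u uv uS uh); split=> //.
rewrite /degree (bigID (mem (~: [set v]))) /= -(degree_induced (exist _ u uS)) du.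
rewrite (eq_bigl (pred1 v)) => [|t]; last by rewrite !inE negbK.
rewrite big_pred1_eq adj_sym (leaf_nbr _ dv vw) wE.
by case: eqP uh => // ->; rewrite codom_f.
Qed.

End Pentagon.

Lemma card_set3 (V : finType) (a b c : V) : #|[set a; b; c]| <= 3.
Proof. by rewrite -setUA cardsU1 cardsU1 cards1; lia. Qed.

Lemma card_set4 (V : finType) (a b c d : V) : #|d |: [set a; b; c]| <= 4.
Proof. by rewrite cardsU1; have := card_set3 a b c; lia. Qed.

(** * Six vertices with one leaf: recognising the pentagon *)

Section SunPentagon.
Variable G : sgraph.
Hypothesis conG : connected G.
Hypothesis cardG : #|G| = 6.
Hypothesis tf : twin_free G.
Hypothesis pf : pendant_path_free G.
Hypothesis sumdeg : \sum_(v : G) degree v = 2 * #|G|.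
Implicit Types (u v w t p a b : G).

Let n3 : 3 <= 6. Proof. by []. Qed.

Let K v := [set u | adj v u && core u].

Lemma card_core_nbrs v : core v -> #|K v| = 2.
Proof.
move=> cv; rewrite -(core_nbrs conG cardG n3 tf pf sumdeg cv) -sum1dep_card [LHS]big_mkcond.
by apply: eq_bigr => u _; case: adj; case: core.
Qed.

Lemma core_nbr_other v a : core v -> core a -> adj v a ->
  exists b, [/\ b != a, core b & K v = [set a; b]].
Proof.
move=> cv ca va; have aK : a \in K v by rewrite inE va ca.
have : #|K v :\ a| = 1 by have := cardsD1 a (K v); rewrite aK card_core_nbrs //; lia.
move=> /eqP/cards1P[b /setP e]; exists b; have := e b; rewrite in_set1 eqxx in_setD1 [_ \in K v]inE
  => /and3P[ba vb cb].
split=> //; apply/esym/eqP; rewrite eqEcard card_core_nbrs // cards2 eq_sym ba andbT.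
by apply/subsetP => u; rewrite !inE => /orP[]/eqP->; rewrite ?va ?vb ?ca ?cb.
Qed.

(** The core is connected; below, this excludes cycles of length 3 and 4, whose vertices would form
    too small a closed set. *)
Lemma core_closed (X : {set G}) p : core p -> p \in X ->
  (forall v, v \in X -> core v -> K v \subset X) -> forall u, core u -> u \in X.
Proof.
move=> cp pX clos u; have [k] := ubnP (dist u p); elim: k u => // k IH u /ltnSE le cu.
have [->//|up] := eqVneq u p; have [t [ct ut e]] := core_desc conG cardG n3 sumdeg cp up.
have /subsetP := clos t (IH t ltac:(by rewrite -e) ct) ct; apply.
by rewrite inE adj_sym ut.
Qed.

Lemma sun6_pentagon : leaves G = 1 -> pendant_pentagon G.
Proof.
move=> L1; have [p lp] : exists p, leaf_nbrs p = 1.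
  by apply: (leafed_exists tf); rewrite L1.
have [t dt tp] : exists2 t, degree t = 1 & adj t p by apply: leaf_nbrs_gt0; rewrite lp.
have leafE u : core u = (u != t).
  move: L1; rewrite leaves_card => /eqP/cards1P[s /setP e].
  have := e t; rewrite !inE dt eqxx => /esym/eqP ->.
  by have := e u; rewrite !inE /core => ->.
have cardC : #|[set u : G | core u]| = 5.
  have := cardsC1 t; rewrite cardG /= => <-; apply: eq_card => u; by rewrite !inE leafE.
have big (X : {set G}) : p \in X -> (forall v, v \in X -> core v -> K v \subset X) -> 5 <= #|X|.
  move=> pX clos; rewrite -cardC; apply/subset_leq_card/subsetP => u; rewrite inE.
  apply: (@core_closed X p) => //; exact: (leaf_support_core conG cardG n3 dt tp).
have cp : core p := leaf_support_core conG cardG n3 dt tp.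
have [a aK] : exists a, a \in K p by apply/card_gt0P; rewrite card_core_nbrs.
move: aK; rewrite inE => /andP[pa ca].
have [b [ba cb Kp]] := core_nbr_other cp ca pa.
have pb : adj p b by have : b \in K p; [rewrite Kp !inE eqxx orbT|rewrite inE => /andP[]].
have ap : adj a p by rewrite adj_sym. have bp : adj b p by rewrite adj_sym.
have [a' [a'p ca' Ka]] := core_nbr_other ca cp ap.
have [b' [b'p cb' Kb]] := core_nbr_other cb cp bp.
have aa' : adj a a' by have : a' \in K a; [rewrite Ka !inE eqxx orbT|rewrite inE => /andP[]].
have bb' : adj b b' by have : b' \in K b; [rewrite Kb !inE eqxx orbT|rewrite inE => /andP[]].
have irr u v : adj u v -> u != v by move=> uv; apply: contraTneq uv => ->; rewrite adj_irr.
have nab : ~~ adj a b.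
  apply/negP => ab; have a'b : a' = b.
    have : b \in K a by rewrite inE ab cb.
    by rewrite Ka !inE (negPf (_ : b != p)) /= => [/eqP|]; rewrite // eq_sym irr.
  have b'a : b' = a.
    have : a \in K b by rewrite inE adj_sym ab ca.
    by rewrite Kb !inE (negPf (_ : a != p)) /= => [/eqP|]; rewrite // eq_sym irr.
  have := big [set p; a; b]; rewrite !inE eqxx => /(_ isT) H.
  have : 5 <= #|[set p; a; b]|; last by move=> /leq_trans/(_ (card_set3 p a b)).
  apply: H => v; rewrite !inE => /orP[/orP[]|] /eqP -> _; rewrite ?Kp ?Ka ?Kb ?a'b ?b'a;
    by apply/subsetP => u; rewrite !inE => /orP[]->; rewrite ?orbT.
have a'b : a' != b by apply: contraNneq nab => <-.
have b'a : b' != a by apply: contraNneq nab => <-; rewrite adj_sym.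
have a'b' : a' != b'.
  apply/eqP => e; have Ka' : K a' = [set a; b].
    apply/esym/eqP; rewrite eqEcard card_core_nbrs // cards2 eq_sym ba andbT.
    by apply/subsetP => u; rewrite !inE => /orP[]/eqP->; rewrite ?ca ?cb adj_sym ?aa' // e bb'.
  have H : 5 <= #|a' |: [set p; a; b]|; last by move: H => /leq_trans/(_ (card_set4 p a b a')).
  apply: big; first by rewrite !inE eqxx orbT.
  move=> v; rewrite !inE => /orP[|/orP[/orP[]|]] /eqP -> _; rewrite ?Kp ?Ka ?Kb ?Ka' -?e;
    by apply/subsetP => u; rewrite !inE => /orP[]->; rewrite ?orbT.
have us : uniq [:: a; p; b; b'; a'].
  rewrite /= !inE !negb_or !andbT (irr _ _ ap) (eq_sym a b) ba (eq_sym a b') b'a (irr _ _ aa').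
  by rewrite (irr _ _ pb) (eq_sym p b') b'p (eq_sym p a') a'p (irr _ _ bb') (eq_sym b a') a'b
    (eq_sym b' a') a'b'.
have eC : [set u in [:: a; p; b; b'; a']] = [set u | core u].
  apply/eqP; rewrite eqEcard cardC cardsE (card_uniqP us) /= andbT.
  by apply/subsetP => u; rewrite !inE => /or4P[||| /orP[]] /eqP ->.
have a'a : adj a' a by rewrite adj_sym.
have [z [za' cz Ka']] := core_nbr_other ca' ca a'a.
have a'z : adj a' z by have : z \in K a'; [rewrite Ka' !inE eqxx orbT|rewrite inE => /andP[]].
have zb' : z = b'.
  have : z \in [set u in [:: a; p; b; b'; a']] by rewrite eC inE.
  rewrite !inE (negPf za') /= => /or4P[] /eqP e //.
  - have : a' \in K p by rewrite inE -e adj_sym a'z.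
    by rewrite Kp !inE (negPf a'b) eq_sym (negPf (irr _ _ aa')).
  - have : a' \in K b by rewrite inE -e adj_sym a'z.
    by rewrite Kb !inE (negPf a'p) (negPf a'b').
  - by rewrite e adj_irr in a'z.
rewrite zb' in a'z.
exists (fun i : 'I_5 => nth p [:: a; p; b; b'; a'] i); split.
- by move=> i j /eqP; rewrite nth_uniq // => /eqP/val_inj.
- by case=> [[|[|[|[|[|//]]]]] h] //=; rewrite adj_sym.
move=> v vout; have vt : v = t.
  apply/eqP; rewrite -[_ == _]negbK -leafE; apply/negP => cv.
  have : v \in [set u in [:: a; p; b; b'; a']] by rewrite eC inE.
  rewrite inE => /(nthP p)[i lt e]; move/negP: vout; apply.
  by apply/codomP; exists (Ordinal (lt : i < 5)); rewrite /= e.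
by rewrite vt.
Qed.

End SunPentagon.

Section Extremals.
Variable G : sgraph.
Hypothesis conG : connected G.
Hypothesis sumdeg : \sum_(v : G) degree v = 2 * #|G|.
Variables (n m : nat) (c : G).
Hypotheses (cardG : #|G| = n) (matG : matching_number G = m).
Hypothesis large : n.+1 <= m + degree c.

Lemma large_eq : m + degree c = n.+1.
Proof. by have := degree_bound conG sumdeg c; rewrite matG cardG; lia. Qed.

Lemma large_iso : isomorphic G (U_graph n m).
Proof.
by have [p [x [y T]]] := bfs_treeP conG sumdeg c; apply: (extremal_iso conG cardG matG large_eq T
  sumdeg).
Qed.

Lemma large_value2 : m = 2 -> 4 <= n -> ecc_dist_sum G + 9 * n = 4 * n * n + 1.
Proof.
by have [p [x [y T]]] := bfs_treeP conG sumdeg c; apply: (ext_value2 conG cardG matG large_eq T).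
Qed.

Lemma large_value3 : m = 3 -> ecc_dist_sum G + 9 * n + 14 = 6 * n * n.
Proof.
by have [p [x [y T]]] := bfs_treeP conG sumdeg c; apply: (ext_value3 conG cardG matG large_eq T).
Qed.

Lemma large_value4 : 4 <= m -> ecc_dist_sum G + 30 * m + 31 * n = 6 * n * n + m * m + 9 * m * n +
  57.
Proof.
by have [p [x [y T]]] := bfs_treeP conG sumdeg c; apply: (ext_value4 conG cardG matG large_eq T).
Qed.

End Extremals.

(** * Induction *)

(* The slack 5 covers n = 8, m = 4, where the bound of part (iii) fails; the induction only needs
   the weaker bound for the smaller graph. *)
Definition lower_bounds (G : sgraph) (n m xi : nat) : Prop :=
  (m = 3 -> 6 * n * n <= xi + 5 * n + 53 /\ (xi + 5 * n + 53 = 6 * n * n -> pendant_pentagon G)) /\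
  (4 <= m -> 6 * n * n + m * m + 9 * m * n + 57 <= xi + 30 * m + 31 * n + 5 /\
    (9 <= n -> 6 * n * n + m * m + 9 * m * n + 57 < xi + 30 * m + 31 * n)).

(** Here [k = n - 2], and [q] is the matching number after deletion, known only to be at least
    [m - 1]; [mono] says that the bound increases in this parameter. *)
Lemma path_arith k m a b d q : b + 53 * k.+2 <= a + 20 * d + 115 ->
  6 * k * k + q * q + 9 * q * k + 57 <= b + 30 * q + 31 * k + 5 -> m <= q.+1 -> 5 <= m ->
  2 * q <= k -> d + m <= k.+2 ->
  6 * k.+2 * k.+2 + m * m + 9 * m * k.+2 + 57 < a + 30 * m + 31 * k.+2.
Proof.
move=> gn W; case: m => // l; rewrite !ltnS => lq l4 qk dk.
have mono : l * l + 9 * l * k + 30 * q <= q * q + 9 * q * k + 30 * l.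
  have -> : q = l + (q - l) by lia.
  by move: (q - l) => r; nia.
by move: gn W dk mono; clear; lia.
Qed.

Section Step.
Variable G : sgraph.
Hypothesis conG : connected G.
Hypothesis sumdeg : \sum_(v : G) degree v = 2 * #|G|.
Variables (n m : nat).
Hypotheses (cardG : #|G| = n) (matG : matching_number G = m).
Hypothesis small : forall v : G, degree v + m <= n.
Hypothesis m3 : 3 <= m.
Hypothesis IH : forall H : sgraph, #|H| < n -> connected H ->
  \sum_(v : H) degree v = 2 * #|H| -> (forall v : H, degree v + matching_number H <= #|H|) ->
  lower_bounds H #|H| (matching_number H) (ecc_dist_sum H).

Let xi := ecc_dist_sum G.

Lemma step_half : 2 * m <= n.
Proof. by have := matching_number_half G; rewrite cardG matG. Qed.

Lemma step_ecc2 (v : G) : 2 <= eccentricity v.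
Proof. by apply: (ecc_ge2 conG); rewrite cardG; have := small v; lia. Qed.

Lemma step_nontriv : 1 < #|G|.
Proof. by rewrite cardG; have := step_half; lia. Qed.

(** The smaller graph may have a vertex of degree too large for the induction hypothesis; it is then
    extremal and its exact value is used. *)
Lemma weak_bound (H : sgraph) : #|H| < n -> connected H ->
  \sum_(v : H) degree v = 2 * #|H| -> 4 <= matching_number H ->
  6 * #|H| * #|H| + matching_number H * matching_number H + 9 * matching_number H * #|H| + 57
    <= ecc_dist_sum H + 30 * matching_number H + 31 * #|H| + 5.
Proof.
move=> lt cH sH m4.
have [/forallP sm|] := boolP [forall v : H, degree v + matching_number H <= #|H|].
  by have [_ /(_ m4)[]] := IH lt cH sH sm.
rewrite negb_forall => /existsP[c]; rewrite -ltnNge addnC => lc.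
by have := large_value4 cH sH (erefl _) (erefl _) lc m4; lia.
Qed.

Section Twin.
Variables v v' w : G.
Hypotheses (dv : degree v = 1) (dv' : degree v' = 1) (vw : adj v w) (vw' : adj v' w) (vv' : v !=
  v').

Let H := induced (~: [set v]).

Lemma twin_facts : [/\ #|H| = n - 1, connected H, \sum_(u : H) degree u = 2 * #|H| &
  matching_number H = m].
Proof.
have cH : #|H| = n - 1 by rewrite card_induced cardsC1 cardG subn1.
split=> //.
- exact: (connected_induced conG (leaf_descent conG dv vw)).
- have E := sum_degree_induced [set v]; rewrite -/H !big_set1 dv adj_irr sumdeg cardG in E.
  by rewrite cH; have hm := step_half; lia.
apply/eqP; rewrite eqn_leq -{1}matG matching_number_induced -matG.
exact: (matching_remove_twin dv dv' vw vw' vv').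
Qed.

(** From [n - 1] to [n] the bound grows by [12 n + 9 m - 37], so with the slack 5 the deletion must
    gain more than [12 n + 9 m - 32]. *)
Lemma twin_step4 : 4 <= m -> 6 * n * n + m * m + 9 * m * n + 57 < xi + 30 * m + 31 * n.
Proof.
move=> m4; have [cH conH sH mH] := twin_facts; have hm := step_half; have dw := small w.
have := weak_bound _ conH sH; rewrite mH cH => /(_ ltac:(lia) m4) W.
have nE : n = (n - 1).+1 by lia.
have [e3|e2] := leqP 3 (eccentricity w).
  have gn := leaf_gain_far conG cardG dv vw step_ecc2 e3.
  rewrite -/H -/xi in gn; move: W gn dw hm; rewrite nE subn1 /=; move: (n - 1) => k.
  by clear -m4; move: xi (ecc_dist_sum H) (degree w) => a b d; lia.
have gn := leaf_gain_near conG cardG dv vw step_ecc2.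
have S0 : #|[set u | adj w u && (eccentricity u <= 2)]| = 0.
  apply/eqP; rewrite cards_eq0; apply/eqP/setP => u; rewrite !inE; apply/negP => /andP[wu eu].
  by have := adjacent_centers conG sumdeg wu e2 eu; rewrite matG; lia.
have cR := nonnbr_card w; rewrite cardG in cR.
(* Without the bonus from eccentricity 4 one has [m = 4] and [degree w <= n - 5], which gives
   [12 n + 5], just above the required [12 n + 4]. *)
have B : #|[set r | [&& r != w, ~~ adj w r & 4 <= eccentricity r]]| = #|[set r | (r != w) &&
  ~~ adj w r]| \/
  (m = 4 /\ 4 <= #|[set r | (r != w) && ~~ adj w r]|).
  have [/existsP[r /and3P[rw nr er]]|none] := boolP [exists r, [&& r != w,
    ~~ adj w r & eccentricity r <= 3]].
    by right; rewrite -matG; apply: (far_ecc conG sumdeg e2 rw nr er); rewrite matG.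
  left; apply: eq_card => r; rewrite !inE; move/existsPn: none => /(_ r).
  by case: (r != w) => //=; case: (adj w r) => //=; rewrite -ltnNge => ->.
rewrite S0 -/H -/xi in gn; move: B cR gn W dw hm.
move: #|[set r | _]| #|[set r | _]| => p q; rewrite nE subn1 /=; move: (n - 1) => k.
by clear -m4; move: xi (ecc_dist_sum H) (degree w) => a b d; lia.
Qed.

Lemma twin_step3 : m = 3 -> 6 * n * n <= xi + 5 * n + 53 /\ (xi + 5 * n + 53 = 6 * n * n ->
  pendant_pentagon G).
Proof.
move=> e3; have [cH conH sH mH] := twin_facts; have hm := step_half; have dw := small w.
have nE : n = (n - 1).+1 by lia.
have gain : ecc_dist_sum H + 18 * n <= xi + 6 * degree w + 29 \/ ecc_dist_sum H + 21 * n <= xi +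
  9 * degree w + 21.
  have [e|e] := leqP 3 (eccentricity w); first by right;
    apply: (leaf_gain_far conG cardG dv vw step_ecc2 e).
  left; have := leaf_gain_near conG cardG dv vw step_ecc2; rewrite -/H -/xi.
  have := card_adjacent_centers conG sumdeg e; rewrite cardG => /(_ ltac:(lia)); lia.
have [/forallP sm|] := boolP [forall u : H, degree u + matching_number H <= #|H|].
  have ltH : #|H| < n by rewrite cH; lia.
  have [b3 _] := IH ltH conH sH sm; have [le eq] := b3 (etrans mH e3).
  rewrite cH in le eq.
  have E : xi + 5 * n + 53 <= 6 * n * n -> ecc_dist_sum H + 5 * (n - 1) +
    53 = 6 * (n - 1) * (n - 1) /\ xi + 5 * n + 53 = 6 * n * n.
    move: gain le dw; rewrite e3 nE subn1 /=; move: (n - 1) => k; clear.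
    by move: xi (ecc_dist_sum H) (degree w) => a b d; lia.
  split; first by rewrite leqNgt; apply/negP => lt; have [_ ex] := E (ltnW lt);
    rewrite ex ltnn in lt.
  move=> ex; have [|eqH _] := E; first by rewrite ex.
  exact: (pentagon_twin dv dv' vw vw' vv' (eq eqH)).
(* Otherwise [H] is extremal. Its vertex [c] has degree [n - 3] and is not [w], so the excess sum
   leaves degree at most 5 for [w], and the gain is ample. *)
rewrite negb_forall => /existsP[c]; rewrite -ltnNge addnC => lc.
have val3 := large_value3 conH sH (erefl _) (erefl _) lc; rewrite mH cH in lc val3.
have {}val3 := val3 e3.
have cv : val c != v by have := valP c; rewrite !inE.
have dc : degree (val c) = degree c + adj (val c) v.
  rewrite degree_induced /degree (bigID (mem (~: [set v]))) /= (sum_setC [set v] (fun u =>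
    (adj (val c) u : nat))).
  by rewrite big_set1.
have cw : val c != w.
  apply/eqP => ec; have := small (val c); rewrite dc ec adj_sym vw e3; lia.
have dcn : degree (val c) + 3 = n.
  have := small (val c); rewrite dc adj_sym (leaf_nbr _ dv vw) (negPf cw); lia.
have nt := step_nontriv; have := excess2_le conG nt sumdeg cw.
have := degreeE conG nt w; have := degreeE conG nt (val c); rewrite cardG => dc' dw' x2.
have d5 : degree w <= 5 by lia.
suff lt : 6 * n * n < xi + 5 * n + 53 by split; [exact: ltnW|move=> e; rewrite e ltnn in lt].
have n6 : 6 <= n by lia.
move: gain val3 d5 n6; rewrite nE subn1 /=; move: (n - 1) => k; clear.
by move: xi (ecc_dist_sum H) (degree w) => a b d; lia.
Qed.

End Twin.

Section Path.
Hypothesis tf : twin_free G.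
Variables v w : G.
Hypotheses (dv : degree v = 1) (vw : adj v w) (dw : degree w = 2).

Lemma path_third : exists2 y, adj w y & y != v.
Proof.
have : 0 < #|[set u | adj w u] :\ v|.
  have := cardsD1 v [set u | adj w u]; rewrite inE adj_sym vw -degree_card dw; lia.
by move=> /card_gt0P[y]; rewrite !inE => /andP[yv wy]; exists y.
Qed.

Lemma path_step : lower_bounds G n m xi.
Proof.
have [y wy yv] := path_third; have hm := step_half; have n3 : 3 <= n by lia.
have Lm := leaves_le_matching conG cardG n3 tf; rewrite matG in Lm.
have smm k : k <= m -> forall u : G, degree u + k <= n by move=> km u; have := small u; lia.
split=> [e3|m4].
  have lt := path_bound3 conG cardG n3 sumdeg dv vw dw wy yv step_ecc2 (smm 3 m3).
  rewrite e3 in Lm hm; have {}lt := lt Lm ltac:(lia); rewrite -/xi in lt.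
  by split; [exact: ltnW|move=> e; rewrite e ltnn in lt].
have [e4|n4] := eqVneq m 4.
  have := path_bound4 conG cardG n3 sumdeg dv vw dw wy yv step_ecc2 (smm 4 m4).
  rewrite e4 in Lm hm *; move=> /(_ Lm ltac:(lia)); rewrite -/xi => -[b1 b2].
  split; [move: b1; clear; lia|move=> n9; move: (b2 n9); clear; lia].
pose H := induced (~: [set v; w]).
have vnw : v != w by apply: contraTneq vw => ->; rewrite adj_irr.
have cH : #|H| = n - 2.
  by have := cardsC [set v; w]; rewrite cards2 vnw cardG card_induced; lia.
have conH : connected H by apply: (connected_induced conG (path_descent conG dv vw dw wy yv)).
have sH : \sum_(u : H) degree u = 2 * #|H|.
  have vw1 : v \notin [set w] by rewrite inE.
  have E := sum_degree_induced [set v; w].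
  rewrite -/H !(big_setU1 _ vw1) !big_set1 !(big_setU1 _ vw1) !big_set1 dv dw sumdeg cardG in E.
  rewrite !adj_irr vw adj_sym vw in E.
  change (\sum_(u : H) degree u + 2 * (1 + 2) = 2 * n + (false + true + (true + false))) in E.
  have h4 : 4 <= n by lia.
  by rewrite cH; move: E h4; clear; move: (\sum_(u : H) degree u) => d; lia.
have mH : m <= (matching_number H).+1 by rewrite -matG; apply: matching_remove_path dv vw.
have dy := small y; have dy3 : degree y + 3 <= n by lia.
have gn := path_gain conG cardG dv vw dw wy yv step_ecc2 dy3; rewrite -/H -/xi in gn.
have hH : 2 * matching_number H <= n - 2 by rewrite -cH matching_number_half.
have m5 : 5 <= m by lia.
have W := weak_bound _ conH sH; rewrite cH in W; have {}W := W ltac:(lia) ltac:(lia).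
have nE : n = (n - 2).+2 by lia.
have fin : 6 * n * n + m * m + 9 * m * n + 57 < xi + 30 * m + 31 * n.
  by have := @path_arith (n - 2) m xi _ (degree y) _ _ W mH m5; rewrite -nE; apply.
split; [by apply: ltnW; apply: leq_trans fin _; rewrite leq_addr|by []].
Qed.

End Path.

Lemma sun_step : twin_free G -> pendant_path_free G -> lower_bounds G n m xi.
Proof.
move=> tf pf; have hm := step_half; have n3 : 3 <= n by lia.
have n6 : 6 <= n by lia.
have [n9|n9] := leqP 9 n.
  have [b4 b3] := sun_large conG cardG n3 tf pf sumdeg n9 hm; rewrite -/xi in b4 b3.
  split=> [_|_]; last by split=> //; apply: ltnW; apply: leq_trans b4 _; rewrite leq_addr.
  by split; [exact: ltnW|move=> e; rewrite e ltnn in b3].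
have [e8|n8] := eqVneq n 8.
  have := sun8 conG cardG n3 tf pf sumdeg n6 e8; rewrite -/xi e8 in hm * => b.
  by split=> [_|m4]; [move: b; clear; lia|have -> : m = 4 by lia]; move: b; clear; lia.
have e3 : m = 3 by lia.
split=> [_|]; last by rewrite e3.
have [e7|n7] := eqVneq n 7.
  by have := sun7 conG cardG n3 tf pf sumdeg n6 e7; rewrite -/xi e7; clear; lia.
have e6 : n = 6 by lia.
have [b eq] := sun6 conG cardG n3 tf pf sumdeg n6 e6; rewrite -/xi in b eq.
rewrite e6; split; first by move: b; clear; lia.
move=> e; have c6 : #|G| = 6 by rewrite cardG.
by apply: (sun6_pentagon conG c6 tf pf sumdeg); apply: eq; move: e; clear; lia.
Qed.

Lemma induction_step : lower_bounds G n m xi.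
Proof.
have [/existsP[v /existsP[v' /existsP[w /and5P[/eqP dv /eqP dv' vw vw' vv']]]]|notwin] :=
  boolP [exists v : G, [exists v' : G, [exists w : G,
    [&& degree v == 1, degree v' == 1, adj v w, adj v' w & v != v']]]].
  split=> [e3|m4]; first exact: (twin_step3 dv dv' vw vw' vv').
  have lt := twin_step4 dv dv' vw vw' vv' m4.
  by split=> //; apply: ltnW; apply: leq_trans lt _; rewrite leq_addr.
have tf : twin_free G.
  move=> v v' w dv dv' vw vw'; apply/eqP; apply: contraT => vv'.
  move/existsPn: notwin => /(_ v)/existsPn/(_ v')/existsPn/(_ w).
  by rewrite dv dv' vw vw' vv'.
have [/existsP[v /existsP[w /and3P[/eqP dv vw /eqP dw]]]|nopath] :=
  boolP [exists v : G, [exists w : G, [&& degree v == 1, adj v w & degree w == 2]]].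
  exact: (path_step tf dv vw dw).
apply: sun_step => // v w dv vw dw.
by move/existsPn: nopath => /(_ v)/existsPn/(_ w); rewrite dv vw dw.
Qed.

End Step.

Lemma lower_boundsP (G : sgraph) : connected G -> \sum_(v : G) degree v = 2 * #|G| ->
  (forall v : G, degree v + matching_number G <= #|G|) -> 3 <= matching_number G ->
  lower_bounds G #|G| (matching_number G) (ecc_dist_sum G).
Proof.
have [k] := ubnP #|G|; elim: k G => // k IH G /ltnSE ltk conG sumdeg small m3.
apply: (induction_step conG sumdeg (erefl _) (erefl _) small m3) => H ltH cH sH smH.
have [m3'|m2] := leqP 3 (matching_number H); first by apply: IH => //; apply: leq_trans ltH ltk.
(* For matching number below 3 both parts of [lower_bounds] are vacuous. *)
by split=> [e|le]; [rewrite e in m2|have := leq_trans le (ltnW m2)].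
Qed.

Lemma small_degree_ge2 (G : sgraph) n : connected G -> #|G| = n ->
  \sum_(v : G) degree v = 2 * #|G| ->
  (forall v : G, degree v + 2 <= n) -> 4 * n * n <= ecc_dist_sum G + 8 * n.
Proof.
move=> conG cardG sumdeg small.
have H : \sum_(v : G) 2 * (2 * n) <= \sum_(v : G) (eccentricity v * dist_sum v + degree v * 2 + 4).
  apply: leq_sum => v _; have e2 : 2 <= eccentricity v by apply: (ecc_ge2 conG); rewrite cardG.
  have := dist_sum_ge2 conG v; rewrite cardG => D.
  have : 2 * dist_sum v <= eccentricity v * dist_sum v by rewrite leq_mul2r e2 orbT.
  by move: D; clear; lia.
rewrite !big_split /= -big_distrl /= !sum_const sumdeg cardG in H.
by rewrite /ecc_dist_sum; move: H; clear; lia.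
Qed.

Lemma extremal_dichotomy (G : sgraph) n m : unicyclic G -> #|G| = n -> matching_number G = m ->
  2 <= m -> 4 <= n ->
  (forall v : G, degree v + m <= n) /\ ~ isomorphic G (U_graph n m) \/
  isomorphic G (U_graph n m) /\
  [/\ m = 2 -> ecc_dist_sum G + 9 * n = 4 * n * n + 1,
      m = 3 -> ecc_dist_sum G + 9 * n + 14 = 6 * n * n &
      4 <= m -> ecc_dist_sum G + 30 * m + 31 * n = 6 * n * n + m * m + 9 * m * n + 57].
Proof.
move=> uG cardG matG m2 n4; have [conG _] := uG; have sumdeg := unicyclic_sum_degree uG.
have half := matching_number_half G; rewrite matG cardG in half.
have [/forallP small|nsmall] := boolP [forall v : G, degree v + m <= n]; [left|right].
  split=> // /(U_graph_degree m2 half)[c]; have := small c; clear; lia.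
move: nsmall; rewrite negb_forall => /existsP[c]; rewrite -ltnNge addnC => lc; split;
  first exact: (large_iso conG sumdeg cardG matG lc).
split=> [e|e|e].
- exact: (large_value2 conG sumdeg cardG matG lc).
- exact: (large_value3 conG sumdeg cardG matG lc).
- exact: (large_value4 conG sumdeg cardG matG lc).
Qed.

Import Order.TTheory GRing.Theory Num.Theory.
Local Open Scope ring_scope.

Theorem theorem3p3 (G : sgraph) (n m : nat)
    (hn : #|G| = n) (hG : unicyclic G) (hm : matching_number G = m)
    (hmn : (2 <= m <= n %/ 2)%N) :
  let N : int := n%:Z in
  let M : int := m%:Z in
  let xi : int := (ecc_dist_sum G)%:Z in
  (m = 2%N ->
     4 * N ^+ 2 - 9 * N + 1 <= xi /\
     (xi = 4 * N ^+ 2 - 9 * N + 1 <-> isomorphic G (U_graph n 2)))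
  /\
  ((m = 3%N -> (n <= 9)%N ->
      6 * N ^+ 2 - 5 * N - 53 <= xi /\
      (xi = 6 * N ^+ 2 - 5 * N - 53 <-> isomorphic G (U'_graph n 3)))
   /\
   (m = 3%N -> (10 <= n)%N ->
      6 * N ^+ 2 - 9 * N - 14 <= xi /\
      (xi = 6 * N ^+ 2 - 9 * N - 14 <-> isomorphic G (U_graph n 3))))
  /\
  ((4 <= m)%N -> (9 <= n)%N ->
     6 * N ^+ 2 + M ^+ 2 + 9 * M * N - 30 * M - 31 * N + 57 <= xi /\
     (xi = 6 * N ^+ 2 + M ^+ 2 + 9 * M * N - 30 * M - 31 * N + 57 <->
        isomorphic G (U_graph n m))).
Proof.
have [conG _] := hG; have sumdeg := unicyclic_sum_degree hG.
have half := matching_number_half G; rewrite hm hn in half.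
have m2 : (2 <= m)%N by case/andP: hmn.
have n4 : (4 <= n)%N by lia.
have dich := extremal_dichotomy hG hn hm m2 n4.
have lower : (3 <= m)%N -> (forall v : G, degree v + m <= n)%N ->
  lower_bounds G n m (ecc_dist_sum G).
  by rewrite -hn -hm => m3 small; apply: lower_boundsP.
move=> N M xi; rewrite !expr2; split; last split; first last.
- move=> m4 n9.
  case: dich => [[small no]|[iso [_ _ v4]]].
    have [_ /(_ m4)[_ /(_ n9) lt]] := lower (ltnW m4) small.
    by split; [rewrite /xi /N /M; lia|split=> // e; move: e; rewrite /xi /N /M; lia].
  by have {}v4 := v4 m4; split; [rewrite /xi /N /M; lia|split=> // _; rewrite /xi /N /M; lia].
- split=> e3 hn9; rewrite ?e3 in dich lower half *.
    have n6 : (6 <= n)%N by lia.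
    case: dich => [[small no]|[iso [_ v3 _]]].
      have [/(_ erefl)[le eq] _] := lower isT small.
      split; first by rewrite /xi /N; lia.
      split=> [e|iso]; first by apply: (pentagon_iso hn n6 sumdeg); apply: eq; move: e;
        rewrite /xi /N; lia.
      by have := pentagon_value conG hn n6 (iso_pentagon iso); rewrite /xi /N; lia.
    have {}v3 := v3 erefl; split; first by rewrite /xi /N; lia.
    split=> [|iso']; first by rewrite /xi /N; lia.
    (* The value of [U_graph n 3] exceeds the pentagon value by [39 - 4 n], positive for [n <= 9],
       so [G] cannot be both. *)
    by have := pentagon_value conG hn n6 (iso_pentagon iso'); rewrite /xi /N; lia.
  case: dich => [[small no]|[iso [_ v3 _]]].
    have [/(_ erefl)[le _] _] := lower isT small.
    by split; [rewrite /xi /N; lia|split=> // e; move: e; rewrite /xi /N; lia].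
  by have {}v3 := v3 erefl; split; [rewrite /xi /N; lia|split=> // _; rewrite /xi /N; lia].
move=> e2; rewrite e2 in dich; case: dich => [[small no]|[iso [v2 _ _]]].
  have lt := small_degree_ge2 conG hn sumdeg small.
  by split; [rewrite /xi /N; lia|split=> // e; move: e; rewrite /xi /N; lia].
by have {}v2 := v2 erefl; split; [rewrite /xi /N; lia|split=> // _; rewrite /xi /N; lia].
Qed.
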